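(* Let $m,n,d$ be positive integers and let $p$ be a positive multiple of $n$. Let $Q$ be a noncommutative multilinear polynomial of degree $d$ in $m$ variables with coefficients in $M_n(\mathbb{C})$ such that $\|Q(\sigma)\|\le1$ for all $\sigma\in\{-1,1\}^m$. Let $\tau:=\max_{i=1,\dots,m}\sum_{S\subseteq\{1,\dots,m\}:\, i\in S}\mathrm{Tr}(\widehat{Q}(S)\widehat{Q}(S)^* )$ be the maximum influence of $Q$, with $\tau>0$. Let $\mathcal{G}$ be a distribution on $M_n(\mathbb{C})$ such that $G\sim\mathcal{G}$ satisfies $\mathbb{E}G=0$ and $\mathbb{E}GG^*=I$, and let $c_2,c_3\ge1$ be such that $\|\mathbb{E}(GG^* )^2\|\le c_2$ and $\|\mathbb{E}(GG^* )^3\|\le c_3$. Then $$\mathbb{E}_{G_i\sim\mathcal{G}\otimes I,\;H_i\sim\mathcal{H}_p}\frac1n\mathrm{Tr}\Big(\max\big(0,|Q^{\iota}\{G_iH_i\}|-1\big)\Big)^2\le(8c_2c_3)^{9d}n^{1/2}\tau^{1/6}+O_{m,n}(\tau^{-1/3}p^{-1/2}).$$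
   Context: A noncommutative multilinear polynomial of degree $d$ in $m$ variables is an expression $Q(X_1,\dots,X_m)=\sum_{S\subseteq\{1,\dots,m\}:|S|\le d}\widehat{Q}(S)\prod_{i\in S}X_i$, where $\widehat{Q}(S)\in M_n(\mathbb{C})$, the $X_i$ are noncommuting $n\times n$ matrix variables, and products are taken in increasing order of the index; the degree is $\max\{|S|:\widehat Q(S)\ne0\}$. Scalars $\sigma_i$ are substituted as $\sigma_i I$, and $Q\{A_i\}$ denotes $Q(A_1,\dots,A_m)$. For $A\in M_n(\mathbb{C})$, $\iota(A)=\begin{pmatrix}A&0\\0&0\end{pmatrix}\in M_p(\mathbb{C})$, and $Q^{\iota}(X_1,\dots,X_m)=\sum_{S}\iota(\widehat{Q}(S))\prod_{i\in S}X_i$ for $p\times p$ matrix variables $X_i$. $|A|=(AA^* )^{1/2}$; $\|A\|$ is the operator norm; $\mathrm{Tr}$ is the unnormalized trace; the real function $t\mapsto(\max(0,t-1))^2$ is applied to the Hermitian matrix $|A|$ by spectral calculus. $G_i\sim\mathcal{G}\otimes I$: $G_i=G_i'\otimes I_{p/n}\in M_p(\mathbb{C})$ with $G_1',\dots,G_m'$ i.i.d. of distribution $\mathcal{G}$. $H_i\sim\mathcal{H}_p$: $H_1,\dots,H_m$ are independent $p\times p$ Haar-distributed random unitary matrices. All these random variables are independent. $a\le O_c(b)$ means that $a\le C(c)b$ for a constant $C(c)>0$ depending on $c$. *)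

(* Defs.v *)
From HB Require Import structures.
From mathcomp Require Import all_boot all_order all_algebra.
From mathcomp Require Import complex.
From mathcomp Require mxtens.
From mathcomp Require Import all_classical all_reals all_analysis.

Set Implicit Arguments.
Unset Strict Implicit.
Unset Printing Implicit Defensive.

Import Order.TTheory GRing.Theory Num.Theory.

Local Open Scope classical_set_scope.
Local Open Scope ring_scope.
Local Open Scope complex_scope.
Local Open Scope sesquilinear_scope.

Section matrices.
Context {R : realType}.

Definition l2norm (n : nat) (x : 'cV[R[i]]_n) : R :=
  Num.sqrt (\sum_(i < n) Normc.normc (x i ord0) ^+ 2).

Definition opnorm (n : nat) (A : 'M[R[i]]_n) : R :=
  sup [set l2norm (A *m x) | x in [set x : 'cV[R[i]]_n | l2norm x <= 1]].

Definition retr (n : nat) (A : 'M[R[i]]_n) : R := complex.Re (\tr A).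

(* Spectral calculus. By orthomx_spectralP, a normal A is equal to
   invmx (spectralmx A) *m diag_mx (spectral_diag A) *m spectralmx A, with
   spectralmx A unitary; the eigenvalues are real if A is Hermitian. *)
Definition spectral_calc (f : R -> R) (n : nat) (A : 'M[R[i]]_n) : 'M[R[i]]_n :=
  invmx (spectralmx A)
  *m diag_mx (map_mx (fun z : R[i] => (f (complex.Re z))%:C) (spectral_diag A))
  *m spectralmx A.

Definition absmx (n : nat) (A : 'M[R[i]]_n) : 'M[R[i]]_n :=
  spectral_calc Num.sqrt (A *m A ^t*).

(* (pid_mx n : 'M_(p, n)) is the identity on top of zeros when n <= p, so that
   iotamx p A has A as its upper left block and is zero elsewhere. *)
Definition iotamx (n p : nat) (A : 'M[R[i]]_n) : 'M[R[i]]_p :=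
  (pid_mx n : 'M[R[i]]_(p, n)) *m A *m (pid_mx n : 'M[R[i]]_(n, p)).

Definition ampliation (n k : nat) (A : 'M[R[i]]_n) : 'M[R[i]]_(n * k) :=
  mxtens.tensmx A (1%:M : 'M[R[i]]_k).

End matrices.

Section ncpoly.
Context {R : realType}.

Definition ncpoly (m n : nat) : Type := {ffun {set 'I_m} -> 'M[R[i]]_n}.

Definition ncdegree (m n : nat) (Q : ncpoly m n) : nat :=
  \max_(S : {set 'I_m} | Q S != 0) #|S|.

(* Big operators enumerate 'I_m in increasing order. *)
Definition nceval (m n : nat) (Q : ncpoly m n) (X : 'I_m -> 'M[R[i]]_n) :
    'M[R[i]]_n :=
  \sum_(S : {set 'I_m}) Q S *m \prod_(i < m | i \in S) X i.

Definition iotapoly (m n p : nat) (Q : ncpoly m n) : ncpoly m p :=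
  [ffun S => iotamx p (Q S)].

Definition max_influence (m n : nat) (Q : ncpoly m n) : R :=
  \big[Num.max/0]_(i < m)
    \sum_(S : {set 'I_m} | i \in S) retr (Q S *m (Q S) ^t*).

End ncpoly.

Arguments ncpoly : clear implicits.

(* M_n(C) as a measurable space: its Borel sigma-algebra, i.e. the one
   generated by the real and imaginary parts of the matrix entries. *)
Definition cmx (R : realType) (n : nat) : Type := 'M[R[i]]_n.

Definition cmx_cylinders (R : realType) (n : nat) : set (set (cmx R n)) :=
  [set A | exists (i j : 'I_n) (B : set R), measurable B /\
    (A = [set M : 'M[R[i]]_n | B (complex.Re (M i j))] \/
     A = [set M : 'M[R[i]]_n | B (complex.Im (M i j))])].

HB.instance Definition _ (R : realType) (n : nat) :=
  Choice.copy (cmx R n) 'M[R[i]]_n.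
HB.instance Definition _ (R : realType) (n : nat) :=
  isPointed.Build (cmx R n) (0 : 'M[R[i]]_n).
HB.instance Definition _ (R : realType) (n : nat) :=
  @isMeasurable.Build (sigma_display (@cmx_cylinders R n)) (cmx R n)
    <<s @cmx_cylinders R n >> (@sigma_algebra0 _ setT (@cmx_cylinders R n))
    (@sigma_algebraC _ (@cmx_cylinders R n))
    (@sigma_algebra_bigcup _ setT (@cmx_cylinders R n)).

Section random_matrices.
Context {R : realType} {disp : measure_display} {T : measurableType disp}.

Definition mx_integrable (P : probability T R) (n : nat)
    (F : T -> 'M[R[i]]_n) : Prop :=
  forall i j : 'I_n,
    P.-integrable setT (fun w => (complex.Re (F w i j))%:E) /\
    P.-integrable setT (fun w => (complex.Im (F w i j))%:E).

Definition mx_expectation (P : probability T R) (n : nat)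
    (F : T -> 'M[R[i]]_n) : 'M[R[i]]_n :=
  \matrix_(i, j)
    (fine 'E_P[fun w => complex.Re (F w i j)]%E
     +i* fine 'E_P[fun w => complex.Im (F w i j)]%E).

Definition rv_events (n : nat) (X : T -> cmx R n) : set (set T) :=
  preimage_set_system setT X measurable.

Definition mutually_independent (P : probability T R) (I : finType)
    (F : I -> set (set T)) : Prop :=
  forall (J : {set I}) (E : I -> set T),
    (forall i, i \in J -> F i (E i)) ->
    P (\bigcap_(i in [set i | i \in J]) E i) = (\prod_(i in J) P (E i))%E.

End random_matrices.

Definition haar_unitary (R : realType) (p : nat) (nu : set (cmx R p) -> \bar R) :
    Prop :=
  nu [set U : cmx R p | (U : 'M[R[i]]_p) \is unitarymx] = 1%E /\
  forall (U : 'M[R[i]]_p) (A : set (cmx R p)),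
    U \is unitarymx -> measurable A ->
    nu [set M : cmx R p | A (U *m M)] = nu A /\
    nu [set M : cmx R p | A ((M : 'M[R[i]]_p) *m U)] = nu A.

(* Main.v *)
Require Import Defs.
From HB Require Import structures.
From mathcomp Require Import all_boot all_order all_algebra.
From mathcomp Require Import complex.
From mathcomp Require mxtens.
From mathcomp Require Import zify ring lra.
From mathcomp Require Import all_classical all_reals all_analysis.
From mathcomp Require Import measurable_realfun.

Set Implicit Arguments.
Unset Strict Implicit.
Unset Printing Implicit Defensive.

Import Order.TTheory GRing.Theory Num.Theory.

Local Open Scope classical_set_scope.
Local Open Scope ring_scope.
Local Open Scope complex_scope.
Local Open Scope sesquilinear_scope.

(** Write X_i = (G_i (x) I) H_i and let q be the n x p matrix formed by the first
    n rows of Q^iota(X), so that q q^* = sum_(S, S') Q_S Z_(S, S') Q_S'^* where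
    Z_(S, S') is the upper left n x n corner of X_S X_S'^*.  Integrating the Haar
    unitaries one at a time, from the last factor inwards, shows that
    Z_(S, S') is within O(p^(-1/2)) in L^2 of zero if S <> S', and of the scalar
    y_S = (G_i G_i^* )_00 * prod_(j in S, j > i) tr_n (G_j G_j^* ), i = min S, if S = S'.
    Hence q q^* is close to sum_S y_S Q_S Q_S^*, whose mean is the average of
    Q(sigma) Q(sigma)^* over the signs and is therefore at most I, and whose variance
    is at most c_2^d d tau n because y_S and y_S' are uncorrelated when S and S'
    are disjoint.  It remains to use
    max(0, t - 1)^2 <= min(t^2, (max(0, t^2 - 1) / 2)^2), which bounds the trace by
    a quarter of the squared distance from q q^* to any matrix below I (used if
    tau <= 1) and by the trace of q q^* (used if tau > 1).  The averaging error
    K c_2^(2d) p^(-1/2) is at most K^3 tau^(-1/3) p^(-1/2) unless K < c_2^d tau^(1/6),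
    and then it is absorbed by the main term. *)

(** * Squared Frobenius norm *)

Section squared_modulus.
Context {R : rcfType}.
Implicit Types z w : R[i].

Definition sqnormc z : R := complex.Re z ^+ 2 + complex.Im z ^+ 2.

Lemma sqnormc_ge0 z : 0 <= sqnormc z.
Proof. by rewrite addr_ge0 ?sqr_ge0. Qed.

Lemma sqnormc_real (x : R) : sqnormc x%:C = x ^+ 2.
Proof. by rewrite /sqnormc /= expr0n addr0. Qed.

Lemma sqnormc0 : sqnormc 0 = 0.
Proof. by rewrite -(rmorph0 (real_complex R)) sqnormc_real expr0n. Qed.

Lemma sqnormc1 : sqnormc 1 = 1.
Proof. by rewrite -(rmorph1 (real_complex R)) sqnormc_real expr1n. Qed.

Lemma sqnormcM z w : sqnormc (z * w) = sqnormc z * sqnormc w.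
Proof. by case: z => a b; case: w => c e; rewrite /sqnormc /=; ring. Qed.

Lemma sqnormc_conj z : sqnormc z^* = sqnormc z.
Proof. by case: z => a b; rewrite /sqnormc /= sqrrN. Qed.

Lemma sqnormcN z : sqnormc (- z) = sqnormc z.
Proof. by case: z => a b; rewrite /sqnormc /= !sqrrN. Qed.

Lemma sqnormcV_nat a : sqnormc (a%:R^-1 : R[i]) = a%:R^-1 ^+ 2.
Proof. by rewrite -sqnormc_real fmorphV rmorph_nat. Qed.

Lemma sqnormc_bool_le1 (b : bool) : sqnormc (b%:R : R[i]) <= 1.
Proof. by case: b; rewrite ?sqnormc1 ?sqnormc0. Qed.

Lemma sqnormcD_le z w : sqnormc (z + w) <= 2 * sqnormc z + 2 * sqnormc w.
Proof.
case: z => a b; case: w => c e; rewrite /sqnormc /=.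
by have := sqr_ge0 (a - c); have := sqr_ge0 (b - e); lra.
Qed.

Lemma mulcJE z : z * z^* = (sqnormc z)%:C.
Proof. by rewrite -sqr_normc -add_Re2_Im2. Qed.

Lemma sqr_Re_le z : complex.Re z ^+ 2 <= sqnormc z.
Proof. by rewrite lerDl sqr_ge0. Qed.

Lemma sqnormc_eq0 z : sqnormc z = 0 -> z = 0.
Proof.
move=> /(congr1 (real_complex R)); rewrite -mulcJE => /eqP.
by rewrite mulf_eq0 conjc_eq0 orbb => /eqP.
Qed.

Lemma sqnormc_dot_le (I : finType) (f g : I -> R[i]) :
  sqnormc (\sum_i f i * g i) <= (\sum_i sqnormc (f i)) * (\sum_i sqnormc (g i)).
Proof.
have enumE (V : nmodType) (h : I -> V) : \sum_i h i = \sum_(j < #|I|) h (enum_val j).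
  by rewrite (reindex _ (onW_bij _ (@enum_val_bij I))).
pose u := \row_(j < #|I|) f (enum_val j); pose v := \row_(j < #|I|) (g (enum_val j))^*.
have uvE : dotmx u v = \sum_i f i * g i.
  rewrite dotmxE mxE enumE; apply: eq_bigr => j _; rewrite !mxE.
  by congr (_ * _); exact: conjcK.
have normE a (h : 'I_a -> R[i]) : dotmx (\row_j h j) (\row_j h j) = (\sum_j sqnormc (h j))%:C.
  rewrite dotmxE mxE rmorph_sum; apply: eq_bigr => j _.
  by rewrite !mxE; exact: mulcJE.
have : `|dotmx u v| ^+ 2 <= dotmx u u * dotmx v v by exact: (CauchySchwarz (@dotmx R[i] _) u v).1.
rewrite uvE !normE -add_Re2_Im2 -rmorphM lecR -(enumE R (fun i => sqnormc (f i))).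
under [X in _ <= _ * X -> _]eq_bigr do rewrite sqnormc_conj.
by rewrite -(enumE R (fun i => sqnormc (g i))).
Qed.

Lemma sqnormc_sum_le (I : finType) (f : I -> R[i]) :
  sqnormc (\sum_i f i) <= #|I|%:R * \sum_i sqnormc (f i).
Proof.
have := sqnormc_dot_le (fun=> 1) f; under eq_bigr do rewrite mul1r.
by under [X in _ <= X * _]eq_bigr do rewrite sqnormc1; rewrite sumr_const.
Qed.

End squared_modulus.

Section adjoint.
Context {R : rcfType}.

Lemma trmxCE a b (A : 'M[R[i]]_(a, b)) i j : (A^t*) i j = (A j i)^*.
Proof. by rewrite !mxE. Qed.

Lemma trmxC0 a b : (0 : 'M[R[i]]_(a, b))^t* = 0.
Proof. by rewrite trmx0 map_mx0. Qed.

Lemma trmxC_mul a b c (A : 'M[R[i]]_(a, b)) (B : 'M[R[i]]_(b, c)) :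
  (A *m B)^t* = B^t* *m A^t*.
Proof. by rewrite trmx_mul map_mxM. Qed.

Lemma trmxCD a b (A B : 'M[R[i]]_(a, b)) : (A + B)^t* = A^t* + B^t*.
Proof. by rewrite linearD map_mxD. Qed.

Lemma trmxCN a b (A : 'M[R[i]]_(a, b)) : (- A)^t* = - A^t*.
Proof. by rewrite linearN map_mxN. Qed.

Lemma trmxCZ a b x (A : 'M[R[i]]_(a, b)) : (x *: A)^t* = x^* *: A^t*.
Proof. by rewrite linearZ map_mxZ. Qed.

Lemma trmxC_sum a b I (r : seq I) (Q : pred I) (F : I -> 'M[R[i]]_(a, b)) :
  (\sum_(i <- r | Q i) F i)^t* = \sum_(i <- r | Q i) (F i)^t*.
Proof. by rewrite linear_sum map_mx_sum. Qed.

Lemma trmxC_diag_real a (f : 'I_a -> R) :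
  (diag_mx (\row_i (f i)%:C))^t* = diag_mx (\row_i (f i)%:C).
Proof.
rewrite tr_diag_mx map_diag_mx; congr diag_mx; apply/rowP => i; rewrite !mxE.
exact: conjc_real.
Qed.

Lemma mul_trmxC_eq0C a b c (A : 'M[R[i]]_(a, b)) (B : 'M[R[i]]_(c, b)) :
  A *m B^t* = 0 -> B *m A^t* = 0.
Proof. by move=> AB; rewrite -[LHS]trmxCK trmxC_mul trmxCK AB trmxC0. Qed.

Lemma mulmx_row_col a b c (A : 'M[R[i]]_(a, b)) (B : 'M[R[i]]_b) (C : 'M[R[i]]_(c, b)) i j :
  (A *m B *m C^t*) i j = (row i A *m B *m (row j C)^t*) 0 0.
Proof. by rewrite -row_mul !mxE; apply: eq_bigr => l _; rewrite !mxE. Qed.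

Lemma unitarymx_trmxC p (U : 'M[R[i]]_p) : U \is unitarymx -> U^t* \is unitarymx.
Proof. by rewrite trmxC_unitary. Qed.

Lemma unitarymx_trmxC_mul p (U : 'M[R[i]]_p) : U \is unitarymx -> U^t* *m U = 1%:M.
Proof. by rewrite -trmxC_unitary => /unitarymxP; rewrite trmxCK. Qed.

End adjoint.

Section sqfro.
Context {R : rcfType}.

Definition sqfro a b (A : 'M[R[i]]_(a, b)) : R := \sum_i \sum_j sqnormc (A i j).

Lemma sqfro_ge0 a b (A : 'M[R[i]]_(a, b)) : 0 <= sqfro A.
Proof. by do 2!apply: sumr_ge0 => ? _; exact: sqnormc_ge0. Qed.

Lemma sqfro0 a b : sqfro (0 : 'M[R[i]]_(a, b)) = 0.
Proof. by rewrite /sqfro !big1// => *; rewrite big1// => *; rewrite mxE sqnormc0. Qed.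

Lemma mul_trmxC_diag a b (A : 'M[R[i]]_(a, b)) i :
  (A *m A^t*) i i = (sqfro (row i A))%:C.
Proof.
rewrite mxE /sqfro big_ord1 rmorph_sum; apply: eq_bigr => j _.
by rewrite !mxE; exact: mulcJE.
Qed.

Lemma mul_trmxC_row a (v : 'rV[R[i]]_a) : v *m v^t* = (sqfro v)%:C%:M.
Proof.
apply/matrixP => i j; rewrite !ord1 mul_trmxC_diag mxE eqxx mulr1n.
by congr (sqfro _)%:C; apply/rowP => k; rewrite mxE.
Qed.

Lemma sqfro_row a b (A : 'M[R[i]]_(a, b)) : sqfro A = \sum_i sqfro (row i A).
Proof.
apply: eq_bigr => i _; rewrite /sqfro big_ord1; apply: eq_bigr => j _.
by rewrite mxE.
Qed.

Lemma mxtrace_mul_trmxC a b (A : 'M[R[i]]_(a, b)) : \tr (A *m A^t*) = (sqfro A)%:C.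
Proof. by rewrite sqfro_row rmorph_sum; apply: eq_bigr => i _; exact: mul_trmxC_diag. Qed.

Lemma sqfro_trmxC a b (A : 'M[R[i]]_(a, b)) : sqfro (A^t*) = sqfro A.
Proof.
rewrite /sqfro exchange_big; apply: eq_bigr => i _; apply: eq_bigr => j _.
by rewrite trmxCE sqnormc_conj.
Qed.

Lemma sqfroZ a b x (A : 'M[R[i]]_(a, b)) : sqfro (x *: A) = sqnormc x * sqfro A.
Proof.
rewrite /sqfro mulr_sumr; apply: eq_bigr => i _; rewrite mulr_sumr.
by apply: eq_bigr => j _; rewrite mxE sqnormcM.
Qed.

Lemma sqfroN a b (A : 'M[R[i]]_(a, b)) : sqfro (- A) = sqfro A.
Proof. by rewrite -scaleN1r sqfroZ sqnormcN sqnormc1 mul1r. Qed.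

Lemma sqfroD_ortho a b (A B : 'M[R[i]]_(a, b)) : A *m B^t* = 0 ->
  sqfro (A + B) = sqfro A + sqfro B.
Proof.
move=> AB; apply: (@complexI R).
rewrite rmorphD /= -!mxtrace_mul_trmxC trmxCD mulmxDl !mulmxDr AB.
by rewrite (mul_trmxC_eq0C AB) addr0 add0r mxtraceD.
Qed.

Lemma sqfroD_le a b (A B : 'M[R[i]]_(a, b)) :
  sqfro (A + B) <= 2 * sqfro A + 2 * sqfro B.
Proof.
rewrite /sqfro !mulr_sumr -big_split; apply: ler_sum => i _.
rewrite !mulr_sumr -big_split; apply: ler_sum => j _; rewrite mxE.
exact: sqnormcD_le.
Qed.

Lemma sqfro_sum_le a b (I : finType) (F : I -> 'M[R[i]]_(a, b)) :
  sqfro (\sum_i F i) <= #|I|%:R * \sum_i sqfro (F i).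
Proof.
rewrite /sqfro [X in _ <= _ * X]exchange_big /= mulr_sumr; apply: ler_sum => x _.
rewrite [X in _ <= _ * X]exchange_big /= mulr_sumr; apply: ler_sum => y _.
by rewrite summxE; apply: sqnormc_sum_le.
Qed.

Lemma sqfro_mul_le a b c (A : 'M[R[i]]_(a, b)) (B : 'M[R[i]]_(b, c)) :
  sqfro (A *m B) <= sqfro A * sqfro B.
Proof.
rewrite /sqfro [X in _ <= _ * X]exchange_big mulr_suml; apply: ler_sum => i _.
rewrite mulr_sumr; apply: ler_sum => j _; rewrite mxE.
exact: sqnormc_dot_le.
Qed.

Lemma sqfro_mul_unitary a b (A : 'M[R[i]]_(a, b)) (U : 'M[R[i]]_b) :
  U \is unitarymx -> sqfro (A *m U) = sqfro A.
Proof.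
move=> Uu; apply: (@complexI R).
by rewrite -!mxtrace_mul_trmxC trmxC_mul mulmxA mulmxtVK.
Qed.

Lemma sqfro_unitary_mul a b (A : 'M[R[i]]_(a, b)) (U : 'M[R[i]]_a) :
  U \is unitarymx -> sqfro (U *m A) = sqfro A.
Proof.
move=> Uu; rewrite -sqfro_trmxC trmxC_mul sqfro_mul_unitary ?unitarymx_trmxC//.
exact: sqfro_trmxC.
Qed.

Lemma sum_sqnormc_diag_le a (A : 'M[R[i]]_a) : \sum_i sqnormc (A i i) <= sqfro A.
Proof.
apply: ler_sum => i _; rewrite (bigD1 i)//= lerDl.
by apply: sumr_ge0 => *; exact: sqnormc_ge0.
Qed.

Lemma sqnormc_le_sqfro a b (A : 'M[R[i]]_(a, b)) i j : sqnormc (A i j) <= sqfro A.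
Proof.
rewrite /sqfro (bigD1 i)//= (bigD1 j)//= -addrA lerDl addr_ge0//.
  by apply: sumr_ge0 => *; exact: sqnormc_ge0.
by do 2!apply: sumr_ge0 => ? _; exact: sqnormc_ge0.
Qed.

Lemma sqfro_eq0 a b (A : 'M[R[i]]_(a, b)) : sqfro A = 0 -> A = 0.
Proof.
move=> A0; apply/matrixP => i j; rewrite mxE; apply: sqnormc_eq0; apply/eqP.
by rewrite eq_le sqnormc_ge0 andbT -A0 sqnormc_le_sqfro.
Qed.

Lemma sqnormc_mxtrace_le a (A : 'M[R[i]]_a) : sqnormc (\tr A) <= a%:R * sqfro A.
Proof.
apply: le_trans (sqnormc_sum_le _) _; rewrite card_ord ler_wpM2l//.
exact: sum_sqnormc_diag_le.
Qed.

Lemma Re_mxtrace_le a (A : 'M[R[i]]_a) s : 0 < s ->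
  complex.Re (\tr A) <= 2^-1 * (a%:R * s + sqfro A / s).
Proof.
move=> s0; have trA := le_trans (sqr_Re_le _) (sqnormc_mxtrace_le A).
set x := complex.Re _ in trA *; set y := a%:R * s; set z := sqfro A / s.
have xyz : x ^+ 2 <= y * z by rewrite /y /z mulrACA divff ?gt_eqF// mulr1.
have yz0 : 0 <= y + z by rewrite addr_ge0 ?mulr_ge0 ?invr_ge0 ?sqfro_ge0// ltW.
apply: le_trans (ler_norm _) _.
rewrite -(@ler_pXn2r _ 2) ?nnegrE ?mulr_ge0// real_normK ?num_real//.
by have := sqr_ge0 (y - z); nra.
Qed.

Lemma sqfro_scalar_mx a (x : R[i]) : sqfro (x%:M : 'M[R[i]]_a) = a%:R * sqnormc x.
Proof.
rewrite /sqfro (eq_bigr (fun=> sqnormc x)) ?sumr_const ?card_ord ?mulr_natl// => i _.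
rewrite (bigD1 i)//= mxE eqxx big1 ?addr0// => j ji.
by rewrite mxE eq_sym (negbTE ji) sqnormc0.
Qed.

Lemma sqfro_delta_mx a b (i : 'I_a) (j : 'I_b) : sqfro (delta_mx i j : 'M[R[i]]_(a, b)) = 1.
Proof.
rewrite /sqfro (bigD1 i)//= (bigD1 j)//= !mxE !eqxx sqnormc1.
rewrite !big1 ?addr0// => [l li|l lj]; last by rewrite mxE (negbTE lj) andbF sqnormc0.
by rewrite big1// => q _; rewrite mxE (negbTE li) sqnormc0.
Qed.

Lemma sqnormc_normalized_mxtrace_le a (A : 'M[R[i]]_a) :
  a%:R * sqnormc (\tr A / a%:R) <= sqfro A.
Proof.
case: a A => [|a] A; first by rewrite mul0r sqfro_ge0.
have := sqnormc_mxtrace_le A; rewrite -ler_pdivrMl ?ltr0n//; apply: le_trans.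
rewrite sqnormcM sqnormcV_nat mulrCA [X in _ <= X]mulrC ler_wpM2l ?sqnormc_ge0//.
by rewrite expr2 mulVKf ?pnatr_eq0.
Qed.

Lemma sqfro_traceless_le a (A : 'M[R[i]]_a) :
  sqfro (A - (\tr A / a%:R)%:M) <= 4 * sqfro A.
Proof.
apply: le_trans (sqfroD_le _ _) _; rewrite sqfroN sqfro_scalar_mx.
by have := sqnormc_normalized_mxtrace_le A; lra.
Qed.

End sqfro.

Section frobenius_product.
Context {R : rcfType}.

Definition frodot a b (A B : 'M[R[i]]_(a, b)) : R := complex.Re (\tr (A *m B^t*)).

Lemma frodotC a b (A B : 'M[R[i]]_(a, b)) : frodot A B = frodot B A.
Proof.
rewrite /frodot -(trmxCK (A *m B^t*)) trmxC_mul trmxCK.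
rewrite /mxtrace !raddf_sum; apply: eq_bigr => i _; rewrite trmxCE.
by case: (_ i i).
Qed.

Lemma frodot_gram a b c (A : 'M[R[i]]_(a, b)) (B : 'M[R[i]]_(a, c)) :
  frodot (A *m A^t*) (B *m B^t*) = sqfro (A^t* *m B).
Proof.
rewrite /frodot trmxC_mul trmxCK -mulmxA mxtrace_mulC -[RHS]/(complex.Re (sqfro _)%:C).
by rewrite -mxtrace_mul_trmxC trmxC_mul trmxCK !mulmxA.
Qed.

Lemma sqfro_lincomb (I : finType) (c : I -> R) a b (A : I -> 'M[R[i]]_(a, b)) :
  sqfro (\sum_i (c i)%:C *: A i) =
  \sum_(ij : I * I) frodot (A ij.1) (A ij.2) * (c ij.1 * c ij.2).
Proof.
rewrite -[LHS]/(complex.Re (sqfro _)%:C) -mxtrace_mul_trmxC trmxC_sum mulmx_suml.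
rewrite -(pair_bigA _ (fun i j => frodot (A i) (A j) * (c i * c j))) /=.
rewrite (raddf_sum (@mxtrace _ a)) (raddf_sum (@complex.Re R)); apply: eq_bigr => i _.
rewrite mulmx_sumr (raddf_sum (@mxtrace _ a)) (raddf_sum (@complex.Re R)).
apply: eq_bigr => j _ /=.
rewrite trmxCZ -scalemxAl -scalemxAr scalerA mxtraceZ.
have -> : (c i)%:C * (c j)%:C^* = (c i * c j)%:C.
  by rewrite rmorphM; congr (_ * _); exact: conjc_real.
by rewrite /frodot [RHS]mulrC; case: (\tr _) => x y /=; rewrite mul0r subr0.
Qed.

(* Nothing is subtracted: expectations can be taken on both sides for nonnegative y
   and frodot, without integrability. *)
Lemma sqfro_centered_lincomb (I : finType) (y : I -> R) a b (A : I -> 'M[R[i]]_(a, b)) :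
  sqfro (\sum_i (y i - 1)%:C *: A i) +
    \sum_(ij : I * I) frodot (A ij.1) (A ij.2) * (2 * y ij.1) =
  \sum_(ij : I * I) frodot (A ij.1) (A ij.2) * (y ij.1 * y ij.2 + 1).
Proof.
pose c (ij : I * I) := frodot (A ij.1) (A ij.2).
have -> : \sum_ij c ij * (2 * y ij.1) = \sum_ij c ij * (y ij.1 + y ij.2).
  under eq_bigr do rewrite mulrDl mul1r mulrDr.
  under [RHS]eq_bigr do rewrite mulrDr.
  rewrite !big_split /=; congr (_ + _).
  rewrite (reindex_inj (can_inj (@swap_pairK I I))) /=.
  by apply: eq_bigr => ij _; rewrite /c frodotC.
by rewrite sqfro_lincomb -big_split; apply: eq_bigr => ij _; rewrite /= -/(c ij); ring.
Qed.

End frobenius_product.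

(** * Spectral calculus *)

Section unitary_extension.
Context {R : rcfType}.

Lemma unitary_extension r p (V : 'M[R[i]]_(r, p)) : V \is unitarymx ->
  exists2 U : 'M[R[i]]_p, U \is unitarymx & pid_mx r *m U = V.
Proof.
move=> Vu; have rV := mxrank_unitary Vu.
have [q [e [B [Bu BV]]]] : exists (q : nat) (e : (r + q)%N = p)
    (B : 'M[R[i]]_(q, p)), B \is unitarymx /\ B *m V^t* = 0.
  pose Vo := orthomx Num.conj (mx_of_hermitian (hermitian1mx p)) V.
  exists (\rank Vo); exists; first by rewrite -[in LHS]rV add_rank_ortho.
  exists (schmidt (row_base Vo)); split.
    by rewrite schmidt_unitarymx// rank_leq_col.
  apply/orthomx1P; rewrite eqmx_schmidt_free ?row_base_free//.
  by rewrite eq_row_base.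
case: p / e V Vu rV B Bu BV => V Vu _ B Bu BV.
exists (col_mx V B); last by rewrite pid_mx_row mul_row_col mul1mx mul0mx addr0.
apply/unitarymxP; rewrite tr_col_mx map_row_mx mul_col_row.
by rewrite !(unitarymxP _)// BV (mul_trmxC_eq0C BV) scalar_mx_block.
Qed.

Lemma unitary_transport r p (E V : 'M[R[i]]_(r, p)) :
  E \is unitarymx -> V \is unitarymx ->
  exists2 U : 'M[R[i]]_p, U \is unitarymx & E *m U = V.
Proof.
move=> /unitary_extension[UE UEu <-] /unitary_extension[UV UVu <-].
exists (UE^t* *m UV); first by rewrite mul_unitarymx ?unitarymx_trmxC.
by rewrite mulmxA (mulmxtVK _ UEu).
Qed.

Lemma row_unitarymx p (a : 'rV[R[i]]_p) : sqfro a = 1 -> a \is unitarymx.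
Proof. by move=> a1; apply/unitarymxP; rewrite mul_trmxC_row a1. Qed.

Lemma col_mx_unitarymx p (a b : 'rV[R[i]]_p) : sqfro a = 1 -> sqfro b = 1 ->
  a *m b^t* = 0 -> col_mx a b \is unitarymx.
Proof.
move=> a1 b1 ab; apply/unitarymxP; rewrite tr_col_mx map_row_mx mul_col_row.
by rewrite ab (mul_trmxC_eq0C ab) !mul_trmxC_row a1 b1 -scalar_mx_block.
Qed.

Lemma delta_mx_ortho p (x y : 'I_p) : x != y ->
  (delta_mx 0 x : 'rV[R[i]]_p) *m (delta_mx 0 y : 'rV[R[i]]_p)^t* = 0.
Proof. by move=> xy; rewrite trmx_delta map_delta_mx mul_delta_mx_0. Qed.

Lemma mul_delta_mx_form p (x y : 'I_p) (M : 'M[R[i]]_p) :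
  ((delta_mx 0 x : 'rV[R[i]]_p) *m M *m (delta_mx 0 y : 'rV[R[i]]_p)^t*) 0 0 = M x y.
Proof. by rewrite trmx_delta map_delta_mx -rowE -colE !mxE. Qed.

End unitary_extension.

Section unitary_diag.
Context {R : rcfType} (p : nat).
Implicit Types (U : 'M[R[i]]_p) (s t : 'I_p -> R).

Definition unitary_diag U s : 'M[R[i]]_p := U^t* *m diag_mx (\row_i (s i)%:C) *m U.

Lemma unitary_diagM U s t : U \is unitarymx ->
  unitary_diag U s *m unitary_diag U t = unitary_diag U (fun i => s i * t i).
Proof.
move=> Uu; rewrite /unitary_diag !mulmxA (mulmxtVK _ Uu) -[X in X *m _ = _]mulmxA.
rewrite mulmx_diag; apply: (congr1 (fun l => U^t* *m diag_mx l *m U)).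
by apply/rowP => i; rewrite !mxE rmorphM.
Qed.

Lemma unitary_diag_trmxC U s : (unitary_diag U s)^t* = unitary_diag U s.
Proof. by rewrite /unitary_diag !trmxC_mul trmxCK trmxC_diag_real mulmxA. Qed.

Lemma unitary_diag_form_ge0 U s (v : 'rV[R[i]]_p) : (forall i, 0 <= s i) ->
  0 <= complex.Re ((v *m unitary_diag U s *m v^t*) 0 0).
Proof.
move=> s0; have -> : v *m unitary_diag U s *m v^t* =
    (v *m U^t*) *m diag_mx (\row_i (s i)%:C) *m (v *m U^t*)^t*.
  by rewrite trmxC_mul trmxCK !mulmxA.
move: (v *m U^t*) => w; rewrite mxE raddf_sum; apply: sumr_ge0 => i _.
rewrite mul_mx_diag trmxCE !mxE mulrAC mulcJE -rmorphM /=.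
by rewrite mulr_ge0 ?sqnormc_ge0.
Qed.

Lemma mxtrace_unitary_diag U s : U \is unitarymx -> \tr (unitary_diag U s) = (\sum_i s i)%:C.
Proof.
move=> Uu; rewrite /unitary_diag -mulmxA mxtrace_mulC (mulmxtVK _ Uu) mxtrace_diag.
by rewrite rmorph_sum; apply: eq_bigr => i _; rewrite mxE.
Qed.

End unitary_diag.

Section spectral_calculus.
Context {R : realType} (p : nat).
Implicit Types (A : 'M[R[i]]_p) (f : R -> R).

Definition eigenval A i : R := complex.Re (spectral_diag A 0 i).

Lemma spectral_calcE f A :
  spectral_calc f A = unitary_diag (spectralmx A) (f \o eigenval A).
Proof.
rewrite /spectral_calc /unitary_diag /eigenval; have := spectral_unitarymx A.
move: (spectralmx A) (spectral_diag A) => U lam Uu; rewrite (invmx_unitary Uu).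
by apply: (congr1 (fun l => U^t* *m diag_mx l *m U)); apply/rowP => i; rewrite !mxE.
Qed.

Lemma spectralmx_diag A : A^t* = A -> A = unitary_diag (spectralmx A) (eigenval A).
Proof.
move=> Ah; have /orthomx_spectralP AE : A \is normalmx by apply/normalmxP; rewrite Ah.
have : spectral_diag A \is a realmx.
  by apply/hermitian_spectral_diag_real/is_hermitianmxP; rewrite expr0 scale1r Ah.
move: AE (spectral_unitarymx A); rewrite /unitary_diag /eigenval.
move: (spectralmx A) (spectral_diag A) => U lam {1}-> Uu /mxOverP lamR; rewrite (invmx_unitary Uu).
apply: (congr1 (fun l => U^t* *m diag_mx l *m U)); apply/rowP => i.
by rewrite mxE (RRe_real (lamR 0 i)).
Qed.

Lemma eigenvalE A i : A^t* = A ->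
  (eigenval A i)%:C = (row i (spectralmx A) *m A *m (row i (spectralmx A))^t*) 0 0.
Proof.
move=> Ah; rewrite -mulmx_row_col [X in _ *m X *m _](spectralmx_diag Ah).
move: (eigenval A) (spectral_unitarymx A) => s; move: (spectralmx A) => U Uu.
rewrite /unitary_diag !mulmxA (mulmxtVK _ Uu) (unitarymxP Uu) mul1mx.
by rewrite !mxE eqxx.
Qed.

Lemma absmx_sqr A : absmx A *m absmx A = A *m A^t*.
Proof.
have AAh : (A *m A^t*)^t* = A *m A^t* by rewrite trmxC_mul trmxCK.
rewrite /absmx spectral_calcE unitary_diagM ?spectral_unitarymx//.
rewrite [RHS](spectralmx_diag AAh); congr unitary_diag; apply/funext => i /=.
rewrite -expr2 sqr_sqrtr// -ler0c eigenvalE//.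
move: (row i _) => v; rewrite mulmxA -(mulmxA (v *m A)) -trmxC_mul.
by rewrite mul_trmxC_diag ler0c sqfro_ge0.
Qed.

Lemma absmx_eigenbasis A : exists (V : 'M[R[i]]_p) (mu : 'I_p -> R),
  [/\ V \is unitarymx, forall i, 0 <= mu i,
   forall i, sqfro (row i V *m A) = mu i ^+ 2 &
   forall f, retr (spectral_calc f (absmx A)) = \sum_i f (mu i)].
Proof.
have Bh : (absmx A)^t* = absmx A by rewrite /absmx spectral_calcE unitary_diag_trmxC.
exists (spectralmx (absmx A)), (eigenval (absmx A)); split.
- exact: spectral_unitarymx.
- move=> i; have /(congr1 (@complex.Re R))/= -> := eigenvalE i Bh.
  rewrite /absmx spectral_calcE; apply: unitary_diag_form_ge0 => j.
  exact: sqrtr_ge0.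
- move=> i; apply: (@complexI R).
  rewrite -[in LHS]row_mul -mul_trmxC_diag trmxC_mul mulmxA -(mulmxA _ A) -absmx_sqr.
  rewrite [X in _ *m (X *m X) *m _](spectralmx_diag Bh).
  move: (eigenval _) (spectral_unitarymx (absmx A)) => s; move: (spectralmx _) => V Vu.
  rewrite unitary_diagM// /unitary_diag !mulmxA (mulmxtVK _ Vu) (unitarymxP Vu) mul1mx.
  by rewrite !mxE eqxx mulr1n -expr2.
- move=> f; rewrite /retr spectral_calcE mxtrace_unitary_diag//.
  exact: spectral_unitarymx.
Qed.

End spectral_calculus.

Section truncation.
Context {R : realType}.

Definition sqr_excess (t : R) : R := Num.max 0 (t - 1) ^+ 2.

Lemma sqr_excess_ge0 t : 0 <= sqr_excess t.
Proof. exact: sqr_ge0. Qed.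

Lemma sqr_excess_le_sqr t : 0 <= t -> sqr_excess t <= t ^+ 2.
Proof.
move=> t0; rewrite /sqr_excess ler_pXn2r ?nnegrE ?le_max ?lexx//.
by rewrite ge_max t0 /= lerBlDr lerDl.
Qed.

Lemma sqr_excess_le_quarter t x : 0 <= t -> t ^+ 2 - 1 <= x ->
  sqr_excess t <= 4^-1 * x ^+ 2.
Proof.
move=> t0 tx; rewrite /sqr_excess; have [t1|t1] := leP t 1.
  by rewrite (max_l _) ?subr_le0// expr0n/= mulr_ge0// sqr_ge0.
rewrite max_r ?subr_ge0 ?(ltW t1)//.
by nra.
Qed.

Lemma retr_sqr_excess_ge0 p (A : 'M[R[i]]_p) :
  0 <= retr (spectral_calc sqr_excess (absmx A)).
Proof.
have [V [mu [_ _ _ ->]]] := absmx_eigenbasis A.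
by apply: sumr_ge0 => i _; exact: sqr_excess_ge0.
Qed.

Lemma retr_sqr_excess_le_sqfro p (A : 'M[R[i]]_p) :
  retr (spectral_calc sqr_excess (absmx A)) <= sqfro A.
Proof.
have [V [mu [Vu mu0 muE ->]]] := absmx_eigenbasis A.
rewrite -(sqfro_unitary_mul _ Vu) sqfro_row; apply: ler_sum => i _.
by rewrite row_mul muE; exact: sqr_excess_le_sqr.
Qed.

Lemma retr_sqr_excess_le_dist p (A Y : 'M[R[i]]_p) :
  (forall v : 'rV[R[i]]_p, complex.Re ((v *m Y *m v^t*) 0 0) <= sqfro v) ->
  retr (spectral_calc sqr_excess (absmx A)) <= 4^-1 * sqfro (A *m A^t* - Y).
Proof.
move=> Y1; have [V [mu [Vu mu0 muE ->]]] := absmx_eigenbasis A.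
rewrite -(sqfro_unitary_mul _ Vu) -(sqfro_mul_unitary _ (unitarymx_trmxC Vu)).
apply: le_trans (ler_wpM2l _ (sum_sqnormc_diag_le _)); last by rewrite invr_ge0.
rewrite mulr_sumr; apply: ler_sum => i _.
apply: le_trans (ler_wpM2l _ (sqr_Re_le _)); last by rewrite invr_ge0.
apply: sqr_excess_le_quarter => //; rewrite mulmx_row_col; set v := row i V.
have -> : (v *m (A *m A^t* - Y) *m v^t*) 0 0 = (mu i ^+ 2)%:C - (v *m Y *m v^t*) 0 0.
  rewrite mulmxBr mulmxBl mxE [X in _ + X]mxE mulmxA -(mulmxA (v *m A)) -trmxC_mul.
  by rewrite mul_trmxC_row muE [X in X + _]mxE eqxx.
rewrite raddfB /= lerD2l lerN2; apply: le_trans (Y1 v) _.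
have /matrixP/(_ i i) := unitarymxP Vu; rewrite mul_trmxC_diag mxE eqxx.
by move=> /(@complexI R) ->.
Qed.

End truncation.

(** * Measurability and expectations *)

Section measurability.
Context {R : realType} {d : measure_display} {T : measurableType d}.
Implicit Types (f g : T -> R[i]).

Definition cmeasurable f : Prop :=
  measurable_fun setT (fun w => complex.Re (f w)) /\
  measurable_fun setT (fun w => complex.Im (f w)).

Definition mxmeasurable a b (F : T -> 'M[R[i]]_(a, b)) : Prop :=
  forall i j, cmeasurable (fun w => F w i j).

Lemma cmeasurable_cst z : cmeasurable (fun=> z).
Proof. by split; exact: measurable_cst. Qed.

Lemma cmeasurable_real (f : T -> R) : measurable_fun setT f -> cmeasurable (fun w => (f w)%:C).
Proof. by move=> mf; split => //; exact: measurable_cst. Qed.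

Lemma cmeasurableD f g : cmeasurable f -> cmeasurable g -> cmeasurable (fun w => f w + g w).
Proof.
move=> [f1 f2] [g1 g2]; split; under eq_fun do rewrite raddfD.
  exact: measurable_funD.
exact: measurable_funD.
Qed.

Lemma cmeasurableM f g : cmeasurable f -> cmeasurable g -> cmeasurable (fun w => f w * g w).
Proof.
move=> [f1 f2] [g1 g2]; split.
  rewrite (_ : (fun _ => _) = (fun w => complex.Re (f w) * complex.Re (g w) -
      complex.Im (f w) * complex.Im (g w))).
    by apply: measurable_funB; exact: measurable_funM.
  by apply/funext => w; case: (f w) (g w) => ? ? [].
rewrite (_ : (fun _ => _) = (fun w => complex.Re (f w) * complex.Im (g w) +
    complex.Im (f w) * complex.Re (g w))).
  by apply: measurable_funD; exact: measurable_funM.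
by apply/funext => w; case: (f w) (g w) => ? ? [].
Qed.

Lemma cmeasurableB f g : cmeasurable f -> cmeasurable g -> cmeasurable (fun w => f w - g w).
Proof.
move=> mf mg; under eq_fun do rewrite -mulN1r.
by apply: cmeasurableD => //; apply: cmeasurableM => //; exact: cmeasurable_cst.
Qed.

Lemma cmeasurable_conj f : cmeasurable f -> cmeasurable (fun w => (f w)^*).
Proof.
move=> [f1 f2]; split.
  by rewrite (_ : (fun _ => _) = fun w => complex.Re (f w))//; apply/funext => w; case: (f w).
rewrite (_ : (fun _ => _) = fun w => - complex.Im (f w)); first exact: measurable_funN.
by apply/funext => w; case: (f w).
Qed.

Lemma cmeasurable_sum I (r : seq I) (F : I -> T -> R[i]) :
  (forall i, cmeasurable (F i)) -> cmeasurable (fun w => \sum_(i <- r) F i w).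
Proof.
move=> mF; elim: r => [|i r IH].
  by under eq_fun do rewrite big_nil; exact: cmeasurable_cst.
by under eq_fun do rewrite big_cons; exact: cmeasurableD.
Qed.

Lemma mxmeasurable_cst a b (A : 'M[R[i]]_(a, b)) : mxmeasurable (fun=> A).
Proof. by move=> i j; exact: cmeasurable_cst. Qed.

Lemma mxmeasurableD a b (F G : T -> 'M[R[i]]_(a, b)) :
  mxmeasurable F -> mxmeasurable G -> mxmeasurable (fun w => F w + G w).
Proof. by move=> mF mG i j; under eq_fun do rewrite mxE; exact: cmeasurableD. Qed.

Lemma mxmeasurableZ a b f (F : T -> 'M[R[i]]_(a, b)) :
  cmeasurable f -> mxmeasurable F -> mxmeasurable (fun w => f w *: F w).
Proof. by move=> mf mF i j; under eq_fun do rewrite mxE; exact: cmeasurableM. Qed.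

Lemma mxmeasurableB a b (F G : T -> 'M[R[i]]_(a, b)) :
  mxmeasurable F -> mxmeasurable G -> mxmeasurable (fun w => F w - G w).
Proof.
by move=> mF mG i j; under eq_fun do rewrite mxE [X in _ + X]mxE; exact: cmeasurableB.
Qed.

Lemma mxmeasurableM a b c (F : T -> 'M[R[i]]_(a, b)) (G : T -> 'M[R[i]]_(b, c)) :
  mxmeasurable F -> mxmeasurable G -> mxmeasurable (fun w => F w *m G w).
Proof.
move=> mF mG i j; under eq_fun do rewrite mxE.
by apply: cmeasurable_sum => k; exact: cmeasurableM.
Qed.

Lemma mxmeasurable_trmxC a b (F : T -> 'M[R[i]]_(a, b)) :
  mxmeasurable F -> mxmeasurable (fun w => (F w)^t*).
Proof. by move=> mF i j; under eq_fun do rewrite !mxE; exact: cmeasurable_conj. Qed.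

Lemma mxmeasurable_row a b (F : T -> 'M[R[i]]_(a, b)) i :
  mxmeasurable F -> mxmeasurable (fun w => row i (F w)).
Proof. by move=> mF u v; under eq_fun do rewrite mxE; exact: mF. Qed.

Lemma mxmeasurable_sum a b I (r : seq I) (F : I -> T -> 'M[R[i]]_(a, b)) :
  (forall i, mxmeasurable (F i)) -> mxmeasurable (fun w => \sum_(i <- r) F i w).
Proof.
move=> mF i j; under eq_fun do rewrite summxE.
by apply: cmeasurable_sum => k; exact: mF.
Qed.

Lemma cmeasurable_mxtrace a (F : T -> 'M[R[i]]_a) :
  mxmeasurable F -> cmeasurable (fun w => \tr (F w)).
Proof. by move=> mF; apply: cmeasurable_sum => i; exact: mF. Qed.

Lemma mxmeasurable_scalar a f :
  cmeasurable f -> mxmeasurable (fun w => (f w)%:M : 'M[R[i]]_a).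
Proof.
move=> mf; under eq_fun do rewrite -scalemx1.
by apply: mxmeasurableZ => //; exact: mxmeasurable_cst.
Qed.

Lemma mxmeasurable_ampliation a k (F : T -> 'M[R[i]]_a) :
  mxmeasurable F -> mxmeasurable (fun w => ampliation k (F w)).
Proof.
move=> mF i j; under eq_fun do rewrite /ampliation mxE.
by apply: cmeasurableM; [exact: mF|exact: cmeasurable_cst].
Qed.

Lemma mxmeasurableP n (F : T -> 'M[R[i]]_n) :
  mxmeasurable F <-> measurable_fun setT (F : T -> cmx R n).
Proof.
split=> mF.
  apply: (@measurability _ _ T (cmx R n) setT F (@cmx_cylinders R n)) => //.
  by move=> _ [_ [i [j [B [mB [->|->]]]]] <-]; [exact: (mF i j).1|exact: (mF i j).2].
have mcyl : @cmx_cylinders R n `<=` measurable by exact: sub_sigma_algebra.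
move=> i j; split => _ B mB.
  apply: (mF measurableT [set M : 'M[R[i]]_n | B (complex.Re (M i j))]).
  by apply: mcyl; exists i, j, B; split => //; left.
apply: (mF measurableT [set M : 'M[R[i]]_n | B (complex.Im (M i j))]).
by apply: mcyl; exists i, j, B; split => //; right.
Qed.

End measurability.

Lemma mxmeasurable_id {R : realType} n : mxmeasurable (fun g : cmx R n => (g : 'M[R[i]]_n)).
Proof. by apply/mxmeasurableP; exact: measurable_id. Qed.

Lemma mxmeasurable_comp {R : realType} {d1 d2} {T1 : measurableType d1}
    {T2 : measurableType d2} a b (F : T2 -> 'M[R[i]]_(a, b)) (g : T1 -> T2) :
  mxmeasurable F -> measurable_fun setT g -> mxmeasurable (fun w => F (g w)).
Proof.
by move=> mF mg i j; split; [exact: (measurableT_comp (mF i j).1 mg)|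
  exact: (measurableT_comp (mF i j).2 mg)].
Qed.

Section nonnegative_measurability.
Context {R : realType} {d : measure_display} {T : measurableType d}.
Implicit Types f g : T -> R.

Definition nnmeasurable f : Prop := measurable_fun setT f /\ forall w, 0 <= f w.

Lemma nnmeasurable_cst c : 0 <= c -> nnmeasurable (fun=> c : R).
Proof. by move=> c0; split => //; exact: measurable_cst. Qed.

Lemma nnmeasurableD f g : nnmeasurable f -> nnmeasurable g ->
  nnmeasurable (fun w => f w + g w).
Proof.
by move=> [mf f0] [mg g0]; split=> [|w]; [exact: measurable_funD|exact: addr_ge0].
Qed.

Lemma nnmeasurableM f g : nnmeasurable f -> nnmeasurable g ->
  nnmeasurable (fun w => f w * g w).
Proof.
by move=> [mf f0] [mg g0]; split=> [|w]; [exact: measurable_funM|exact: mulr_ge0].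
Qed.

Lemma nnmeasurableZ c f : 0 <= c -> nnmeasurable f -> nnmeasurable (fun w => c * f w).
Proof. by move=> c0; apply: nnmeasurableM; exact: nnmeasurable_cst. Qed.

Lemma nnmeasurableX f k : nnmeasurable f -> nnmeasurable (fun w => f w ^+ k).
Proof.
by move=> [mf f0]; split=> [|w]; [exact: measurable_funX|exact: exprn_ge0].
Qed.

Lemma nnmeasurable_sum I (r : seq I) (f : I -> T -> R) :
  (forall i, nnmeasurable (f i)) -> nnmeasurable (fun w => \sum_(i <- r) f i w).
Proof.
move=> mf; split=> [|w]; first by apply: measurable_sum => i; exact: (mf i).1.
by apply: sumr_ge0 => i _; exact: (mf i).2.
Qed.

Lemma nnmeasurable_sqnormc (f : T -> R[i]) :
  cmeasurable f -> nnmeasurable (fun w => sqnormc (f w)).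
Proof.
by move=> [f1 f2]; split=> [|w]; [apply: measurable_funD; exact: measurable_funX|
  exact: sqnormc_ge0].
Qed.

Lemma nnmeasurable_sqfro a b (F : T -> 'M[R[i]]_(a, b)) :
  mxmeasurable F -> nnmeasurable (fun w => sqfro (F w)).
Proof. by move=> mF; do 2!apply: nnmeasurable_sum => ?; exact: nnmeasurable_sqnormc. Qed.

End nonnegative_measurability.

Lemma nnmeasurable_comp {R : realType} {d1 d2} {T1 : measurableType d1}
    {T2 : measurableType d2} (f : T2 -> R) (g : T1 -> T2) :
  nnmeasurable f -> measurable_fun setT g -> nnmeasurable (fun w => f (g w)).
Proof. by move=> [mf f0] mg; split => //; exact: (measurableT_comp mf mg). Qed.

Ltac mxmeasurability := repeat first
  [ assumption | exact: mxmeasurable_cst | exact: mxmeasurable_id | exact: cmeasurable_cst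
  | apply: mxmeasurableM | apply: mxmeasurable_trmxC | apply: mxmeasurableB
  | apply: mxmeasurableD | apply: mxmeasurable_scalar | apply: mxmeasurable_ampliation
  | apply: mxmeasurable_row | apply: mxmeasurableZ | apply: nnmeasurable_sqfro
  | apply: nnmeasurable_sqnormc | apply: cmeasurable_mxtrace | apply: cmeasurableM ].

Lemma measurable_unitarymx (R : realType) (p : nat) :
  measurable [set U : cmx R p | (U : 'M[R[i]]_p) \is unitarymx].
Proof.
have [mf _] : nnmeasurable (fun U : cmx R p => sqfro ((U : 'M[R[i]]_p) *m U^t* - 1%:M)).
  by mxmeasurability.
rewrite (_ : [set _ | _] =
  (fun U : cmx R p => sqfro ((U : 'M[R[i]]_p) *m U^t* - 1%:M)) @^-1` [set 0]).
  by rewrite -[X in measurable X]setTI; exact: mf.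
apply/seteqP; split => U /=; first by move=> /unitarymxP ->; rewrite subrr sqfro0.
by move=> /sqfro_eq0/subr0_eq/unitarymxP.
Qed.

Section expectation.
Context {R : realType} {d : measure_display} {T : measurableType d} (P : probability T R).
Implicit Types f g : T -> R.
Local Open Scope ereal_scope.

Lemma ge0_le_integralT (f g : T -> \bar R) : (forall w, 0 <= f w) ->
  (forall w, f w <= g w) -> \int[P]_w f w <= \int[P]_w g w.
Proof.
(* The integral of a nonnegative function is a supremum over the simple
   functions below it. *)
move=> f0 fg; rewrite !ge0_integralTE//; last by move=> w; exact: le_trans (fg w).
by apply: le_ereal_sup => _ [h hf <-]; exists h => // w; exact: le_trans (fg w).
Qed.

Lemma ge0_le_expectation f g : (forall w, (0 <= f w)%R) ->
  (forall w, (f w <= g w)%R) -> 'E_P[f] <= 'E_P[g].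
Proof.
move=> f0 fg; rewrite unlock; apply: ge0_le_integralT => w; rewrite lee_fin.
  exact: f0.
exact: fg.
Qed.

Lemma ae_le_expectation f g : nnmeasurable f -> nnmeasurable g ->
  {ae P, forall w, (f w <= g w)%R} -> 'E_P[f] <= 'E_P[g].
Proof. by move=> [mf f0] [mg g0]; exact: expectation_le. Qed.

Lemma ge0_expectationD f g : nnmeasurable f -> nnmeasurable g ->
  'E_P[fun w => f w + g w]%R = 'E_P[f] + 'E_P[g].
Proof.
move=> [mf f0] [mg g0]; rewrite unlock; under eq_integral do rewrite EFinD.
by rewrite ge0_integralD//; [move=> *; rewrite lee_fin|exact/measurable_EFinP|
  move=> *; rewrite lee_fin|exact/measurable_EFinP].
Qed.

Lemma ge0_expectationZ k f : (0 <= k)%R -> nnmeasurable f ->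
  'E_P[fun w => k * f w]%R = k%:E * 'E_P[f].
Proof.
move=> k0 [mf f0]; rewrite unlock; under eq_integral do rewrite EFinM.
by rewrite ge0_integralZl//; [exact/measurable_EFinP|move=> *; rewrite lee_fin].
Qed.

Lemma ge0_expectation_sum I (r : seq I) (f : I -> T -> R) :
  (forall i, nnmeasurable (f i)) ->
  'E_P[fun w => \sum_(i <- r) f i w]%R = \sum_(i <- r) 'E_P[f i].
Proof.
move=> mf; rewrite unlock; under eq_integral do rewrite -sumEFin.
rewrite ge0_integral_sum//; first by move=> i; apply/measurable_EFinP; exact: (mf i).1.
by move=> i w _; rewrite lee_fin; exact: (mf i).2.
Qed.

Lemma ge0_expectationD_le f g (a b : R) : nnmeasurable f -> nnmeasurable g ->
  'E_P[f] <= a%:E -> 'E_P[g] <= b%:E -> 'E_P[fun w => f w + g w]%R <= (a + b)%:E.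
Proof. by move=> mf mg fa gb; rewrite ge0_expectationD// EFinD leeD. Qed.

Lemma ge0_expectationZ_le k f (a : R) : (0 <= k)%R -> nnmeasurable f ->
  'E_P[f] <= a%:E -> 'E_P[fun w => k * f w]%R <= (k * a)%:E.
Proof.
by move=> k0 mf fa; rewrite ge0_expectationZ// EFinM lee_wpmul2l// lee_fin.
Qed.

Lemma ge0_expectation_lincomb (I : finType) (c : I -> R) (f : I -> T -> R) (e : I -> R) :
  (forall i, (0 <= c i)%R) -> (forall i, nnmeasurable (f i)) ->
  (forall i, 'E_P[f i] = (e i)%:E) ->
  'E_P[fun w => \sum_i c i * f i w]%R = (\sum_i c i * e i)%R%:E.
Proof.
move=> c0 mf fe; rewrite ge0_expectation_sum => [|i]; last exact: nnmeasurableZ.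
by rewrite -sumEFin; apply: eq_bigr => i _; rewrite ge0_expectationZ// fe.
Qed.

Lemma ge0_expectation_lincomb_le (I : finType) (c : I -> R) (f : I -> T -> R) (e : I -> R) :
  (forall i, (0 <= c i)%R) -> (forall i, nnmeasurable (f i)) ->
  (forall i, (0 < c i)%R -> 'E_P[f i] <= (e i)%:E) ->
  'E_P[fun w => \sum_i c i * f i w]%R <= (\sum_i c i * e i)%R%:E.
Proof.
move=> c0 mf fe; rewrite ge0_expectation_sum => [|i]; last exact: nnmeasurableZ.
rewrite -sumEFin; apply: lee_sum => i _; rewrite ge0_expectationZ//.
have [->|ci] := eqVneq (c i) 0%R; first by rewrite mul0e mul0r.
by rewrite EFinM lee_wpmul2l ?lee_fin// fe// lt_neqAle eq_sym ci c0.
Qed.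

Lemma ge0_expectation_average_le (I : finType) (A : pred I) (f : I -> T -> R)
    (e : \bar R) (k : R) : (0 < #|A|)%N -> (0 <= k)%R ->
  (forall i, nnmeasurable (f i)) -> (forall i, A i -> 'E_P[f i] = e) ->
  {ae P, forall w, (\sum_(i in A) f i w <= k)%R} -> e <= (k / #|A|%:R)%:E.
Proof.
move=> A0 k0 mf fe fk.
have sumE : \sum_(i in A) 'E_P[f i] = #|A|%:R%:E * e.
  by rewrite mule_natl (eq_bigr (fun=> e))//; exact: sumr_const.
rewrite mulrC EFinM lee_pdivlMl ?ltr0n// -sumE.
rewrite -(expectation_cst P k).
have -> : \sum_(i in A) 'E_P[f i] = 'E_P[fun w => \sum_(i <- enum A) f i w]%R.
  by rewrite ge0_expectation_sum// big_enum.
apply: ae_le_expectation; [exact: nnmeasurable_sum|exact: nnmeasurable_cst|].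
by apply: filterS fk => w; rewrite -big_enum.
Qed.

Lemma ge0_expectation_sqdist_le (f g h : T -> R[i]) (a b : R) :
  cmeasurable f -> cmeasurable g -> cmeasurable h ->
  'E_P[fun w => sqnormc (f w - g w)%R] <= a%:E ->
  'E_P[fun w => sqnormc (g w - h w)%R] <= b%:E ->
  'E_P[fun w => sqnormc (f w - h w)%R] <= (2 * a + 2 * b)%:E.
Proof.
move=> mf mg mh fg gh.
have mfg : nnmeasurable (fun w => sqnormc (f w - g w)%R).
  exact/nnmeasurable_sqnormc/cmeasurableB.
have mgh : nnmeasurable (fun w => sqnormc (g w - h w)%R).
  exact/nnmeasurable_sqnormc/cmeasurableB.
apply: (@le_trans _ _ 'E_P[fun w => 2 * sqnormc (f w - g w)%R + 2 * sqnormc (g w - h w)%R]%R).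
  apply: ge0_le_expectation => w; first exact: sqnormc_ge0.
  by rewrite -[(f w - h w)%R](subrKA (g w)) sqnormcD_le.
by apply: ge0_expectationD_le; (try exact: nnmeasurableZ); apply: ge0_expectationZ_le.
Qed.

End expectation.

Lemma ae_probability1 {R : realType} {d} {T : measurableType d} (P : probability T R) (A : set T) :
  measurable A -> P A = 1%E -> {ae P, forall w, A w}.
Proof.
move=> mA PA; exists (~` A); split; [exact: measurableC| |by move=> w].
have -> : P (~` A) = (1 - P A)%E by exact: probability_setC.
by rewrite PA subee.
Qed.

Lemma ge0_expectation_transfer {R : realType} {d1 d2} {X : measurableType d1}
    {Y : measurableType d2} (mu : probability X R) (nu : probability Y R)
    (phi : X -> Y) (f : Y -> R) :
  measurable_fun setT phi -> nnmeasurable f ->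
  (forall A, measurable A -> mu (phi @^-1` A) = nu A) ->
  'E_mu[fun x => f (phi x)]%E = 'E_nu[f]%E.
Proof.
move=> mphi [mf f0] munu; rewrite unlock.
pose phi' : {mfun X >-> Y} := HB.pack phi (isMeasurableFun.Build _ _ _ _ _ mphi).
transitivity (\int[distribution mu phi']_y (f y)%:E)%E; last first.
  by apply: eq_measure_integral => A mA _; exact: munu.
by rewrite ge0_integral_distribution//; exact/measurable_EFinP.
Qed.

Lemma expectation_sqfro_le {R : realType} {d} {T : measurableType d} (P : probability T R) a b
    (F : T -> 'M[R[i]]_(a, b)) (c : R) : mxmeasurable F ->
  (forall x y, ('E_P[fun w => sqnormc (F w x y)] <= c%:E)%E) ->
  ('E_P[fun w => sqfro (F w)] <= (a%:R * (b%:R * c))%:E)%E.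
Proof.
move=> mF Fc; rewrite /sqfro ge0_expectation_sum => [|x]; last first.
  by apply: nnmeasurable_sum => y; exact: nnmeasurable_sqnormc.
apply: (@le_trans _ _ (\sum_(x < a) \sum_(y < b) c%:E)%E); last first.
  under eq_bigr do rewrite sumEFin; rewrite sumEFin !sumr_const !card_ord.
  by rewrite !mulr_natl.
apply: lee_sum => x _; rewrite ge0_expectation_sum => [|y]; last exact: nnmeasurable_sqnormc.
by apply: lee_sum => y _; exact: Fc.
Qed.

Lemma expectation_sqfro_centered_le {R : realType} {d} {T : measurableType d}
    (P : probability T R) (I : finType) a b (A : I -> 'M[R[i]]_(a, b)) (y : I -> T -> R)
    (rho : I -> I -> R) :
  (forall i j, 0 <= frodot (A i) (A j)) -> (forall i, nnmeasurable (y i)) ->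
  (forall i, 'E_P[y i] = 1%:E)%E ->
  (forall i j, ('E_P[(fun w => y i w * y j w)%R] <= (rho i j)%:E)%E) ->
  ('E_P[(fun w => sqfro (\sum_i (y i w - 1)%:C *: A i))%R] <=
   (\sum_i \sum_j (rho i j - 1) * frodot (A i) (A j))%:E)%E.
Proof.
move=> A0 my Ey Eyy; pose c (ij : I * I) := frodot (A ij.1) (A ij.2).
have c0 ij : 0 <= c ij by exact: A0.
pose F w := sqfro (\sum_i (y i w - 1)%:C *: A i).
have mF : nnmeasurable F.
  apply: nnmeasurable_sqfro; apply: mxmeasurable_sum => i; apply: mxmeasurableZ.
    by apply/cmeasurable_real/measurable_funB => //; exact: (my i).1.
  exact: mxmeasurable_cst.
have lhs_mean : 'E_P[(fun w => \sum_ij c ij * (2 * y ij.1 w))%R]%E =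
    (\sum_ij c ij * (2 * 1))%:E.
  apply: ge0_expectation_lincomb => // ij; first exact: nnmeasurableZ.
  by rewrite ge0_expectationZ// Ey.
have rhs_mean : ('E_P[(fun w => \sum_ij c ij * (y ij.1 w * y ij.2 w + 1))%R] <=
    (\sum_ij c ij * (rho ij.1 ij.2 + 1))%:E)%E.
  have my2 ij : nnmeasurable (fun w => y ij.1 w * y ij.2 w) by exact: nnmeasurableM.
  have m1 : nnmeasurable ((fun=> 1) : T -> R) by exact: nnmeasurable_cst.
  apply: ge0_expectation_lincomb_le => // ij; first exact: nnmeasurableD.
  by move=> _; apply: ge0_expectationD_le; rewrite ?expectation_cst.
have -> : \sum_i \sum_j (rho i j - 1) * frodot (A i) (A j) =
    \sum_ij c ij * (rho ij.1 ij.2 + 1) - \sum_ij c ij * (2 * 1).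
  by rewrite pair_big -sumrB; apply: eq_bigr => ij _; rewrite /c; ring.
rewrite EFinB leeBrDr// -lhs_mean -ge0_expectationD//; last first.
  by apply: nnmeasurable_sum => ij; do 2?apply: nnmeasurableZ.
by under eq_fun do rewrite sqfro_centered_lincomb.
Qed.

(** * Averages over the Haar measure *)

Lemma mulmx_polarization (F : comNzRingType) a b c (U V : 'M[F]_(a, b)) (X Y : 'M[F]_(b, c)) :
  (U + V) *m (X - Y) + (U - V) *m (X + Y) = 2 *: (U *m X - V *m Y).
Proof.
rewrite !mulmxDl !mulmxDr !mulmxN !mulNmx.
by apply/matrixP => i j; rewrite !mxE; ring.
Qed.

Section haar.
Context {R : realType} (p : nat) (nu : probability (cmx R p) R).
Hypothesis nu_haar : haar_unitary nu.
Implicit Types (a b u v : 'rV[R[i]]_p) (U D : 'M[R[i]]_p).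

Lemma haar_mull U (f : cmx R p -> R) : U \is unitarymx -> nnmeasurable f ->
  'E_nu[fun h : 'M[R[i]]_p => f (U *m h)]%E = 'E_nu[f]%E.
Proof.
move=> Uu mf; apply: (ge0_expectation_transfer (phi := fun h : cmx R p => U *m h : cmx R p)) => //.
  by apply/mxmeasurableP; mxmeasurability.
by move=> A mA; exact: (nu_haar.2 _ _ Uu mA).1.
Qed.

Lemma haar_mulr U (f : cmx R p -> R) : U \is unitarymx -> nnmeasurable f ->
  'E_nu[fun h : 'M[R[i]]_p => f (h *m U)]%E = 'E_nu[f]%E.
Proof.
move=> Uu mf.
apply: (ge0_expectation_transfer (phi := fun h : cmx R p => (h : 'M[R[i]]_p) *m U : cmx R p)) => //.
  by apply/mxmeasurableP; mxmeasurability.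
by move=> A mA; exact: (nu_haar.2 _ _ Uu mA).2.
Qed.

Lemma haar_ae_unitary : {ae nu, forall h : cmx R p, (h : 'M[R[i]]_p) \is unitarymx}.
Proof.
apply: (@ae_probability1 _ _ _ nu [set h : cmx R p | (h : 'M[R[i]]_p) \is unitarymx]).
  exact: measurable_unitarymx.
exact: nu_haar.1.
Qed.

Definition normalize a := (Num.sqrt (sqfro a))^-1%:C *: a.

Lemma normalizeE a : a = (Num.sqrt (sqfro a))%:C *: normalize a.
Proof.
have [->|s0] := eqVneq a 0; first by rewrite /normalize !scaler0.
rewrite /normalize scalerA -rmorphM divff ?scale1r// gt_eqF// sqrtr_gt0.
by rewrite lt_neqAle sqfro_ge0 andbT eq_sym; apply: contraNneq s0 => /sqfro_eq0 ->.
Qed.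

Lemma sqfro_normalize a : a != 0 -> sqfro (normalize a) = 1.
Proof.
move=> a0; rewrite sqfroZ sqnormc_real exprVn sqr_sqrtr ?sqfro_ge0// mulVf//.
by apply: contraNneq a0 => /sqfro_eq0 ->.
Qed.

Lemma normalize_ortho a b : a *m b^t* = 0 -> normalize a *m (normalize b)^t* = 0.
Proof. by move=> ab; rewrite trmxCZ -scalemxAl -scalemxAr ab !scaler0. Qed.

Lemma haar_entry_unit_le a u : (0 < p)%N -> sqfro u = 1 ->
  ('E_nu[fun h : 'M[R[i]]_p => sqnormc ((a *m h *m u^t*) ord0 ord0)] <= (sqfro a / p%:R)%:E)%E.
Proof.
move=> p0 u1; rewrite -[X in X%:R]card_ord.
pose f (x : 'I_p) (h : cmx R p) := sqnormc ((a *m (h : 'M[R[i]]_p)) 0 x).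
have mf x : nnmeasurable (f x).
  by rewrite /f; mxmeasurability.
apply: (ge0_expectation_average_le (P := nu) (f := f)) => //; first by rewrite card_ord.
- exact: sqfro_ge0.
- move=> x _; have [U Uu xU] := unitary_transport
    (row_unitarymx (sqfro_delta_mx 0 x)) (row_unitarymx u1).
  rewrite -(haar_mulr (unitarymx_trmxC Uu) (mf x)); congr expectation.
  apply/funext => h; rewrite /f -xU trmxC_mul !mulmxA.
  by rewrite trmx_delta map_delta_mx -colE [in RHS]mxE.
- apply: filterS haar_ae_unitary => h hu.
  by rewrite -(sqfro_mul_unitary a hu) /sqfro big_ord1.
Qed.

Lemma haar_entry_le a b : (0 < p)%N ->
  ('E_nu[fun h : 'M[R[i]]_p => sqnormc ((a *m h *m b^t*) ord0 ord0)] <=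
   (sqfro a * sqfro b / p%:R)%:E)%E.
Proof.
move=> p0; have [->|b0] := eqVneq b 0.
  rewrite -(expectation_cst nu); apply: ge0_le_expectation => h; first exact: sqnormc_ge0.
  by rewrite trmxC0 mulmx0 mxE sqnormc0 sqfro0 mulr0 mul0r.
rewrite (_ : (fun h => _) = (fun h : 'M[R[i]]_p =>
    sqfro b * sqnormc ((a *m h *m (normalize b)^t*) ord0 ord0))); last first.
  apply/funext => h; rewrite {1}(normalizeE b) trmxCZ -scalemxAr mxE sqnormcM.
  by rewrite sqnormc_conj sqnormc_real sqr_sqrtr ?sqfro_ge0.
rewrite (_ : _ / _ = sqfro b * (sqfro a / p%:R)); last by ring.
apply: ge0_expectationZ_le; [exact: sqfro_ge0|by mxmeasurability|].
by apply: haar_entry_unit_le => //; exact: sqfro_normalize.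
Qed.

Section conjugation.
Variable D : 'M[R[i]]_p.
Local Notation conjD h := (h *m D *m h^t*).

Definition haar_form a b : \bar R :=
  'E_nu[fun h : 'M[R[i]]_p => sqnormc ((a *m conjD h *m b^t*) ord0 ord0)]%E.

Let beta : R := sqfro D / (p%:R * (p%:R - 1)).

Hypothesis p_gt1 : (1 < p)%N.

Let beta_ge0 : 0 <= beta.
Proof. by rewrite divr_ge0 ?sqfro_ge0// mulr_ge0// subr_ge0 ler1n ltnW. Qed.

Let nnmeasurable_form a b :
  nnmeasurable (fun h : cmx R p => sqnormc ((a *m conjD (h : 'M[R[i]]_p) *m b^t*) ord0 ord0)).
Proof. by mxmeasurability. Qed.

Lemma haar_form_unitary U a b : U \is unitarymx ->
  haar_form (a *m U) (b *m U) = haar_form a b.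
Proof.
move=> Uu; rewrite -[RHS](haar_mull Uu (nnmeasurable_form a b)); congr expectation.
by apply/funext => h; rewrite !trmxC_mul !mulmxA.
Qed.

Lemma haar_form_scale_le k a b :
  (a != 0 -> b != 0 -> (haar_form (normalize a) (normalize b) <= k%:E)%E) ->
  (haar_form a b <= (k * (sqfro a * sqfro b))%:E)%E.
Proof.
have -> : haar_form a b =
    ((sqfro a * sqfro b)%:E * haar_form (normalize a) (normalize b))%E.
  rewrite -ge0_expectationZ ?mulr_ge0 ?sqfro_ge0//; congr expectation; apply/funext => h.
  move: (normalizeE a) (normalizeE b); move: (normalize a) (normalize b) => u v aE bE.
  rewrite {1}aE {1}bE trmxCZ -!scalemxAl -scalemxAr scalerA mxE.
  by rewrite !sqnormcM sqnormc_conj !sqnormc_real !sqr_sqrtr ?sqfro_ge0.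
have [->|a0] := eqVneq a 0; first by rewrite sqfro0 !mul0r mulr0 mul0e.
have [->|b0] := eqVneq b 0; first by rewrite sqfro0 !mulr0 mul0e.
move=> /(_ isT isT) abk; rewrite [X in (_ <= X%:E)%E]mulrC [leRHS]EFinM lee_wpmul2l// lee_fin.
by rewrite mulr_ge0 ?sqfro_ge0.
Qed.

Lemma card_off_diagonal : #|[pred x : 'I_p * 'I_p | x.1 != x.2]| = (p * p.-1)%N.
Proof.
rewrite -sum1_card -(pair_big_dep xpredT (fun x y : 'I_p => x != y) (fun _ _ => 1%N)) /=.
rewrite (eq_bigr (fun=> p.-1)) ?sum_nat_const ?card_ord// => x _.
rewrite sum1_card -[in RHS](card_ord p) -(cardC1 x).
by apply: eq_card => y; rewrite !inE eq_sym.
Qed.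

(* By invariance all the orthonormal pairs have the same mean, and these means
   add up to at most sqfro D over the pairs of distinct vectors of a basis. *)
Lemma haar_form_orthonormal_le u v : sqfro u = 1 -> sqfro v = 1 ->
  u *m v^t* = 0 -> (haar_form u v <= beta%:E)%E.
Proof.
move=> u1 v1 uv; rewrite /beta.
have -> : p%:R * (p%:R - 1) = #|[pred x : 'I_p * 'I_p | x.1 != x.2]|%:R :> R.
  by rewrite card_off_diagonal natrM -subn1 natrB// ltnW.
pose f (x : 'I_p * 'I_p) (h : cmx R p) := sqnormc (conjD (h : 'M[R[i]]_p) x.1 x.2).
apply: (ge0_expectation_average_le (P := nu) (f := f)).
- by rewrite card_off_diagonal muln_gt0 (ltnW p_gt1) -subn1 subn_gt0.
- exact: sqfro_ge0.
- by move=> x; rewrite /f; mxmeasurability.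
- move=> [x y] /= xy; have [U Uu] := unitary_transport
    (col_mx_unitarymx (sqfro_delta_mx 0 x) (sqfro_delta_mx 0 y) (delta_mx_ortho xy))
    (col_mx_unitarymx u1 v1 uv).
  rewrite mul_col_mx => /eq_col_mx[<- <-]; rewrite haar_form_unitary//.
  by congr expectation; apply/funext => h; rewrite mul_delta_mx_form.
- apply: filterS haar_ae_unitary => h hu.
  rewrite -(sqfro_unitary_mul D hu) -(sqfro_mul_unitary _ (unitarymx_trmxC hu)).
  rewrite /sqfro pair_bigA [leRHS](bigID [pred x : 'I_p * 'I_p | x.1 != x.2])/= lerDl.
  by apply: sumr_ge0 => x _; exact: sqnormc_ge0.
Qed.

Lemma haar_form_ortho_le a b : a *m b^t* = 0 ->
  (haar_form a b <= (beta * (sqfro a * sqfro b))%:E)%E.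
Proof.
move=> ab; apply: haar_form_scale_le => a0 b0.
by apply: haar_form_orthonormal_le; rewrite ?sqfro_normalize ?normalize_ortho.
Qed.

(* Polarization turns a difference of diagonal values into off-diagonal ones. *)
Lemma haar_form_diag_sub_le u v : sqfro u = 1 -> sqfro v = 1 -> u *m v^t* = 0 ->
  ('E_nu[fun h : 'M[R[i]]_p => sqnormc (
      (u *m conjD h *m u^t* - v *m conjD h *m v^t*)%R ord0 ord0)] <= (4 * beta)%:E)%E.
Proof.
move=> u1 v1 uv.
have vNu : sqfro (- v) = 1 by rewrite sqfroN.
have uNv : u *m (- v)^t* = 0 by rewrite trmxCN mulmxN uv oppr0.
have [P2 M2] : sqfro (u + v) = 2 /\ sqfro (u - v) = 2.
  by rewrite !sqfroD_ortho// u1 v1 vNu.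
have ortho : (u + v) *m (u - v)^t* = 0.
  rewrite trmxCD trmxCN mulmxDl !mulmxDr !mulmxN uv (mul_trmxC_eq0C uv) !mul_trmxC_row.
  by rewrite u1 v1 oppr0 addr0 add0r subrr.
have bound x y : x *m y^t* = 0 -> sqfro x = 2 -> sqfro y = 2 ->
    (haar_form x y <= (beta * 4)%:E)%E.
  move=> xy x2 y2; apply: le_trans (haar_form_ortho_le xy) _.
  by rewrite x2 y2 lee_fin -natrM.
have polar h : u *m conjD h *m u^t* - v *m conjD h *m v^t* =
    2^-1%:C *: ((u + v) *m conjD h *m (u - v)^t* + (u - v) *m conjD h *m (u + v)^t*).
  rewrite !trmxCD trmxCN !(mulmxDl _ _ (conjD h)) mulNmx mulmx_polarization scalerA.
  by rewrite -(rmorph_nat (real_complex R)) -rmorphM mulVf ?scale1r.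
apply: (@le_trans _ _ 'E_nu[(fun h : 'M[R[i]]_p =>
    2^-1 * sqnormc (((u + v) *m conjD h *m (u - v)^t*) ord0 ord0) +
    2^-1 * sqnormc (((u - v) *m conjD h *m (u + v)^t*) ord0 ord0))%R]%E).
  apply: ge0_le_expectation => h; first exact: sqnormc_ge0.
  rewrite polar mxE sqnormcM sqnormc_real mxE.
  set P := ((_ *m _ *m _) _ _); set M := ((_ *m _ *m _) _ _).
  by have := sqnormcD_le P M; lra.
have -> : 4 * beta = 2^-1 * (beta * 4) + 2^-1 * (beta * 4) by lra.
have mform (x y : 'rV_p) : nnmeasurable (fun h : cmx R p =>
    2^-1 * sqnormc ((x *m conjD (h : 'M[R[i]]_p) *m y^t*) ord0 ord0)).
  by apply: nnmeasurableZ => //; exact: nnmeasurable_form.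
apply: ge0_expectationD_le; [exact: mform|exact: mform| |].
  by apply: ge0_expectationZ_le; [|exact: nnmeasurable_form|exact: bound].
apply: ge0_expectationZ_le; [by []|exact: nnmeasurable_form|].
exact: (bound _ _ (mul_trmxC_eq0C ortho)).
Qed.

Lemma traceless_form_average U h u : (0 < p)%N -> U \is unitarymx -> h \is unitarymx ->
  \tr D = 0 -> (u *m conjD h *m u^t*) ord0 ord0 = p%:R^-1 *
    \sum_x (u *m conjD h *m u^t* - row x U *m conjD h *m (row x U)^t*) ord0 ord0.
Proof.
move=> p0 Uu hu D0; have trN : \tr (U *m conjD h *m U^t*) = 0.
  rewrite mxtrace_mulC mulmxA (unitarymx_trmxC_mul Uu) mul1mx mxtrace_mulC mulmxA.
  by rewrite (unitarymx_trmxC_mul hu) mul1mx.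
under eq_bigr do rewrite mxE [X in _ + X]mxE -mulmx_row_col.
rewrite big_split /= sumr_const card_ord sumrN -[\sum_i _]/(\tr _) trN subr0.
by rewrite -[X in _ = _ * X]mulr_natl mulKf// pnatr_eq0 -lt0n.
Qed.

Lemma haar_form_diag_le u : \tr D = 0 -> sqfro u = 1 -> (haar_form u u <= (4 * beta)%:E)%E.
Proof.
move=> D0 u1; have p0 : (0 < p)%N by exact: ltnW.
have [U Uu Ue] := unitary_transport
  (row_unitarymx (sqfro_delta_mx 0 (Ordinal p0))) (row_unitarymx u1).
pose f x (h : cmx R p) := sqnormc ((u *m conjD (h : 'M[R[i]]_p) *m u^t* -
  row x U *m conjD (h : 'M[R[i]]_p) *m (row x U)^t*) ord0 ord0).
have mf x : nnmeasurable (f x).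
  by rewrite /f; mxmeasurability.
have fle x : ('E_nu[f x] <= (4 * beta)%:E)%E.
  have [->|x0] := eqVneq x (Ordinal p0).
    rewrite -(expectation_cst nu); apply: ge0_le_expectation => h; first exact: (mf _).2.
    by rewrite /f rowE Ue subrr mxE sqnormc0 mulr_ge0.
  apply: haar_form_diag_sub_le => //.
    by rewrite rowE sqfro_mul_unitary// sqfro_delta_mx.
  by rewrite -{1}Ue rowE trmxC_mul mulmxA (mulmxtVK _ Uu) delta_mx_ortho// eq_sym.
have -> : 4 * beta = \sum_(x < p) p%:R^-1 * (4 * beta).
  by rewrite sumr_const card_ord -[RHS]mulr_natl mulVKf// pnatr_eq0 -lt0n.
have pV0 : 0 <= p%:R^-1 :> R by rewrite invr_ge0.
apply: (@le_trans _ _ 'E_nu[(fun h => \sum_x p%:R^-1 * f x h)%R]%E); last first.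
  by apply: ge0_expectation_lincomb_le.
apply: ae_le_expectation => //.
  by apply: nnmeasurable_sum => x; exact: nnmeasurableZ.
apply: filterS haar_ae_unitary => h hu.
rewrite (traceless_form_average u p0 Uu hu D0) sqnormcM sqnormcV_nat -mulr_sumr.
rewrite expr2 -mulrA ler_wpM2l// ler_pdivrMl ?ltr0n// -[X in X%:R]card_ord.
exact: sqnormc_sum_le.
Qed.

Lemma haar_form_le a b : \tr D = 0 ->
  (haar_form a b <= (8 * beta * (sqfro a * sqfro b))%:E)%E.
Proof.
move=> D0; apply: haar_form_scale_le => /sqfro_normalize + /sqfro_normalize.
move: (normalize a) (normalize b) => u v u1 v1.
pose c := (v *m u^t*) ord0 ord0; pose f := v - c *: u.
have fu : f *m u^t* = 0.
  rewrite mulmxBl -scalemxAl mul_trmxC_row u1 [v *m _]mx11_scalar -/c.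
  by rewrite scale_scalar_mx mulr1 subrr.
have uf := mul_trmxC_eq0C fu.
have vE : v = c *: u + f by rewrite /f addrC subrK.
have cf : sqnormc c + sqfro f = 1.
  have cuf : (c *: u) *m f^t* = 0 by rewrite -scalemxAl uf scaler0.
  by rewrite -v1 [in RHS]vE (sqfroD_ortho cuf) sqfroZ u1 mulr1.
apply: (@le_trans _ _ 'E_nu[(fun h : 'M[R[i]]_p =>
    (2 * sqnormc c) * sqnormc ((u *m conjD h *m u^t*) ord0 ord0) +
    2 * sqnormc ((u *m conjD h *m f^t*) ord0 ord0))%R]%E).
  apply: ge0_le_expectation => h; first exact: sqnormc_ge0.
  rewrite vE trmxCD trmxCZ mulmxDr -scalemxAr mxE; apply: le_trans (sqnormcD_le _ _) _.
  by rewrite mxE sqnormcM sqnormc_conj mulrA.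
have c0 := sqnormc_ge0 c; have f0 := sqfro_ge0 f.
apply: (@le_trans _ _ (2 * sqnormc c * (4 * beta) + 2 * (beta * sqfro f))%:E); last first.
  have -> : 8 * beta = 8 * beta * (sqnormc c + sqfro f) by rewrite cf mulr1.
  by rewrite lee_fin; have := mulr_ge0 beta_ge0 f0; lra.
apply: ge0_expectationD_le; [by apply: nnmeasurableZ; rewrite ?mulr_ge0|exact: nnmeasurableZ| |].
  by apply: ge0_expectationZ_le; rewrite ?mulr_ge0//; exact: haar_form_diag_le.
by apply: ge0_expectationZ_le; rewrite // -[sqfro f]mul1r -u1; exact: haar_form_ortho_le.
Qed.

End conjugation.

Lemma haar_conj_le D a b : (0 < p)%N ->
  ('E_nu[fun h : 'M[R[i]]_p =>
      sqnormc ((a *m (h *m D *m h^t* - (\tr D / p%:R)%:M)%R *m b^t*) ord0 ord0)] <=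
   (64 * sqfro D / p%:R ^+ 2 * (sqfro a * sqfro b))%:E)%E.
Proof.
move=> p0; pose D0 := D - (\tr D / p%:R)%:M.
have trD0 : \tr D0 = 0.
  rewrite /D0 raddfB /= mxtrace_scalar -[(_ / _) *+ p]mulr_natr divfK ?subrr//.
  by rewrite pnatr_eq0 -lt0n.
apply: (@le_trans _ _ (haar_form D0 a b)).
  apply: ae_le_expectation; [by mxmeasurability..|].
  apply: filterS haar_ae_unitary => h hu.
  rewrite (_ : h *m D0 *m h^t* = h *m D *m h^t* - (\tr D / p%:R)%:M)//.
  by rewrite mulmxBr mulmxBl mul_mx_scalar -scalemxAl (unitarymxP hu) scalemx1.
have [p1|p1] := ltnP 1 p.
  apply: le_trans (haar_form_le p1 a b trD0) _; rewrite lee_fin.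
  rewrite ler_wpM2r ?mulr_ge0 ?sqfro_ge0//.
  have p2 : 2 <= p%:R :> R by rewrite ler_nat.
  have pV : (p%:R * (p%:R - 1))^-1 <= 2 / p%:R ^+ 2 :> R.
    have pp : 2 * p%:R <= p%:R ^+ 2 :> R by rewrite expr2 ler_wpM2r.
    by rewrite -[leRHS]invf_div lef_pV2 ?posrE; lra.
  have -> : 64 * sqfro D / p%:R ^+ 2 = 8 * (4 * sqfro D * (2 / p%:R ^+ 2)).
    by field; rewrite pnatr_eq0 -lt0n.
  rewrite ler_pM2l// ler_pM ?sqfro_ge0 ?sqfro_traceless_le// invr_ge0.
  by nra.
have -> : D0 = 0.
  have ord_eq (i j : 'I_p) : i = j.
    by apply: val_inj; case: i j => i + [j] /=; lia.
  apply/matrixP => i j; rewrite [RHS]mxE (ord_eq j i) -trD0 /mxtrace (bigD1 i)//=.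
  by rewrite big1 ?addr0// => k; rewrite (ord_eq k i) eqxx.
have -> : haar_form 0 a b = 0%E.
  transitivity ('E_nu[cst 0%R])%E; last exact: expectation_cst.
  congr expectation; apply/funext => h.
  by rewrite mulmx0 mul0mx mulmx0 mul0mx mxE sqnormc0.
by rewrite lee_fin !mulr_ge0 ?sqfro_ge0// invr_ge0 exprn_ge0.
Qed.

End haar.

(** * Independence *)

Section independence.
Context {R : realType} {d d' : measure_display} {T : measurableType d}
  {Y : measurableType d'} (P : probability T R) (I : finType).
Variables (F : I -> set (set T)) (i0 : I).
Hypothesis F_measurable : forall i A, F i A -> measurable A.
Hypothesis F_setT : forall i, F i setT.
Hypothesis F_setI : forall i, setI_closed (F i).
Hypothesis F_indep : mutually_independent P F.

Definition cylinders_but : set (set T) :=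
  [set A | exists E : I -> set T, (forall i, F i (E i)) /\
    A = \bigcap_(i in [set i | i \in [set~ i0]%SET]) E i].

Lemma cylinders_but_measurable : cylinders_but `<=` measurable.
Proof.
move=> _ [E [FE ->]]; apply: fin_bigcap_measurable => //.
by move=> i _; exact: F_measurable (FE i).
Qed.

Lemma cylinders_but_setT : cylinders_but setT.
Proof. by exists (fun=> setT); split => //; rewrite bigcapT. Qed.

Lemma cylinders_but_setI : setI_closed cylinders_but.
Proof.
move=> _ _ [E [FE ->]] [E' [FE' ->]]; exists (fun i => E i `&` E' i).
by split=> [i|]; [exact: F_setI|rewrite bigcapI].
Qed.

Lemma sub_cylinders_but i A : i != i0 -> F i A -> cylinders_but A.
Proof.
move=> ii FA; exists (fun j => if j == i then A else setT); split.
  by move=> j; case: eqP => [->|].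
apply/seteqP; split=> [w Aw j _|w]; first by case: ifP.
by move/(_ i); rewrite /= eqxx; apply; rewrite !inE.
Qed.

Lemma cylinder_but_indep A B : cylinders_but A -> F i0 B -> P (A `&` B) = (P A * P B)%E.
Proof.
move=> [E [FE ->]] FB; pose E' i := if i == i0 then B else E i.
have : P (\bigcap_(i in [set i | i \in [set: I]%SET]) E' i) =
    (\prod_(i in [set: I]%SET) P (E' i))%E.
  by apply: F_indep => i _; rewrite /E'; case: eqP => [->|].
rewrite (_ : \bigcap_(i in [set i | i \in [set: I]%SET]) E' i =
   \bigcap_(i in [set i | i \in [set~ i0]%SET]) E i `&` B); last first.
  apply/seteqP; split=> w.
    move=> h; split; last by have := h i0 (finset.in_setT _); rewrite /E' eqxx.
    move=> i; rewrite /= !inE => ii; have := h i (finset.in_setT _).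
    by rewrite /E' (negbTE ii).
  move=> [h wB] i _; rewrite /E'; case: eqP => // /eqP ii.
  by apply: h; rewrite /= !inE.
move=> ->; rewrite (F_indep (J := [set~ i0]%SET) (E := E)) => [|i _]; last exact: FE.
rewrite (bigD1 i0) ?inE//= {1}/E' eqxx muleC; congr (_ * _)%E.
apply: eq_big => i; first by rewrite !inE.
by rewrite /E' !inE => /negbTE ->.
Qed.

Lemma generated_but_indep A B : <<s cylinders_but >> A -> F i0 B ->
  P (A `&` B) = (P A * P B)%E.
Proof.
move=> sA FB; have mB := F_measurable FB.
have PB : P B \is a fin_num by exact: fin_num_measure.
pose c := NngNum (fine_ge0 (measure_ge0 P B)).
have mscaleE A' : mscale c P A' = (P A' * P B)%E by rewrite /mscale /= fineK// muleC.
rewrite -mscaleE; have -> : P (A `&` B) = mrestr P mB A by [].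
apply: (g_sigma_algebra_measure_unique cylinders_but _ (fun=> setT) _ _ (mrestr P mB)) sA.
- exact: cylinders_but_measurable.
- by move=> _; exact: cylinders_but_setT.
- by rewrite bigcup_const.
- exact: cylinders_but_setI.
- by move=> C cC; apply: etrans (esym (mscaleE _)); exact: cylinder_but_indep.
- by move=> _; rewrite -ge0_fin_numE// fin_num_measure.
Qed.

(* T equipped with the sigma-algebra of all the sources but i0: Tonelli can then
   be applied to the pair of the identity and of a variable of source i0. *)
Definition all_but : Type := g_sigma_algebraType cylinders_but.
HB.instance Definition _ := Measurable.on all_but.

Lemma measurable_but_id : measurable_fun setT (fun w : T => w : all_but).
Proof.
move=> _ A sA; rewrite setTI; apply: (smallest_sub _ _ sA).
  exact: sigma_algebra_measurable.
exact: cylinders_but_measurable.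
Qed.

Variables (X : T -> Y) (law : probability Y R).
Hypothesis X_measurable : measurable_fun setT X.
Hypothesis X_source : forall B, measurable B -> F i0 (X @^-1` B).
Hypothesis X_law : forall B, measurable B -> P (X @^-1` B) = law B.

Let id_but : {mfun T >-> all_but} :=
  HB.pack (fun w : T => w : all_but) (isMeasurableFun.Build _ _ _ _ _ measurable_but_id).
Let P_but : probability all_but R := distribution P id_but.

Let pair_but w : all_but * Y := (w, X w).

Let measurable_pair_but : measurable_fun setT pair_but.
Proof. by apply: measurable_fun_pair => //; exact: measurable_but_id. Qed.

Let pair_mfun : {mfun T >-> (all_but * Y)%type} :=
  HB.pack pair_but (isMeasurableFun.Build _ _ _ _ _ measurable_pair_but).

Lemma pair_but_law (A : set (all_but * Y)) : measurable A ->
  P (pair_but @^-1` A) = (P_but \x law)%E A.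
Proof.
move=> mA; apply/esym.
apply: (@product_measure_unique _ _ _ _ _ P_but law (distribution P pair_mfun)) mA.
move=> B C mB mC; suff : P ((B : set T) `&` X @^-1` C) = (P B * law C)%E by [].
by rewrite -X_law//; apply: generated_but_indep => //; exact: X_source.
Qed.

Lemma indep_tonelli (phi : all_but * Y -> R) : nnmeasurable phi ->
  'E_P[fun w => phi (w, X w)]%E = (\int[P]_w 'E_law[fun y => phi (w, y)])%E.
Proof.
move=> mphi; have [/measurable_EFinP mphi' phi0] := mphi.
have phi0' z : (0 <= (phi z)%:E)%E by rewrite lee_fin.
rewrite (ge0_expectation_transfer measurable_pair_but mphi pair_but_law) unlock.
rewrite fubini_tonelli1// ge0_integral_distribution//.
- exact: measurable_fun_fubini_tonelli_F.
- by move=> w; exact: integral_ge0.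
Qed.

Lemma indep_expectation_le (phi : all_but * Y -> R) (b : T -> R) : nnmeasurable phi ->
  (forall w, 'E_law[fun y => phi (w, y)] <= (b w)%:E)%E ->
  ('E_P[fun w => phi (w, X w)] <= 'E_P[b])%E.
Proof.
move=> mphi phib; rewrite indep_tonelli//.
have -> : ('E_P[b] = \int[P]_w (b w)%:E)%E by rewrite unlock.
apply: ge0_le_integralT => // w; apply: expectation_ge0 => y.
exact: mphi.2.
Qed.

Lemma indep_expectationM (f : all_but -> R) (g : Y -> R) :
  nnmeasurable f -> nnmeasurable g ->
  'E_P[(fun w => f w * g (X w))%R]%E = ('E_P[f] * 'E_law[g])%E.
Proof.
move=> mf mg; rewrite (indep_tonelli (phi := fun z => f z.1 * g z.2)); last first.
  apply: (nnmeasurableM (f := fun z => f z.1) (g := fun z => g z.2)).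
    exact: (nnmeasurable_comp (g := @fst all_but Y) mf measurable_fst).
  exact: (nnmeasurable_comp (g := @snd all_but Y) mg measurable_snd).
under eq_integral => w _ do rewrite (ge0_expectationZ law (mf.2 w) mg) muleC.
rewrite ge0_integralZl//.
- by rewrite muleC; congr (_ * _)%E; rewrite unlock.
- apply/measurable_EFinP; exact: (nnmeasurable_comp mf measurable_but_id).1.
- by move=> w _; rewrite lee_fin; exact: mf.2.
- exact: expectation_ge0 mg.2.
Qed.

End independence.

(** * Ampliations *)

Section ampliation.
Context {R : realType} (n k : nat).
Implicit Types A B : 'M[R[i]]_n.

Lemma sum_mxtens (V : nmodType) (f : 'I_(n * k) -> V) :
  \sum_q f q = \sum_(i < n) \sum_(c < k) f (mxtens.mxtens_index (i, c)).
Proof.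
rewrite pair_big (reindex (@mxtens.mxtens_index n k)) /=; last first.
  by exists (@mxtens.mxtens_unindex n k) => x _;
    [exact: mxtens.mxtens_indexK|exact: mxtens.mxtens_unindexK].
by apply: eq_bigr => -[].
Qed.

Lemma ampliationE A i j c e :
  ampliation k A (mxtens.mxtens_index (i, c)) (mxtens.mxtens_index (j, e)) =
  A i j * (c == e)%:R.
Proof. by rewrite /ampliation mxtens.tensmxE mxE. Qed.

Lemma ampliationM A B : ampliation k (A *m B) = ampliation k A *m ampliation k B.
Proof. by rewrite /ampliation mxtens.tensmx_mul mulmx1. Qed.

Lemma ampliation_trmxC A : (ampliation k A)^t* = ampliation k (A^t*).
Proof.
rewrite /ampliation mxtens.trmx_tens trmx1 mxtens.map_mxT; congr mxtens.tensmx.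
by rewrite map_mx1.
Qed.

Lemma ampliation1 : ampliation k (1%:M : 'M[R[i]]_n) = 1%:M.
Proof.
apply/matrixP => p q; case: (mxtens.mxtens_indexP p) (mxtens.mxtens_indexP q).
move=> i c [j e]; rewrite ampliationE !mxE (can_eq (@mxtens.mxtens_indexK n k)).
by rewrite xpair_eqE -natrM mulnb.
Qed.

Lemma ampliationZ x A : ampliation k (x *: A) = x *: ampliation k A.
Proof. by apply/matrixP => i j; rewrite !mxE mulrA. Qed.

Lemma ampliation0 : ampliation k (0 : 'M[R[i]]_n) = 0.
Proof. by rewrite /ampliation mxtens.tens0mx. Qed.

Lemma mxtrace_ampliation A : \tr (ampliation k A) = k%:R * \tr A.
Proof.
rewrite /mxtrace sum_mxtens mulr_sumr; apply: eq_bigr => i _.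
under eq_bigr do rewrite ampliationE eqxx mulr1.
by rewrite sumr_const card_ord mulr_natl.
Qed.

Lemma sqfro_ampliation A : sqfro (ampliation k A) = k%:R * sqfro A.
Proof.
apply: (@complexI R); rewrite -mxtrace_mul_trmxC ampliation_trmxC -ampliationM.
by rewrite mxtrace_ampliation mxtrace_mul_trmxC rmorphM /= rmorph_nat.
Qed.

(* The n-dimensional Frobenius norm suffices here: the k slices of a row are
   multiplied by A separately. *)
Lemma sqfro_mul_ampliation_le a (v : 'M[R[i]]_(a, n * k)) A :
  sqfro (v *m ampliation k A) <= sqfro v * sqfro A.
Proof.
rewrite /sqfro mulr_suml; apply: ler_sum => i _.
rewrite !sum_mxtens exchange_big /= [X in _ <= X * _]exchange_big /= mulr_suml.
apply: ler_sum => c _; rewrite [X in _ <= _ * X]exchange_big mulr_sumr.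
apply: ler_sum => j _.
rewrite (_ : (v *m _) _ _ = \sum_(l < n) v i (mxtens.mxtens_index (l, c)) * A l j).
  exact: sqnormc_dot_le.
rewrite mxE sum_mxtens; apply: eq_bigr => l _; rewrite (bigD1 c)//= big1 ?addr0.
  by rewrite ampliationE eqxx mulr1.
by move=> e ec; rewrite ampliationE (negbTE ec) !mulr0.
Qed.

End ampliation.

Section corner.
Context {R : realType} (n k : nat).
Hypothesis k_gt0 : (0 < k)%N.
Implicit Types (A : 'M[R[i]]_n) (x y : 'I_n).

Local Notation corner := (pid_mx n : 'M[R[i]]_(n, n * k)).
Local Notation widen := (widen_ord (leq_pmulr n k_gt0)).

Lemma corner_trmxC : corner^t* = (pid_mx n : 'M[R[i]]_(n * k, n)).
Proof. by rewrite tr_pid_mx map_pid_mx. Qed.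

Lemma corner_unitarymx : corner \is unitarymx.
Proof.
by apply/unitarymxP; rewrite corner_trmxC pid_mx_id ?leq_pmulr// pid_mx_1.
Qed.

Lemma mul_corner_trmxC a (M : 'M[R[i]]_(a, n * k)) i x :
  (M *m corner^t*) i x = M i (widen x).
Proof.
rewrite corner_trmxC mxE (bigD1 (widen x))//= big1 ?addr0.
  by rewrite mxE /= eqxx ltn_ord mulr1.
move=> q qx; rewrite mxE (_ : (_ == _) = false) ?mulr0//.
by apply: contraNF qx => /eqP h; apply/eqP/val_inj.
Qed.

Lemma mul_corner_conjE (B : 'M[R[i]]_(n * k)) x y :
  (corner *m B *m corner^t*) x y = B (widen x) (widen y).
Proof.
rewrite mul_corner_trmxC -[in LHS](trmxCK (corner *m B)) trmxCE trmxC_mul.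
by rewrite mul_corner_trmxC trmxCE conjcK.
Qed.

Lemma sqfro_mul_corner_trmxC_le a (M : 'M[R[i]]_(a, n * k)) :
  sqfro (M *m corner^t*) <= sqfro M.
Proof.
apply: ler_sum => i _; under eq_bigr do rewrite mul_corner_trmxC.
rewrite [leRHS](bigID (fun q : 'I_(n * k) => (q < n)%N)) /=.
rewrite -[leLHS]addr0; apply: lerD; last by apply: sumr_ge0 => *; exact: sqnormc_ge0.
by rewrite (big_ord_narrow (leq_pmulr n k_gt0)).
Qed.

Lemma sqfro_mul_corner a (M : 'M[R[i]]_(a, n)) : sqfro (M *m corner) = sqfro M.
Proof.
apply: (@complexI R); rewrite -!mxtrace_mul_trmxC trmxC_mul mulmxA.
by rewrite (mulmxtVK _ corner_unitarymx).
Qed.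

Lemma sqfro_corner_trmxC_mul a (M : 'M[R[i]]_(n, a)) : sqfro (corner^t* *m M) = sqfro M.
Proof. by rewrite -sqfro_trmxC trmxC_mul trmxCK sqfro_mul_corner sqfro_trmxC. Qed.

Lemma sqfro_row_corner x : sqfro (row x corner) = 1.
Proof. by rewrite rowE sqfro_mul_corner sqfro_delta_mx. Qed.

Lemma corner_ampliation A (o x y : 'I_n) : val o = 0%N -> (n <= k)%N ->
  (corner *m ampliation k A *m corner^t*) x y = A o o * (x == y)%:R.
Proof.
move=> o0 nk; have wE (z : 'I_n) : widen z = mxtens.mxtens_index (o, widen_ord nk z).
  by apply: val_inj; rewrite /= o0 mul0n.
by rewrite mul_corner_conjE !wE ampliationE.
Qed.

Lemma sqnormc_corner_ampliation_le A x y :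
  sqnormc ((corner *m ampliation k A *m corner^t*) x y) <= sqfro A.
Proof.
rewrite mul_corner_conjE; case: (mxtens.mxtens_indexP (widen x)) => i c.
case: (mxtens.mxtens_indexP (widen y)) => j e.
rewrite ampliationE sqnormcM -[leRHS]mulr1.
by rewrite ler_pM ?sqnormc_ge0 ?sqnormc_le_sqfro ?sqnormc_bool_le1.
Qed.

End corner.

(** * Concentration of words in the random matrices *)

Section words.
Context {R : realType} (m n k : nat).
Hypotheses (n_gt0 : (0 < n)%N) (k_gt0 : (0 < k)%N).
Local Notation p := (n * k)%N.
Local Notation corner := (pid_mx n : 'M[R[i]]_(n, p)).
Implicit Types (A D : 'M[R[i]]_n) (U : 'M[R[i]]_p) (u v : 'rV[R[i]]_p).
Implicit Types (g : 'I_m -> 'M[R[i]]_n) (h : 'I_m -> 'M[R[i]]_p).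
Implicit Types (S : {set 'I_m}) (s r : seq 'I_m).

Definition append (b : bool) A U v : 'rV[R[i]]_p :=
  if b then v *m ampliation k A *m U else v.

Definition word g h S s : 'M[R[i]]_p :=
  \prod_(i <- s | i \in S) (ampliation k (g i) *m h i).

Definition wordrow g h S s (x : 'I_n) : 'rV[R[i]]_p := row x (corner *m word g h S s).

(* The mean of (A (x) I) U (D (x) I) U^* (A (x) I)^*, of (A (x) I) U (D (x) I), and
   so on, over a Haar unitary U, up to the ampliation. *)
Definition mean_step (b1 b2 : bool) A D : 'M[R[i]]_n :=
  if b1 && b2 then (\tr D / n%:R) *: (A *m A^t*) else if b1 || b2 then 0 else D.

Fixpoint meanmx g S1 S2 r : 'M[R[i]]_n :=
  if r is j :: r' then mean_step (j \in S1) (j \in S2) (g j) (meanmx g S1 S2 r') else 1%:M.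

(* An entry of the corner of X_S1 X_S2^*, for the words along s ++ r, where the
   unitaries along r have been averaged out. *)
Definition hybrid g h S1 S2 s r (x y : 'I_n) : R[i] :=
  (wordrow g h S1 s x *m ampliation k (meanmx g S1 S2 r) *m (wordrow g h S2 s y)^t*) ord0 ord0.

Definition letter_weight (b : bool) A : R := if b then 1 + sqfro A ^+ 2 else 1.

Definition weight g S1 S2 s : R :=
  \prod_(i <- s) letter_weight ((i \in S1) || (i \in S2)) (g i).

Lemma letter_weight_ge1 b A : 1 <= letter_weight b A.
Proof. by case: b => //=; rewrite lerDl sqr_ge0. Qed.

Lemma letter_weight_ge0 b A : 0 <= letter_weight b A.
Proof. exact: le_trans (letter_weight_ge1 b A). Qed.

Lemma weight_ge0 g S1 S2 s : 0 <= weight g S1 S2 s.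
Proof. by apply: prodr_ge0 => i _; exact: letter_weight_ge0. Qed.

Lemma sqfro_le_letter_weight A : sqfro A <= letter_weight true A.
Proof. by rewrite /=; have := sqr_ge0 (sqfro A - 1); nra. Qed.

Lemma sqr_sqfro_le_letter_weight A : sqfro A ^+ 2 <= letter_weight true A.
Proof. by rewrite /= lerDr. Qed.

Lemma wordrow_nil g h S x : wordrow g h S [::] x = row x corner.
Proof. by rewrite /wordrow /word big_nil; congr row; exact: mulmx1. Qed.

Lemma wordrow_rcons g h S s j x :
  wordrow g h S (rcons s j) x = append (j \in S) (g j) (h j) (wordrow g h S s x).
Proof.
rewrite /wordrow /word /append big_rcons /=; case: ifP => _; last first.
  by congr (row x (_ *m _)); exact: mulmx1.
by rewrite -!row_mul; congr row; rewrite -!mulmxA.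
Qed.

Lemma sqfro_wordrow_le g h S s x : (forall i, h i \is unitarymx) ->
  sqfro (wordrow g h S s x) <= \prod_(i <- s | i \in S) sqfro (g i).
Proof.
move=> hu; elim/last_ind: s => [|s j IH].
  by rewrite wordrow_nil big_nil sqfro_row_corner.
rewrite wordrow_rcons big_rcons /=; case: ifP => _; last by rewrite mulr1.
rewrite /append sqfro_mul_unitary//; apply: le_trans (sqfro_mul_ampliation_le _ _) _.
by rewrite ler_wpM2r// sqfro_ge0.
Qed.

Lemma prod_sqfro_le_weight g S1 S2 s :
  (\prod_(i <- s | i \in S1) sqfro (g i)) * (\prod_(i <- s | i \in S2) sqfro (g i))
  <= weight g S1 S2 s.
Proof.
rewrite big_mkcond [X in _ * X]big_mkcond -big_split; apply: ler_prod => i _ /=.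
have f0 := sqfro_ge0 (g i); apply/andP; split.
  by rewrite mulr_ge0//; case: ifP.
case: (i \in S1); case: (i \in S2) => /=; rewrite ?mul1r ?mulr1//.
- by rewrite -expr2 sqr_sqfro_le_letter_weight.
- exact: sqfro_le_letter_weight.
- exact: sqfro_le_letter_weight.
Qed.

Lemma sqfro_mean_step_le b1 b2 A D :
  sqfro (mean_step b1 b2 A D) <= letter_weight (b1 || b2) A * sqfro D.
Proof.
have D0 := sqfro_ge0 D; have w0 := letter_weight_ge0 (b1 || b2) A.
rewrite /mean_step; case: b1 b2 w0 => -[] /= w0; rewrite ?sqfro0 ?mulr_ge0 ?mul1r//.
rewrite sqfroZ mulrC ler_pM ?sqfro_ge0 ?sqnormc_ge0//.
  apply: le_trans (sqr_sqfro_le_letter_weight A).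
  by apply: le_trans (sqfro_mul_le _ _) _; rewrite sqfro_trmxC expr2.
apply: le_trans (sqnormc_normalized_mxtrace_le D).
by rewrite ler_peMl ?sqnormc_ge0// ler1n.
Qed.

Lemma sqfro_meanmx_le g S1 S2 r : sqfro (meanmx g S1 S2 r) <= n%:R * weight g S1 S2 r.
Proof.
elim: r => [|j r IH]; first by rewrite /weight big_nil sqfro_scalar_mx sqnormc1.
apply: le_trans (sqfro_mean_step_le _ _ _ _) _.
by rewrite [weight _ _ _ _]big_cons mulrCA ler_wpM2l ?letter_weight_ge0.
Qed.

Lemma meanmx_eq0 g S1 S2 r : has (fun j => (j \in S1) != (j \in S2)) r ->
  meanmx g S1 S2 r = 0.
Proof.
elim: r => [|j r IH] //= /orP[|/IH ->]; rewrite /mean_step.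
  by case: (j \in S1); case: (j \in S2).
by rewrite mxtrace0 mul0r scale0r; case: ifP => _ //; case: ifP.
Qed.

(* When k < n the corner overlaps several blocks of the ampliation; then
   1 / k > 1 / n, so that the trivial bound is already of order 1 / p. *)
Lemma hybrid_nil_le g h S1 S2 r (o x y : 'I_n) : val o = 0%N ->
  sqnormc (hybrid g h S1 S2 [::] r x y - meanmx g S1 S2 r o o * (x == y)%:R) <=
  64 * n%:R ^+ 3 / p%:R * weight g S1 S2 r.
Proof.
move=> o0; rewrite /hybrid !wordrow_nil -mulmx_row_col.
have w0 := weight_ge0 g S1 S2 r; have D0 := sqfro_meanmx_le g S1 S2 r.
have [nk|kn] := leqP n k.
  rewrite (corner_ampliation k_gt0 _ _ _ o0 nk) subrr sqnormc0.
  by rewrite mulr_ge0// divr_ge0// mulr_ge0// exprn_ge0.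
have trivial_le : sqnormc (meanmx g S1 S2 r o o * (x == y)%:R) <= sqfro (meanmx g S1 S2 r).
  by rewrite sqnormcM -[leRHS]mulr1 ler_pM ?sqnormc_ge0 ?sqnormc_le_sqfro ?sqnormc_bool_le1.
apply: le_trans (sqnormcD_le _ _) _; rewrite sqnormcN.
apply: (@le_trans _ _ (4 * (n%:R * weight g S1 S2 r))).
  have := sqnormc_corner_ampliation_le k_gt0 (meanmx g S1 S2 r) x y.
  by lra.
rewrite mulrA ler_wpM2r// natrM.
have -> : 64 * n%:R ^+ 3 / (n%:R * k%:R) = 64 * n%:R * (n%:R / k%:R) :> R.
  by field; rewrite !pnatr_eq0 -!lt0n n_gt0 k_gt0.
have : 1 <= n%:R / k%:R :> R by rewrite ler_pdivlMr ?ltr0n// mul1r ler_nat ltnW.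
have n0 : 0 <= n%:R :> R by [].
by nra.
Qed.

Definition step_error b1 b2 A D u v U : R[i] :=
  (append b1 A U u *m ampliation k D *m (append b2 A U v)^t* -
   u *m ampliation k (mean_step b1 b2 A D) *m v^t*) ord0 ord0.

Lemma hybrid_rcons_sub g h S1 S2 s j r x y :
  hybrid g h S1 S2 (rcons s j) r x y - hybrid g h S1 S2 s (j :: r) x y =
  step_error (j \in S1) (j \in S2) (g j) (meanmx g S1 S2 r)
    (wordrow g h S1 s x) (wordrow g h S2 s y) (h j).
Proof.
by rewrite /hybrid /step_error !wordrow_rcons [RHS]mxE; congr (_ + _); rewrite [RHS]mxE.
Qed.

Definition step_bound (b1 b2 : bool) A D u v : R :=
  64 / p%:R * (letter_weight (b1 || b2) A * (sqfro u * sqfro v * sqfro D)).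

Lemma step_bound_le_weight g h S1 S2 s j r x y : (forall i, h i \is unitarymx) ->
  step_bound (j \in S1) (j \in S2) (g j) (meanmx g S1 S2 r)
    (wordrow g h S1 s x) (wordrow g h S2 s y) <=
  64 * n%:R ^+ 3 / p%:R * weight g S1 S2 (s ++ j :: r).
Proof.
move=> hu; rewrite /weight big_cat big_cons /= -!/(weight _ _ _ _) /step_bound.
have lw0 := letter_weight_ge0 ((j \in S1) || (j \in S2)) (g j).
have := weight_ge0 g S1 S2 s; have := weight_ge0 g S1 S2 r.
move: (letter_weight _ _) lw0 => l l0 r0 s0.
apply: (@le_trans _ _ (64 / p%:R * (l * (weight g S1 S2 s * (n%:R * weight g S1 S2 r))))).
  rewrite ler_wpM2l ?divr_ge0// ler_wpM2l// ler_pM ?mulr_ge0 ?sqfro_ge0 ?sqfro_meanmx_le//.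
  apply: le_trans (prod_sqfro_le_weight _ _ _ _).
  by rewrite ler_pM ?sqfro_ge0 ?sqfro_wordrow_le.
rewrite [leRHS](_ : _ = 64 / p%:R * (l * (weight g S1 S2 s * (n%:R ^+ 3 * weight g S1 S2 r)))).
  rewrite ler_wpM2l ?divr_ge0// ler_wpM2l// ler_wpM2l// ler_wpM2r//.
  by rewrite -[leLHS]expr1 ler_weXn2l// ler1n.
by ring.
Qed.

Section haar_step.
Variable nu : probability (cmx R p) R.
Hypothesis nu_haar : haar_unitary nu.

Let p_gt0 : (0 < p)%N. Proof. by rewrite muln_gt0 n_gt0. Qed.

Lemma haar_step_left_le A D u v :
  ('E_nu[fun U : 'M[R[i]]_p => sqnormc (step_error true false A D u v U)] <=
   (step_bound true false A D u v)%:E)%E.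
Proof.
have -> : (fun U : 'M[R[i]]_p => sqnormc (step_error true false A D u v U)) =
    (fun U : 'M[R[i]]_p =>
      sqnormc ((u *m ampliation k A *m U *m (v *m ampliation k (D^t*))^t*) ord0 ord0)).
  apply/funext => U; rewrite /step_error /mean_step /= ampliation0 mulmx0 mul0mx subr0.
  by rewrite trmxC_mul ampliation_trmxC trmxCK mulmxA.
apply: le_trans (haar_entry_le nu_haar _ _ p_gt0) _.
rewrite lee_fin; apply: (@le_trans _ _
    (letter_weight true A * sqfro u * (sqfro v * sqfro D) / p%:R)).
  rewrite ler_wpM2r ?invr_ge0// ler_pM ?sqfro_ge0//.
    apply: le_trans (sqfro_mul_ampliation_le _ _) _.
    by rewrite mulrC ler_wpM2r ?sqfro_ge0 ?sqfro_le_letter_weight.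
  by apply: le_trans (sqfro_mul_ampliation_le _ _) _; rewrite sqfro_trmxC.
rewrite [leRHS](_ : _ = 64 * (letter_weight true A * sqfro u * (sqfro v * sqfro D) / p%:R)).
  by rewrite ler_peMl ?ler1n// !mulr_ge0 ?letter_weight_ge0 ?sqfro_ge0 ?invr_ge0.
by rewrite /step_bound; ring.
Qed.

Lemma haar_step_both_le A D u v :
  ('E_nu[fun U : 'M[R[i]]_p => sqnormc (step_error true true A D u v U)] <=
   (step_bound true true A D u v)%:E)%E.
Proof.
have pR : 0 < p%:R :> R by rewrite ltr0n.
pose D' := ampliation k D; pose A' := ampliation k A.
have trE : \tr D' / p%:R = \tr D / n%:R.
  by rewrite mxtrace_ampliation natrM [k%:R * _]mulrC -mulf_div divff ?mulr1// pnatr_eq0 -lt0n.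
have -> : (fun U : 'M[R[i]]_p => sqnormc (step_error true true A D u v U)) =
    (fun U : 'M[R[i]]_p => sqnormc (((u *m A') *m (U *m D' *m U^t* - (\tr D' / p%:R)%:M)
      *m (v *m A')^t*) ord0 ord0)).
  apply/funext => U; congr (sqnormc (_ ord0 ord0)); rewrite /mean_step /= trE.
  rewrite ampliationZ ampliationM -ampliation_trmxC -/A' -/D'.
  move: (\tr D / _) => t; rewrite mulmxBr mulmxBl mul_mx_scalar !trmxC_mul !mulmxA.
  by rewrite -!scalemxAr -!scalemxAl !mulmxA.
apply: le_trans (haar_conj_le nu_haar _ _ _ p_gt0) _; rewrite sqfro_ampliation lee_fin.
have -> : 64 * (k%:R * sqfro D) / p%:R ^+ 2 * (sqfro (u *m A') * sqfro (v *m A')) =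
    64 / p%:R * (sqfro (u *m A') * sqfro (v *m A') * sqfro D * (k%:R / p%:R)).
  by field; rewrite !pnatr_eq0 -!lt0n k_gt0.
rewrite /step_bound ler_pM2l ?divr_gt0// [leRHS]mulrA -[leRHS]mulr1.
rewrite ler_pM ?mulr_ge0 ?sqfro_ge0 ?invr_ge0//; last first.
  by rewrite ler_pdivrMr// mul1r ler_nat leq_pmull.
rewrite ler_wpM2r ?sqfro_ge0//; apply: (@le_trans _ _ (sqfro A ^+ 2 * (sqfro u * sqfro v))).
  rewrite (_ : _ ^+ 2 * _ = (sqfro u * sqfro A) * (sqfro v * sqfro A)); last by ring.
  by rewrite ler_pM ?sqfro_ge0 ?sqfro_mul_ampliation_le.
by rewrite ler_wpM2r ?mulr_ge0 ?sqfro_ge0 ?sqr_sqfro_le_letter_weight.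
Qed.

Lemma haar_step_le b1 b2 A D u v :
  ('E_nu[fun U : 'M[R[i]]_p => sqnormc (step_error b1 b2 A D u v U)] <=
   (step_bound b1 b2 A D u v)%:E)%E.
Proof.
case: b1 b2 => -[]; [exact: haar_step_both_le|exact: haar_step_left_le| |].
  have -> : (fun U : 'M[R[i]]_p => sqnormc (step_error false true A D u v U)) =
      (fun U => sqnormc (step_error true false A (D^t*) v u U)).
    apply/funext => U; rewrite -sqnormc_conj; congr sqnormc.
    rewrite /step_error /mean_step /= !ampliation0 !mulmx0 !mul0mx !subr0 -trmxCE.
    by rewrite trmxC_mul trmxCK trmxC_mul ampliation_trmxC mulmxA.
  apply: le_trans (haar_step_left_le _ _ _ _) _.
  by rewrite /step_bound sqfro_trmxC (mulrC (sqfro v)).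
rewrite -(expectation_cst nu); apply: ge0_le_expectation => U; first exact: sqnormc_ge0.
rewrite /step_error /mean_step /= subrr mxE sqnormc0 /step_bound.
by rewrite !mulr_ge0 ?invr_ge0 ?letter_weight_ge0 ?sqfro_ge0.
Qed.

End haar_step.

End words.

Section measurability_words.
Context {R : realType} (m n k : nat) {d : measure_display} {W : measurableType d}.
Local Notation p := (n * k)%N.
Variables (g : 'I_m -> W -> 'M[R[i]]_n) (h : 'I_m -> W -> 'M[R[i]]_p).
Implicit Types (S : {set 'I_m}) (s r : seq 'I_m).

Lemma mxmeasurable_append b (A : W -> 'M[R[i]]_n) (U : W -> 'M[R[i]]_p) (v : W -> 'rV[R[i]]_p) :
  mxmeasurable A -> mxmeasurable U -> mxmeasurable v ->
  mxmeasurable (fun w => append b (A w) (U w) (v w)).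
Proof. by case: b => mA mU mv //=; mxmeasurability. Qed.

Lemma mxmeasurable_mean_step b1 b2 (A D : W -> 'M[R[i]]_n) :
  mxmeasurable A -> mxmeasurable D -> mxmeasurable (fun w => mean_step b1 b2 (A w) (D w)).
Proof. by move=> mA mD; case: b1 b2 => -[]; rewrite /mean_step /=; mxmeasurability. Qed.

Lemma mxmeasurable_wordrow S s x : {in s, forall i, mxmeasurable (g i)} ->
  {in s, forall i, mxmeasurable (h i)} ->
  mxmeasurable (fun w => wordrow (g^~ w) (h^~ w) S s x).
Proof.
elim/last_ind: s => [|s j IH] gs hs.
  by under eq_fun do rewrite wordrow_nil; exact: mxmeasurable_cst.
under eq_fun do rewrite wordrow_rcons; apply: mxmeasurable_append.
- by apply: gs; rewrite mem_rcons inE eqxx.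
- by apply: hs; rewrite mem_rcons inE eqxx.
- by apply: IH => i si; [apply: gs|apply: hs]; rewrite mem_rcons inE si orbT.
Qed.

Lemma mxmeasurable_meanmx S1 S2 r : {in r, forall i, mxmeasurable (g i)} ->
  mxmeasurable (fun w => meanmx (g^~ w) S1 S2 r).
Proof.
elim: r => [|j r IH] gr /=; first exact: mxmeasurable_cst.
apply: mxmeasurable_mean_step; first by apply: gr; rewrite inE eqxx.
by apply: IH => i ri; apply: gr; rewrite inE ri orbT.
Qed.

Lemma nnmeasurable_letter_weight b (A : W -> 'M[R[i]]_n) :
  mxmeasurable A -> nnmeasurable (fun w => letter_weight b (A w)).
Proof.
move=> mA; case: b => /=; last exact: nnmeasurable_cst.
by apply: nnmeasurableD; [exact: nnmeasurable_cst|exact/nnmeasurableX/nnmeasurable_sqfro].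
Qed.

Lemma nnmeasurable_weight S1 S2 s : {in s, forall i, mxmeasurable (g i)} ->
  nnmeasurable (fun w => weight (g^~ w) S1 S2 s).
Proof.
rewrite /weight; elim: s => [|j s IH] gs.
  by under eq_fun do rewrite big_nil; exact: nnmeasurable_cst.
under eq_fun do rewrite big_cons; apply: nnmeasurableM.
  by apply: nnmeasurable_letter_weight; apply: gs; rewrite inE eqxx.
by apply: IH => i si; apply: gs; rewrite inE si orbT.
Qed.

Lemma cmeasurable_hybrid S1 S2 s r x y : {in s ++ r, forall i, mxmeasurable (g i)} ->
  {in s, forall i, mxmeasurable (h i)} ->
  cmeasurable (fun w => hybrid (g^~ w) (h^~ w) S1 S2 s r x y).
Proof.
move=> gsr hs; have gs : {in s, forall i, mxmeasurable (g i)}.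
  by move=> i si; apply: gsr; rewrite mem_cat si.
apply: mxmeasurableM; [apply: mxmeasurableM|apply: mxmeasurable_trmxC].
- exact: mxmeasurable_wordrow.
- apply/mxmeasurable_ampliation/mxmeasurable_meanmx => i ri.
  by apply: gsr; rewrite mem_cat ri orbT.
- exact: mxmeasurable_wordrow.
Qed.

Lemma nnmeasurable_step_error b1 b2 (A D : W -> 'M[R[i]]_n) (u v : W -> 'rV[R[i]]_p)
    (U : W -> 'M[R[i]]_p) :
  mxmeasurable A -> mxmeasurable D -> mxmeasurable u -> mxmeasurable v -> mxmeasurable U ->
  nnmeasurable (fun w => sqnormc (step_error b1 b2 (A w) (D w) (u w) (v w) (U w))).
Proof.
move=> mA mD mu mv mU; apply: nnmeasurable_sqnormc; apply: mxmeasurableB.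
  by mxmeasurability; exact: mxmeasurable_append.
by mxmeasurability; exact: mxmeasurable_mean_step.
Qed.

End measurability_words.

Section random_words.
Context {R : realType} (m n k : nat).
Hypotheses (n_gt0 : (0 < n)%N) (k_gt0 : (0 < k)%N).
Local Notation p := (n * k)%N.
Context {disp : measure_display} {T : measurableType disp} (P : probability T R).
Variables (G : 'I_m -> {RV P >-> cmx R n}) (H : 'I_m -> {RV P >-> cmx R p}).

Definition source_events (i : 'I_m + 'I_m) : set (set T) :=
  match i with inl a => rv_events (G a) | inr b => rv_events (H b) end.

Hypothesis GH_indep : mutually_independent P source_events.

Lemma source_events_measurable i A : source_events i A -> measurable A.
Proof. by case: i => i [B mB <-]; exact: measurable_funPT. Qed.

Lemma source_events_setT i : source_events i setT.
Proof. by case: i => i; exists setT => //; rewrite setTI preimage_setT. Qed.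

Lemma source_events_setI i : setI_closed (source_events i).
Proof.
by case: i => i _ _ [A mA <-] [B mB <-]; (exists (A `&` B); first exact: measurableI);
  rewrite !setTI preimage_setI.
Qed.

Local Notation all_but := (all_but source_events).

Lemma mxmeasurable_but_G j i : inl i != j ->
  mxmeasurable (fun w : all_but j => (G i w : 'M[R[i]]_n)).
Proof.
move=> ij; apply/mxmeasurableP => _ B mB; rewrite setTI; apply: sub_sigma_algebra.
apply: (sub_cylinders_but source_events_setT (i := inl i)) => //.
by exists B => //; rewrite setTI.
Qed.

Lemma mxmeasurable_but_H j i : inr i != j ->
  mxmeasurable (fun w : all_but j => (H i w : 'M[R[i]]_p)).
Proof.
move=> ij; apply/mxmeasurableP => _ B mB; rewrite setTI; apply: sub_sigma_algebra.
apply: (sub_cylinders_but source_events_setT (i := inr i)) => //.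
by exists B => //; rewrite setTI.
Qed.

Lemma mxmeasurable_but_meanmx j S1 S2 r :
  mxmeasurable (fun w : all_but (inr j) => meanmx (fun i => G i w : 'M[R[i]]_n) S1 S2 r).
Proof.
apply: (mxmeasurable_meanmx (W := all_but (inr j)) (g := fun i w => G i w)) => i _.
exact: mxmeasurable_but_G.
Qed.

Lemma mxmeasurable_but_wordrow j S s x : j \notin s -> mxmeasurable (fun w : all_but (inr j) =>
  wordrow (fun i => G i w : 'M[R[i]]_n) (fun i => H i w : 'M[R[i]]_p) S s x).
Proof.
move=> js; apply: (mxmeasurable_wordrow (W := all_but (inr j)) (g := fun i w => G i w)
  (h := fun i w => H i w)) => i si; first exact: mxmeasurable_but_G.
by apply: mxmeasurable_but_H; apply: contraNneq js => -[<-].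
Qed.

Lemma mxmeasurable_G i : mxmeasurable (fun w : T => (G i w : 'M[R[i]]_n)).
Proof. by apply/mxmeasurableP; exact: measurable_funPT. Qed.

Lemma mxmeasurable_H i : mxmeasurable (fun w : T => (H i w : 'M[R[i]]_p)).
Proof. by apply/mxmeasurableP; exact: measurable_funPT. Qed.

Hypothesis H_haar : forall i, haar_unitary (distribution P (H i)).

Lemma ae_unitarymx_H : {ae P, forall w, forall i, (H i w : 'M[R[i]]_p) \is unitarymx}.
Proof.
apply: filter_forall => i.
have mU : measurable [set U : cmx R p | (U : 'M[R[i]]_p) \is unitarymx].
  exact: measurable_unitarymx.
apply: (ae_probability1 (A := H i @^-1` [set U | (U : 'M[R[i]]_p) \is unitarymx])).
  exact: measurable_funPTI.
exact: (H_haar i).1.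
Qed.

Section concentration.
Variables (S1 S2 : {set 'I_m}) (o x y : 'I_n).
Hypothesis o0 : val o = 0%N.
Let g w : 'I_m -> 'M[R[i]]_n := fun i => G i w.
Let h w : 'I_m -> 'M[R[i]]_p := fun i => H i w.
Let hyb s r w := hybrid (g w) (h w) S1 S2 s r x y.
Let kappa : R := 64 * n%:R ^+ 3 / p%:R.

Let kappa_ge0 : 0 <= kappa.
Proof. by rewrite divr_ge0// mulr_ge0// exprn_ge0. Qed.

Let nnmeasurable_kappa_weight s : nnmeasurable (fun w => kappa * weight (g w) S1 S2 s).
Proof. by apply/nnmeasurableZ/(nnmeasurable_weight (W := T)) => // i _; exact: mxmeasurable_G. Qed.

Lemma hybrid_step_le s j r : uniq (s ++ j :: r) ->
  ('E_P[fun w => sqnormc (hyb (rcons s j) r w - hyb s (j :: r) w)%R] <=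
   'E_P[fun w => kappa * weight (g w) S1 S2 (s ++ j :: r)]%R)%E.
Proof.
rewrite uniq_catC cat_uniq => /and3P[_ /hasPn sr _].
have js : j \notin s by apply/negP => /sr; rewrite inE eqxx.
pose A w := g w j; pose D w := meanmx (g w) S1 S2 r.
pose u w := wordrow (g w) (h w) S1 s x; pose v w := wordrow (g w) (h w) S2 s y.
pose b w := step_bound (j \in S1) (j \in S2) (A w) (D w) (u w) (v w).
have mA : mxmeasurable (A : all_but (inr j) -> _) by exact: mxmeasurable_but_G.
have mD : mxmeasurable (D : all_but (inr j) -> _) by exact: mxmeasurable_but_meanmx.
have mu : mxmeasurable (u : all_but (inr j) -> _) by exact: mxmeasurable_but_wordrow.
have mv : mxmeasurable (v : all_but (inr j) -> _) by exact: mxmeasurable_but_wordrow.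
pose phi (z : all_but (inr j) * cmx R p) :=
  sqnormc (step_error (j \in S1) (j \in S2) (A z.1) (D z.1) (u z.1) (v z.1) z.2).
have mphi : nnmeasurable phi.
  have mfst q1 q2 (F : all_but (inr j) -> 'M[R[i]]_(q1, q2)) :
      mxmeasurable F -> mxmeasurable (fun z : all_but (inr j) * cmx R p => F z.1).
    by move=> mF; exact: (mxmeasurable_comp mF measurable_fst).
  have msnd : mxmeasurable (fun z : all_but (inr j) * cmx R p => (z.2 : 'M[R[i]]_p)).
    by apply/mxmeasurableP; exact: measurable_snd.
  by apply: nnmeasurable_step_error => //; exact: mfst.
apply: (@le_trans _ _ ('E_P[b])%E).
  rewrite (_ : (fun w => sqnormc _) = (fun w => phi (w, H j w))); last first.
    by apply/funext => w; rewrite [X in sqnormc X]hybrid_rcons_sub.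
  apply: (indep_expectation_le source_events_measurable source_events_setT
    source_events_setI GH_indep (law := distribution P (H j)) _ _ _ mphi) => //.
    by move=> B mB; exists B => //; rewrite setTI.
  move=> w; exact: (haar_step_le n_gt0 k_gt0 (H_haar j) _ _ (A w) (D w) (u w) (v w)).
have toT q1 q2 (F : T -> 'M[R[i]]_(q1, q2)) :
    mxmeasurable (F : all_but (inr j) -> _) -> mxmeasurable F.
  by move=> mF; exact: (mxmeasurable_comp mF (measurable_but_id source_events_measurable)).
apply: ae_le_expectation => //.
  apply: nnmeasurableZ; first by rewrite divr_ge0.
  apply: nnmeasurableM; first by apply: nnmeasurable_letter_weight; exact: toT.
  by do 2?apply: nnmeasurableM; apply: nnmeasurable_sqfro; exact: toT.
apply: filterS ae_unitarymx_H => w hu.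
exact: (step_bound_le_weight n_gt0 k_gt0 (g w) S1 S2 s j r x y (h := h w) hu).
Qed.

(* Averaging out one more unitary moves the hybrid by an L^2 distance of order
   p^(-1/2); the steps are summed up with (a + b)^2 <= 2 a^2 + 2 b^2. *)
Lemma hybrid_concentration s r (K : R) : uniq (s ++ r) ->
  ('E_P[(fun w => kappa * weight (g w) S1 S2 (s ++ r))%R] <= K%:E)%E ->
  ('E_P[(fun w => sqnormc (hyb s r w - meanmx (g w) S1 S2 (s ++ r) o o * (x == y)%:R))%R] <=
   (4 ^+ size s * K)%:E)%E.
Proof.
elim/last_ind: s r => [|s j IH] r us KE.
  rewrite expr0 mul1r; apply: le_trans KE; apply: ge0_le_expectation => w.
    exact: sqnormc_ge0.
  exact: hybrid_nil_le.
rewrite cat_rcons in us KE *.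
have K0 : 0 <= K.
  rewrite -lee_fin; apply: le_trans KE; apply: expectation_ge0.
  exact: (nnmeasurable_kappa_weight _).2.
have mhyb s' r' : cmeasurable (hyb s' r').
  by apply: (cmeasurable_hybrid (W := T)) => i _; [exact: mxmeasurable_G|exact: mxmeasurable_H].
apply: le_trans (ge0_expectation_sqdist_le (mhyb _ _) (mhyb s (j :: r)) _
  (le_trans (hybrid_step_le us) KE) (IH _ us KE)) _.
  apply: cmeasurableM; last exact: cmeasurable_cst.
  by apply: (mxmeasurable_meanmx (W := T)) => i _; exact: mxmeasurable_G.
rewrite lee_fin size_rcons exprS.
have : 1 <= 4 ^+ size s :> R by rewrite exprn_ege1// ler1n.
by nra.
Qed.

End concentration.

End random_words.

(** * Operator norm and moments of the random matrices *)

Section opnorm.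
Context {R : realType} (n : nat).
Implicit Types (A : 'M[R[i]]_n) (x : 'cV[R[i]]_n).

Lemma l2normE x : l2norm x = Num.sqrt (sqfro x).
Proof.
rewrite /l2norm /sqfro; congr Num.sqrt; apply: eq_bigr => i _; rewrite big_ord1.
by case: (x i ord0) => a b; rewrite /Normc.normc sqr_sqrtr// addr_ge0 ?sqr_ge0.
Qed.

Lemma sqrt_sqfro_mul_le_opnorm A x : sqfro x <= 1 -> Num.sqrt (sqfro (A *m x)) <= opnorm A.
Proof.
move=> x1; apply: ub_le_sup; last first.
  by exists x; rewrite /= l2normE// -sqrtr1 ler_wsqrtr.
exists (Num.sqrt (sqfro A)) => _ [y y1 <-]; rewrite l2normE ler_wsqrtr//.
apply: le_trans (sqfro_mul_le _ _) _; rewrite ler_piMr ?sqfro_ge0//.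
by move: y1; rewrite /= l2normE -[X in _ <= X]sqrtr1 ler_sqrt.
Qed.

Lemma Re_diag_le_opnorm A i : complex.Re (A i i) <= opnorm A.
Proof.
have := sqrt_sqfro_mul_le_opnorm A (x := delta_mx i 0); rewrite sqfro_delta_mx lexx.
move=> /(_ isT); apply: le_trans; rewrite -colE; apply: le_trans (ler_norm _) _.
rewrite -sqrtr_sqr ler_wsqrtr//; apply: le_trans (sqr_Re_le _) _.
by have := sqnormc_le_sqfro (col i A) i 0; rewrite mxE.
Qed.

Lemma sqfro_contraction_mul_le A x : opnorm A <= 1 -> sqfro (A *m x) <= sqfro x.
Proof.
move=> A1; have [->|x0] := eqVneq x 0; first by rewrite mulmx0.
have f0 : 0 < sqfro x.
  by rewrite lt_neqAle sqfro_ge0 andbT eq_sym; apply: contraNneq x0 => /sqfro_eq0 ->.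
pose c := (Num.sqrt (sqfro x))^-1.
have c2 : c ^+ 2 = (sqfro x)^-1 by rewrite /c exprVn sqr_sqrtr ?sqfro_ge0.
have := sqrt_sqfro_mul_le_opnorm A (x := c%:C *: x).
rewrite sqfroZ sqnormc_real c2 mulVf ?gt_eqF// lexx => /(_ isT).
rewrite -scalemxAr sqfroZ sqnormc_real c2 => /le_trans/(_ A1).
by rewrite -[X in _ <= X]sqrtr1 ler_sqrt// mulrC ler_pdivrMr// mul1r.
Qed.

(* |v A|^2 = <v, v A A^* > is at most |v| |v A|, as A contracts the columns. *)
Lemma sqfro_mul_contraction_le A (v : 'rV[R[i]]_n) : opnorm A <= 1 ->
  sqfro (v *m A) <= sqfro v.
Proof.
move=> A1; have := sqfro_contraction_mul_le ((v *m A)^t*) A1.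
set f := sqfro (v *m A); rewrite sqfro_trmxC -/f => Af.
have [f0|f0] := eqVneq f 0; first by rewrite f0 sqfro_ge0.
rewrite -(@ler_pM2r _ f); last by rewrite lt_neqAle eq_sym f0 sqfro_ge0.
apply: le_trans (ler_wpM2l (sqfro_ge0 v) Af); apply: le_trans (sqfro_mul_le _ _).
by rewrite mulmxA mul_trmxC_row sqfro_scalar_mx mul1r sqnormc_real -expr2.
Qed.

End opnorm.

Lemma expectation_Re_entry {R : realType} {d} {T : measurableType d} (P : probability T R)
    n (F : T -> 'M[R[i]]_n) i j : mx_integrable P F ->
  'E_P[fun w => complex.Re (F w i j)]%E = (complex.Re (mx_expectation P F i j))%:E.
Proof.
by move=> F_int; rewrite mxE /= unlock /expectation.unlock fineK//;
  exact: (integrable_fin_num _ (F_int i j).1).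
Qed.

Definition unit_gram_mean {R : realType} n (calG : probability (cmx R n) R) : Prop :=
  mx_integrable calG (fun g : 'M[R[i]]_n => g *m g^t*) /\
  mx_expectation calG (fun g : 'M[R[i]]_n => g *m g^t*) = 1%:M.

Definition sqr_gram_mean_le {R : realType} n (calG : probability (cmx R n) R) (c : R) : Prop :=
  mx_integrable calG (fun g : 'M[R[i]]_n => (g *m g^t*) ^+ 2) /\
  opnorm (mx_expectation calG (fun g : 'M[R[i]]_n => (g *m g^t*) ^+ 2)) <= c.

Section moments.
Context {R : realType} (n : nat) (o : 'I_n).
Implicit Types g : 'M[R[i]]_n.

(* The normalized trace (if b) or the (o, o) entry of g g^*, provided c. *)
Definition gram_factor (c b : bool) g : R :=
  if c then if b then sqfro g / n%:R else sqfro (row o g) else 1.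

Let n_gt0 : (0 < n)%N. Proof. exact: leq_trans (ltn_ord o). Qed.
Let nR_gt0 : 0 < n%:R :> R. Proof. by rewrite ltr0n. Qed.

Lemma gram_factor_ge0 c b g : 0 <= gram_factor c b g.
Proof. by case: c b => -[]; rewrite /= ?divr_ge0 ?sqfro_ge0. Qed.

Lemma nnmeasurable_gram_factor {d} {W : measurableType d} (A : W -> 'M[R[i]]_n) c b :
  mxmeasurable A -> nnmeasurable (fun w => gram_factor c b (A w)).
Proof.
move=> mA; case: c b => -[] /=; try exact: nnmeasurable_cst.
  by apply: nnmeasurableM; [mxmeasurability|apply: nnmeasurable_cst; rewrite invr_ge0].
by mxmeasurability.
Qed.

Lemma sqr_sqfro_row_le g i : sqfro (row i g) ^+ 2 <= sqfro (row i (g *m g^t*)).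
Proof.
rewrite -sqnormc_real -mul_trmxC_diag.
by have := sqnormc_le_sqfro (row i (g *m g^t*)) 0 i; rewrite mxE.
Qed.

Lemma sqr_sqfro_le_gram g : sqfro g ^+ 2 <= n%:R * \sum_i sqfro (row i (g *m g^t*)).
Proof.
rewrite sqfro_row -sqnormc_real rmorph_sum; apply: le_trans (sqnormc_sum_le _) _.
rewrite card_ord ler_wpM2l//; apply: ler_sum => i _.
by rewrite sqnormc_real sqr_sqfro_row_le.
Qed.

Let mrow i : nnmeasurable (fun g : cmx R n => sqfro (row i (g : 'M[R[i]]_n))).
Proof. by mxmeasurability. Qed.

Let mgram i : nnmeasurable
  (fun g : cmx R n => sqfro (row i ((g : 'M[R[i]]_n) *m (g : 'M[R[i]]_n)^t*))).
Proof. by mxmeasurability. Qed.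

Let mfactor c b : nnmeasurable (gram_factor c b : cmx R n -> R).
Proof. by apply: nnmeasurable_gram_factor; exact: mxmeasurable_id. Qed.

Variable calG : probability (cmx R n) R.
Variable c2 : R.
Hypothesis c2_ge1 : 1 <= c2.
Hypothesis GG_mean : unit_gram_mean calG.
Hypothesis GG2_le : sqr_gram_mean_le calG c2.

Lemma expectation_sqfro_row i : 'E_calG[fun g : 'M[R[i]]_n => sqfro (row i g)]%E = 1%:E.
Proof.
have := expectation_Re_entry i i GG_mean.1; rewrite GG_mean.2 mxE eqxx /= => <-.
by congr expectation; apply/funext => g; rewrite mul_trmxC_diag.
Qed.

Lemma expectation_sqfro_row_gram_le i :
  ('E_calG[fun g : 'M[R[i]]_n => sqfro (row i (g *m g^t*))] <= c2%:E)%E.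
Proof.
have -> : (fun g : 'M[R[i]]_n => sqfro (row i (g *m g^t*))) =
    (fun g : 'M[R[i]]_n => complex.Re (((g *m g^t*) ^+ 2) i i)).
  apply/funext => g; have -> : (g *m g^t*) ^+ 2 = (g *m g^t*) *m (g *m g^t*)^t*.
    by rewrite trmxC_mul trmxCK.
  by rewrite mul_trmxC_diag.
rewrite (expectation_Re_entry i i GG2_le.1) lee_fin.
exact: le_trans (Re_diag_le_opnorm _ _) GG2_le.2.
Qed.

Lemma expectation_gram_factor c b : 'E_calG[gram_factor c b]%E = 1%:E.
Proof.
case: c => /=; last exact: expectation_cst.
case: b => /=; last exact: expectation_sqfro_row.
have -> : gram_factor true true =
    (fun g : 'M[R[i]]_n => \sum_i n%:R^-1 * sqfro (row i g)).
  by apply/funext => g; rewrite -mulr_sumr -sqfro_row mulrC.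
rewrite (ge0_expectation_lincomb (c := fun=> n%:R^-1) _ mrow expectation_sqfro_row).
  by rewrite -mulr_suml sumr_const card_ord -[_ *+ n]mulr_natr mulVf ?gt_eqF// mulr1.
by move=> _; rewrite invr_ge0.
Qed.

Lemma expectation_sqr_gram_factor_le b :
  ('E_calG[(fun g => gram_factor true b g ^+ 2)%R] <= c2%:E)%E.
Proof.
case: b; last first.
  apply: le_trans (expectation_sqfro_row_gram_le o); apply: ge0_le_expectation => g.
    exact: sqr_ge0.
  exact: sqr_sqfro_row_le.
apply: (@le_trans _ _ ('E_calG[(fun g : 'M[R[i]]_n =>
    \sum_i n%:R^-1 * sqfro (row i (g *m g^t*)))%R])%E).
  apply: ge0_le_expectation => g; first exact: sqr_ge0.
  rewrite -mulr_sumr /= exprMn exprVn ler_pdivrMr ?exprn_gt0//.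
  rewrite [leRHS](_ : _ = n%:R * \sum_i sqfro (row i (g *m g^t*))).
    exact: sqr_sqfro_le_gram.
  by field; rewrite gt_eqF.
have -> : c2 = \sum_(i < n) n%:R^-1 * c2.
  by rewrite -mulr_suml sumr_const card_ord -[_ *+ n]mulr_natr mulVf ?gt_eqF// mul1r.
apply: ge0_expectation_lincomb_le => [_|i|i _]; first by rewrite invr_ge0.
  exact: mgram.
exact: expectation_sqfro_row_gram_le.
Qed.

Lemma expectation_gram_factorM_le c c' b b' :
  ('E_calG[(fun g => gram_factor c b g * gram_factor c' b' g)%R] <= (c2 ^+ (c && c'))%:E)%E.
Proof.
case: c c' => -[]; last 3 first.
- rewrite (_ : (fun g => _) = gram_factor true b) ?expectation_gram_factor//.
  by apply/funext => g /=; rewrite mulr1.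
- rewrite (_ : (fun g => _) = gram_factor true b') ?expectation_gram_factor//.
  by apply/funext => g /=; rewrite mul1r.
- rewrite (_ : (fun g => _) = gram_factor false b) ?expectation_gram_factor//.
  by apply/funext => g /=; rewrite mulr1.
apply: (@le_trans _ _ ('E_calG[(fun g =>
    2^-1 * gram_factor true b g ^+ 2 + 2^-1 * gram_factor true b' g ^+ 2)%R])%E).
  apply: ge0_le_expectation => g; first by rewrite mulr_ge0// gram_factor_ge0.
  by have := sqr_ge0 (gram_factor true b g - gram_factor true b' g); nra.
rewrite expr1 (_ : c2 = 2^-1 * c2 + 2^-1 * c2); last by lra.
have msqr b0 : nnmeasurable (fun g : cmx R n => gram_factor true b0 g ^+ 2).
  exact/nnmeasurableX/mfactor.
by apply: ge0_expectationD_le; (try by apply: nnmeasurableZ);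
  apply: ge0_expectationZ_le => //; exact: expectation_sqr_gram_factor_le.
Qed.

Lemma expectation_letter_weight_le b :
  ('E_calG[letter_weight b] <= ((2 * n%:R ^+ 2 * c2) ^+ b)%:E)%E.
Proof.
case: b; last by rewrite expr0 expectation_cst.
have nc : 1 <= n%:R ^+ 2 * c2 by rewrite mulr_ege1// exprn_ege1// ler1n.
apply: (@le_trans _ _ (1 + \sum_(i < n) n%:R * c2)%:E); last first.
  by rewrite lee_fin sumr_const card_ord -[_ *+ n]mulr_natl expr1; lra.
apply: (@le_trans _ _ ('E_calG[(fun g : 'M[R[i]]_n =>
    1 + \sum_i n%:R * sqfro (row i (g *m g^t*)))%R])%E).
  apply: ge0_le_expectation => g; first exact: letter_weight_ge0.
  by rewrite -mulr_sumr /= lerD2l sqr_sqfro_le_gram.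
apply: ge0_expectationD_le; [exact: nnmeasurable_cst| |by rewrite expectation_cst|].
  by apply: nnmeasurable_sum => i; exact: nnmeasurableZ.
by apply: ge0_expectation_lincomb_le => // i _; exact: expectation_sqfro_row_gram_le.
Qed.

End moments.

Section scalar_mean.
Context {R : realType} (m n : nat) (o : 'I_n).
Implicit Types (g : 'I_m -> 'M[R[i]]_n) (S : {set 'I_m}) (r : seq 'I_m).

(* The normalized trace (if b) or the (o, o) entry of meanmx g S S r; inside the
   first factor of the word only traces occur. *)
Fixpoint scalar_mean (b : bool) g S r : R :=
  if r is j :: r' then
    scalar_mean (b || (j \in S)) g S r' * gram_factor o (j \in S) b (g j)
  else 1.

Lemma scalar_mean_ge0 b g S r : 0 <= scalar_mean b g S r.
Proof. by elim: r b => [|j r IH] b //=; rewrite mulr_ge0 ?gram_factor_ge0. Qed.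

Lemma meanmx_scalar_mean g S r :
  \tr (meanmx g S S r) / n%:R = (scalar_mean true g S r)%:C /\
  meanmx g S S r o o = (scalar_mean false g S r)%:C.
Proof.
have n0 : (0 < n)%N by exact: leq_trans (ltn_ord o).
elim: r => [|j r [trE ooE]] /=.
  by rewrite mxtrace1 divff ?pnatr_eq0 -?lt0n// mxE eqxx.
rewrite /mean_step andbb orbb; case: (j \in S) => /=; last by rewrite !mulr1.
rewrite mxtraceZ mxE trE mxtrace_mul_trmxC mul_trmxC_diag; split; last by rewrite -rmorphM.
by rewrite -mulrA !rmorphM /= fmorphV rmorph_nat.
Qed.

Context {d : measure_display} {W : measurableType d} (g : 'I_m -> W -> 'M[R[i]]_n).

Lemma nnmeasurable_scalar_mean b S r :
  {in r, forall i, mxmeasurable (g i)} ->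
  nnmeasurable (fun w => scalar_mean b (g^~ w) S r).
Proof.
elim: r b => [|j r IH] b gr /=; first exact: nnmeasurable_cst.
apply: nnmeasurableM; last first.
  by apply: nnmeasurable_gram_factor; apply: gr; rewrite inE eqxx.
by apply: IH => i ri; apply: gr; rewrite inE ri orbT.
Qed.

End scalar_mean.

Section expectations.
Context {R : realType} (m n k : nat) (o : 'I_n).
Local Notation p := (n * k)%N.
Context {disp : measure_display} {T : measurableType disp} (P : probability T R).
Variables (G : 'I_m -> {RV P >-> cmx R n}) (H : 'I_m -> {RV P >-> cmx R p}).
Hypothesis GH_indep : mutually_independent P (source_events G H).
Variable calG : probability (cmx R n) R.
Hypothesis G_law : forall (i : 'I_m) (A : set (cmx R n)), measurable A ->
  distribution P (G i) A = calG A.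
Variable c2 : R.
Hypothesis c2_ge1 : 1 <= c2.
Hypothesis GG_mean : unit_gram_mean calG.
Hypothesis GG2_le : sqr_gram_mean_le calG c2.

Local Notation all_but j := (all_but (source_events G H) (inl j)).
Let g w : 'I_m -> 'M[R[i]]_n := fun i => G i w.

Lemma expectation_mul_source j (f : all_but j -> R) (q : cmx R n -> R) :
  nnmeasurable f -> nnmeasurable q ->
  'E_P[(fun w => f w * q (g w j))%R]%E = ('E_P[f] * 'E_calG[q])%E.
Proof.
move=> mf mq.
apply: (indep_expectationM (@source_events_measurable _ _ _ _ _ _ _ G H)
  (@source_events_setT _ _ _ _ _ _ _ G H) (@source_events_setI _ _ _ _ _ _ _ G H) GH_indep
  (i0 := inl j) (X := G j) (law := calG)) => //.
- by move=> B mB; exists B => //; rewrite setTI.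
- by move=> B mB; rewrite -(G_law j).
Qed.

Let mxmeasurable_rest j r : uniq (j :: r) ->
  {in r, forall i, mxmeasurable (fun w : all_but j => (G i w : 'M[R[i]]_n))}.
Proof.
move=> /= /andP[jr _] i ir; apply: mxmeasurable_but_G; apply: contraNneq jr => -[<-].
exact: ir.
Qed.

Let nnmeasurable_rest_mean j b S r : uniq (j :: r) ->
  nnmeasurable (fun w : all_but j => scalar_mean o b (g w) S r).
Proof.
move=> ur; apply: (nnmeasurable_scalar_mean o (W := all_but j) (g := fun i w => G i w)).
exact: mxmeasurable_rest ur.
Qed.

Let nnmeasurable_factor c b : nnmeasurable (gram_factor o c b : cmx R n -> R).
Proof. by apply: nnmeasurable_gram_factor; exact: mxmeasurable_id. Qed.

Lemma expectation_scalar_mean b S r : uniq r ->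
  'E_P[fun w => scalar_mean o b (g w) S r]%E = 1%:E.
Proof.
elim: r b => [|j r IH] b /=; first by move=> _; exact: expectation_cst.
move=> ur; rewrite (expectation_mul_source (nnmeasurable_rest_mean _ _ ur)
  (nnmeasurable_factor _ _)).
by rewrite IH ?(expectation_gram_factor o GG_mean) ?mule1//; case/andP: ur.
Qed.

Lemma expectation_scalar_meanM_le b b' S S' r : uniq r ->
  ('E_P[(fun w => scalar_mean o b (g w) S r * scalar_mean o b' (g w) S' r)%R] <=
   (c2 ^+ count (fun i => (i \in S) && (i \in S')) r)%:E)%E.
Proof.
elim: r b b' => [|j r IH] b b' /= ur.
  by under eq_fun do rewrite mulr1; rewrite expectation_cst.
under eq_fun do rewrite mulrACA.
rewrite (expectation_mul_source
  (f := fun w => scalar_mean o (b || (j \in S)) (g w) S r *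
                 scalar_mean o (b' || (j \in S')) (g w) S' r)
  (q := fun A => gram_factor o (j \in S) b A * gram_factor o (j \in S') b' A)); last 2 first.
- by apply: nnmeasurableM; exact: nnmeasurable_rest_mean.
- by apply: nnmeasurableM; exact: nnmeasurable_factor.
rewrite exprD EFinM muleC; apply: lee_pmul.
- by apply: expectation_ge0 => A; rewrite mulr_ge0 ?gram_factor_ge0.
- by apply: expectation_ge0 => w; rewrite mulr_ge0 ?scalar_mean_ge0.
- exact: expectation_gram_factorM_le.
- by apply: IH; case/andP: ur.
Qed.

Lemma expectation_weight_le S S' r : uniq r ->
  ('E_P[fun w => weight (g w) S S' r] <=
   ((2 * n%:R ^+ 2 * c2) ^+ count (fun i => (i \in S) || (i \in S')) r)%R%:E)%E.
Proof.
rewrite /weight; elim: r => [|j r IH] /= ur.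
  by under eq_fun do rewrite big_nil; rewrite expectation_cst.
under eq_fun do rewrite big_cons mulrC.
rewrite (expectation_mul_source (f := fun w => weight (g w) S S' r)
  (q := letter_weight ((j \in S) || (j \in S')))); last 2 first.
- apply: (nnmeasurable_weight (W := all_but j) (g := fun i w => G i w)).
  exact: mxmeasurable_rest ur.
- by apply: nnmeasurable_letter_weight; exact: mxmeasurable_id.
rewrite exprD EFinM muleC; apply: lee_pmul.
- by apply: expectation_ge0 => A; exact: letter_weight_ge0.
- by apply: expectation_ge0 => w; exact: weight_ge0.
- exact: expectation_letter_weight_le.
- by apply: IH; case/andP: ur.
Qed.

End expectations.

(** * Polynomials of bounded norm *)

Lemma neq_set_mem (T : finType) (S S' : {set T}) : S != S' ->
  exists i, (i \in S) != (i \in S').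
Proof.
move=> SS; apply/existsP; rewrite -negb_forall; apply: contraNN SS => /forallP e.
by apply/eqP/setP => i; exact/eqP.
Qed.

Section parseval.
Context {R : rcfType} (m : nat).

Definition sgn (e : {ffun 'I_m -> bool}) (i : 'I_m) : R[i] := if e i then -1 else 1.

Lemma sgn_orthogonal (S S' : {set 'I_m}) :
  \sum_(e : {ffun 'I_m -> bool}) (\prod_(i in S) sgn e i) * (\prod_(i in S') sgn e i) =
  if S == S' then 2 ^+ m else 0.
Proof.
pose c i (b : bool) : R[i] := (if i \in S then (if b then -1 else 1) else 1) *
  (if i \in S' then (if b then -1 else 1) else 1).
transitivity (\sum_(e : {ffun 'I_m -> bool}) \prod_i c i (e i)).
  apply: eq_bigr => e _; rewrite big_split /=.
  by congr (_ * _); rewrite big_mkcond.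
rewrite -bigA_distr_bigA /=.
have cE i : \sum_(b : bool) c i b = if (i \in S) == (i \in S') then 2 else 0.
  by rewrite big_bool /c; case: (i \in S); case: (i \in S') => /=;
    rewrite ?mulr1 ?mul1r ?mulrNN ?mulr1 ?addNr.
have [SS|/neq_set_mem[i iSS]] := eqVneq S S'.
  by under eq_bigr do rewrite cE SS eqxx; rewrite prodr_const card_ord.
by rewrite (bigD1 i)//= cE (negbTE iSS) mul0r.
Qed.

Lemma sqnormc_parseval (f : {set 'I_m} -> R[i]) :
  \sum_(e : {ffun 'I_m -> bool})
    sqnormc (\sum_(S : {set 'I_m}) (\prod_(i in S) sgn e i) * f S) =
  2 ^+ m * \sum_S sqnormc (f S).
Proof.
apply: (@complexI R); rewrite rmorph_sum rmorphM rmorphXn /= rmorph_nat rmorph_sum /=.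
transitivity (\sum_(e : {ffun 'I_m -> bool}) \sum_(S : {set 'I_m}) \sum_(S' : {set 'I_m})
    ((\prod_(i in S) sgn e i) * (\prod_(i in S') sgn e i)) * (f S * (f S')^*)).
  apply: eq_bigr => e _; rewrite -mulcJE rmorph_sum mulr_suml; apply: eq_bigr => S _.
  rewrite mulr_sumr; apply: eq_bigr => S' _; rewrite rmorphM rmorph_prod /= mulrACA.
  congr (_ * _ * _); apply: eq_bigr => i _.
  by rewrite /sgn; case: (e i); rewrite ?rmorphN rmorph1.
rewrite exchange_big mulr_sumr; apply: eq_bigr => S _.
rewrite exchange_big (bigD1 S)//= -mulr_suml sgn_orthogonal eqxx mulcJE.
rewrite [X in _ + X]big1 ?addr0// => S' SS.
by rewrite -mulr_suml sgn_orthogonal eq_sym (negbTE SS) mul0r.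
Qed.

Lemma sqfro_parseval a b (f : {set 'I_m} -> 'M[R[i]]_(a, b)) :
  \sum_(e : {ffun 'I_m -> bool})
    sqfro (\sum_(S : {set 'I_m}) (\prod_(i in S) sgn e i) *: f S) =
  2 ^+ m * \sum_S sqfro (f S).
Proof.
rewrite /sqfro exchange_big /= [in RHS]exchange_big mulr_sumr; apply: eq_bigr => x _.
rewrite exchange_big /= [in RHS]exchange_big mulr_sumr; apply: eq_bigr => y _.
rewrite -sqnormc_parseval; apply: eq_bigr => e _; rewrite summxE; congr sqnormc.
by apply: eq_bigr => S _; rewrite mxE.
Qed.

End parseval.

Section set_sums.
Context {R : realDomainType} (T : finType) (f : {set T} -> R).

Lemma sum_influences : \sum_i \sum_(S : {set T} | i \in S) f S = \sum_(S : {set T}) #|S|%:R * f S.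
Proof.
rewrite (exchange_big_dep xpredT)//=; apply: eq_bigr => S _.
by rewrite sumr_const mulr_natl.
Qed.

Lemma sum_sqr_influences : \sum_i (\sum_(S : {set T} | i \in S) f S) ^+ 2 =
  \sum_(S : {set T}) \sum_(S' : {set T}) #|S :&: S'|%:R * (f S * f S').
Proof.
under eq_bigr do rewrite expr2 mulr_suml.
rewrite (exchange_big_dep xpredT)//=; apply: eq_bigr => S _.
under eq_bigr do rewrite mulr_sumr.
rewrite (exchange_big_dep xpredT)//=; apply: eq_bigr => S' _.
rewrite (eq_bigl [in S :&: S']) => [|i]; last by rewrite inE.
by rewrite sumr_const mulr_natl.
Qed.

End set_sums.

Definition sign_bounded {R : realType} m n (Q : ncpoly R m n) : Prop :=
  forall sigma : 'I_m -> R[i], (forall i, sigma i = -1 \/ sigma i = 1) ->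
  opnorm (nceval Q (fun i => (sigma i)%:M)) <= 1.

Section bounded_polynomial.
Context {R : realType} (m n : nat) (Q : ncpoly R m n).
Hypothesis Q_norm : sign_bounded Q.

Definition gram_coef S : 'M[R[i]]_n := Q S *m (Q S)^t*.

Lemma nceval_sgn e : nceval Q (fun i => (sgn e i)%:M) =
  \sum_(S : {set 'I_m}) (\prod_(i in S) sgn e i) *: Q S.
Proof.
apply: eq_bigr => S _; rewrite -mul_mx_scalar; congr (_ *m _).
by elim/big_rec2: _ => // i x y _ ->; rewrite -mulmxE -scalar_mxM.
Qed.

Lemma sum_sqfro_mul_coef_le (v : 'rV[R[i]]_n) : \sum_S sqfro (v *m Q S) <= sqfro v.
Proof.
rewrite -(@ler_pM2l _ (2 ^+ m)) ?exprn_gt0// -sqfro_parseval.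
have -> : 2 ^+ m * sqfro v = \sum_(e : {ffun 'I_m -> bool}) sqfro v.
  by rewrite sumr_const card_ffun card_bool card_ord -[RHS]mulr_natl natrX.
apply: ler_sum => e _.
have -> : \sum_(S : {set 'I_m}) (\prod_(i in S) sgn e i) *: (v *m Q S) =
    v *m nceval Q (fun i => (sgn e i)%:M).
  by rewrite nceval_sgn mulmx_sumr; apply: eq_bigr => S _; rewrite scalemxAr.
apply: sqfro_mul_contraction_le; apply: Q_norm => i.
by rewrite /sgn; case: (e i); [left|right].
Qed.

Lemma sum_sqfro_coef_le : \sum_S sqfro (Q S) <= n%:R.
Proof.
under eq_bigr do rewrite sqfro_row.
rewrite exchange_big /= -[X in _ <= X%:R]card_ord -sumr_const.
apply: ler_sum => i _; rewrite -(sqfro_delta_mx (R := R) (0 : 'I_1) i).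
by apply: le_trans (sum_sqfro_mul_coef_le _); apply: ler_sum => S _; rewrite -rowE.
Qed.

Lemma sqfro_coef_le S : sqfro (Q S) <= n%:R.
Proof.
apply: le_trans sum_sqfro_coef_le; rewrite (bigD1 S)//= lerDl.
by apply: sumr_ge0 => *; exact: sqfro_ge0.
Qed.

(* sum_S Q_S Q_S^* is the mean of Q(sigma) Q(sigma)^* over the signs sigma. *)
Lemma sum_gram_coef_form_le (v : 'rV[R[i]]_n) :
  complex.Re ((v *m (\sum_S gram_coef S) *m v^t*) 0 0) <= sqfro v.
Proof.
apply: le_trans (sum_sqfro_mul_coef_le v); rewrite mulmx_sumr mulmx_suml summxE raddf_sum.
apply: ler_sum => S _; rewrite mulmxA -(mulmxA (v *m Q S)) -trmxC_mul.
by rewrite mul_trmxC_row mxE eqxx mulr1n.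
Qed.

Lemma card_coef_le d S : (ncdegree Q <= d)%N -> Q S != 0 -> (#|S| <= d)%N.
Proof.
by move=> Qd QS; apply: leq_trans Qd; rewrite /ncdegree (bigD1 S)//= leq_maxl.
Qed.

Lemma influence_le_max i : \sum_(S : {set 'I_m} | i \in S) sqfro (Q S) <= max_influence Q.
Proof.
under eq_bigr do rewrite -[sqfro _]/(complex.Re (sqfro _)%:C) -mxtrace_mul_trmxC.
exact: (le_bigmax _ _ i).
Qed.

Lemma max_influence_ge0 : 0 <= max_influence Q.
Proof. exact: bigmax_ge_id. Qed.

Definition gram_overlap S S' : R := sqfro ((Q S)^t* *m Q S').

Lemma sum_sqr_influences_le d : (ncdegree Q <= d)%N ->
  \sum_(S : {set 'I_m}) \sum_(S' : {set 'I_m}) #|S :&: S'|%:R * (sqfro (Q S) * sqfro (Q S')) <=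
  max_influence Q * (d%:R * n%:R).
Proof.
move=> Qd; rewrite -sum_sqr_influences.
have inf0 i : 0 <= \sum_(S : {set 'I_m} | i \in S) sqfro (Q S).
  by apply: sumr_ge0 => S _; exact: sqfro_ge0.
apply: (@le_trans _ _
    (max_influence Q * \sum_i \sum_(S : {set 'I_m} | i \in S) sqfro (Q S))).
  rewrite mulr_sumr; apply: ler_sum => i _; rewrite expr2 ler_wpM2r//.
  exact: influence_le_max.
rewrite ler_wpM2l ?max_influence_ge0// sum_influences.
apply: le_trans (ler_wpM2l _ sum_sqfro_coef_le) => //.
rewrite mulr_sumr; apply: ler_sum => S _.
have [->|Q0] := eqVneq (Q S) 0; first by rewrite sqfro0 !mulr0.
by rewrite ler_wpM2r ?sqfro_ge0// ler_nat (card_coef_le Qd).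
Qed.

Lemma sum_gram_overlap_le d c : (ncdegree Q <= d)%N -> 1 <= c ->
  \sum_(S : {set 'I_m}) \sum_(S' : {set 'I_m}) (c ^+ #|S :&: S'| - 1) * gram_overlap S S' <=
  c ^+ d * (max_influence Q * (d%:R * n%:R)).
Proof.
move=> Qd c1; have c0 : 0 <= c by exact: le_trans c1.
apply: le_trans (ler_wpM2l _ (sum_sqr_influences_le Qd)); last exact: exprn_ge0.
rewrite mulr_sumr; apply: ler_sum => S _; rewrite mulr_sumr; apply: ler_sum => S' _.
have overlap_le : gram_overlap S S' <= sqfro (Q S) * sqfro (Q S').
  by apply: le_trans (sqfro_mul_le _ _) _; rewrite sqfro_trmxC.
have overlap0 : 0 <= gram_overlap S S' by exact: sqfro_ge0.
have [Q0|Q0] := eqVneq (Q S) 0.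
  by rewrite /gram_overlap Q0 trmxC0 mul0mx sqfro0 mulr0 mul0r !mulr0.
have [SS0|SS] := eqVneq #|S :&: S'| 0%N; first by rewrite SS0 expr0 subrr !mul0r mulr0.
apply: (@le_trans _ _ (c ^+ d * gram_overlap S S')).
  rewrite ler_wpM2r// lerBlDr ler_wpDr// ler_weXn2l//.
  by apply: leq_trans (card_coef_le Qd Q0); exact/subset_leq_card/subsetIl.
rewrite ler_wpM2l ?exprn_ge0//; apply: le_trans overlap_le _.
by rewrite ler_peMl ?mulr_ge0 ?sqfro_ge0// ler1n lt0n.
Qed.

End bounded_polynomial.

(** * The Gram matrix of the random polynomial *)

Section decomposition.
Context {R : realType} (m n k : nat) (o : 'I_n).
Hypothesis k_gt0 : (0 < k)%N.
Local Notation p := (n * k)%N.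
Local Notation corner := (pid_mx n : 'M[R[i]]_(n, p)).
Local Notation idx := (index_enum 'I_m).
Variable Q : ncpoly R m n.
Hypothesis Q_norm : sign_bounded Q.
Variables (g : 'I_m -> 'M[R[i]]_n) (h : 'I_m -> 'M[R[i]]_p).

Definition iotaeval : 'M[R[i]]_p :=
  nceval (iotapoly p Q) (fun i => ampliation k (g i) *m h i).

Definition evalrows : 'M[R[i]]_(n, p) := \sum_S Q S *m (corner *m word g h S idx).

Definition residual S1 S2 : 'M[R[i]]_n :=
  \matrix_(x, y) (hybrid g h S1 S2 idx [::] x y - meanmx g S1 S2 idx o o * (x == y)%:R).

Definition gram_error : 'M[R[i]]_n := \sum_S1 \sum_S2 Q S1 *m residual S1 S2 *m (Q S2)^t*.

Definition gram_main : 'M[R[i]]_n := \sum_S (scalar_mean o false g S idx)%:C *: gram_coef Q S.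

Lemma iotaevalE : iotaeval = corner^t* *m evalrows.
Proof.
rewrite corner_trmxC mulmx_sumr; apply: eq_bigr => S _.
by rewrite ffunE /iotamx !mulmxA.
Qed.

Lemma mul_word_trmxC S1 S2 :
  (corner *m word g h S1 idx) *m (corner *m word g h S2 idx)^t* =
  residual S1 S2 + (meanmx g S1 S2 idx o o)%:M.
Proof.
apply/matrixP => x y; rewrite [RHS]mxE [residual _ _ _ _]mxE [X in _ + X]mxE.
rewrite mulr_natr subrK /hybrid /= ampliation1 mulmx1.
by rewrite [LHS]mxE [RHS]mxE; apply: eq_bigr => j _; rewrite !trmxCE !mxE.
Qed.

Lemma sum_meanmx_coef (S : {set 'I_m}) :
  \sum_(S' : {set 'I_m}) meanmx g S S' idx o o *: (Q S *m (Q S')^t*) =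
  (scalar_mean o false g S idx)%:C *: gram_coef Q S.
Proof.
rewrite (bigD1 S)//= (meanmx_scalar_mean o g S idx).2 big1 ?addr0// => S' SS.
rewrite meanmx_eq0 ?mxE ?scale0r//; apply/hasP.
have [i iSS] : exists i, (i \in S) != (i \in S') by apply: neq_set_mem; rewrite eq_sym.
by exists i; rewrite ?mem_index_enum.
Qed.

Lemma evalrows_gram : evalrows *m evalrows^t* = gram_error + gram_main.
Proof.
rewrite {1}/evalrows mulmx_suml -big_split /=; apply: eq_bigr => S1 _.
rewrite /= -sum_meanmx_coef -big_split /evalrows trmxC_sum mulmx_sumr.
apply: eq_bigr => S2 _.
rewrite trmxC_mul [LHS]mulmxA -(mulmxA (Q S1)) mul_word_trmxC.
by rewrite mulmxDr mulmxDl mul_mx_scalar -scalemxAl.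
Qed.

Lemma retr_sqr_excess_eval_le_dist :
  retr (spectral_calc sqr_excess (absmx iotaeval)) <=
  2^-1 * sqfro gram_error + 2^-1 * sqfro (gram_main - \sum_S gram_coef Q S).
Proof.
set Y := \sum_S gram_coef Q S.
apply: le_trans (retr_sqr_excess_le_dist iotaeval (Y := corner^t* *m Y *m corner) _) _.
  move=> v; rewrite !mulmxA -[v *m _ *m _ *m _ *m _]mulmxA.
  rewrite -[X in _ *m (X *m _)]trmxCK -trmxC_mul.
  exact: le_trans (sum_gram_coef_form_le Q_norm _) (sqfro_mul_corner_trmxC_le k_gt0 _).
have -> : iotaeval *m iotaeval^t* - corner^t* *m Y *m corner =
    corner^t* *m (gram_error + (gram_main - Y)) *m corner.
  rewrite iotaevalE trmxC_mul trmxCK addrA -evalrows_gram mulmxBr mulmxBl.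
  by rewrite !mulmxA.
rewrite sqfro_mul_corner// sqfro_corner_trmxC_mul//.
by have := sqfroD_le gram_error (gram_main - Y); lra.
Qed.

Lemma retr_sqr_excess_eval_le_mxtrace s : 0 < s ->
  retr (spectral_calc sqr_excess (absmx iotaeval)) <=
  2^-1 * (n%:R * s + sqfro gram_error / s) +
  \sum_S sqfro (Q S) * scalar_mean o false g S idx.
Proof.
move=> s0; apply: le_trans (retr_sqr_excess_le_sqfro _) _.
rewrite iotaevalE sqfro_corner_trmxC_mul//.
rewrite -[sqfro _]/(complex.Re (sqfro _)%:C) -mxtrace_mul_trmxC evalrows_gram !raddfD /=.
apply: lerD; first exact: Re_mxtrace_le.
rewrite (raddf_sum (@mxtrace _ n)) (raddf_sum (@complex.Re R)); apply: ler_sum => S _ /=.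
by rewrite mxtraceZ mxtrace_mul_trmxC -rmorphM /= mulrC.
Qed.

Lemma sqfro_gram_error_le : sqfro gram_error <=
  #|{: {set 'I_m} * {set 'I_m}}|%:R * n%:R ^+ 2 *
  \sum_(SS : {set 'I_m} * {set 'I_m})
     ((Q SS.1 != 0) && (Q SS.2 != 0))%:R * sqfro (residual SS.1 SS.2).
Proof.
rewrite /gram_error pair_big /=; apply: le_trans (sqfro_sum_le _) _.
rewrite -mulrA ler_wpM2l// mulr_sumr; apply: ler_sum => -[S1 S2] _ /=.
have [->|Q1] := eqVneq (Q S1) 0; first by rewrite !mul0mx sqfro0 mul0r mulr0.
have [->|Q2] := eqVneq (Q S2) 0; first by rewrite trmxC0 mulmx0 sqfro0 mul0r mulr0.
rewrite mul1r; apply: le_trans (sqfro_mul_le _ _) _; rewrite sqfro_trmxC.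
have -> : n%:R ^+ 2 * sqfro (residual S1 S2) = n%:R * sqfro (residual S1 S2) * n%:R by ring.
apply: ler_pM; rewrite ?sqfro_ge0 ?sqfro_coef_le//.
apply: le_trans (sqfro_mul_le _ _) _.
by rewrite ler_wpM2r ?sqfro_ge0 ?sqfro_coef_le.
Qed.

End decomposition.

(* Each of the m averaging steps costs 64 n^3 / p times the mean of a weight, which is
   at most (2 n^2)^m c2^(2 d); the steps add up with the factor 4^m. *)
Definition residual_const {R : realType} (m n : nat) : R :=
  n%:R ^+ 2 * (4 ^+ m * (64 * n%:R ^+ 3 * (2 * n%:R ^+ 2) ^+ m)).

Definition error_const {R : realType} (m n : nat) : R :=
  (#|{: {set 'I_m} * {set 'I_m}}|%:R * n%:R) ^+ 2 * residual_const m n.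

Lemma error_const_ge0 {R : realType} m n : 0 <= error_const m n :> R.
Proof. by rewrite /error_const /residual_const !(mulr_ge0, exprn_ge0). Qed.

Section random_evaluation.
Context {R : realType} (m n k : nat) (o : 'I_n).
Hypotheses (o0 : val o = 0%N) (k_gt0 : (0 < k)%N).
Local Notation p := (n * k)%N.
Local Notation idx := (index_enum 'I_m).
Variables (Q : ncpoly R m n) (d : nat).
Hypothesis Q_degree : (ncdegree Q <= d)%N.
Hypothesis Q_norm : sign_bounded Q.
Variable calG : probability (cmx R n) R.
Variable c2 : R.
Hypothesis c2_ge1 : 1 <= c2.
Hypothesis GG_mean : unit_gram_mean calG.
Hypothesis GG2_le : sqr_gram_mean_le calG c2.
Context {disp : measure_display} {T : measurableType disp} (P : probability T R).
Variables (G : 'I_m -> {RV P >-> cmx R n}) (H : 'I_m -> {RV P >-> cmx R p}).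
Hypothesis G_law : forall (i : 'I_m) (A : set (cmx R n)), measurable A ->
  distribution P (G i) A = calG A.
Hypothesis H_haar : forall i, haar_unitary (distribution P (H i)).
Hypothesis GH_indep : mutually_independent P (source_events G H).

Let g w : 'I_m -> 'M[R[i]]_n := fun i => G i w.
Let h w : 'I_m -> 'M[R[i]]_p := fun i => H i w.
Let n_gt0 : (0 < n)%N.
Proof. exact: leq_trans (ltn_ord o). Qed.
Let size_idx : size idx = m.
Proof. by rewrite -sum1_size sum1_card card_ord. Qed.
Let c2_ge0 : 0 <= c2.
Proof. exact: le_trans c2_ge1. Qed.
Let mean S w := scalar_mean o false (g w) S idx.

Let nnmeasurable_mean S : nnmeasurable (mean S).
Proof.
apply: (nnmeasurable_scalar_mean o (W := T) (g := fun i w => G i w)) => i _.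
exact: mxmeasurable_G.
Qed.

Let mxmeasurable_residual S1 S2 : mxmeasurable (fun w => residual o (g w) (h w) S1 S2).
Proof.
move=> x y; under eq_fun do rewrite mxE; apply: cmeasurableB.
  by apply: (cmeasurable_hybrid (W := T)) => i _; [exact: mxmeasurable_G|exact: mxmeasurable_H].
apply: cmeasurableM; last exact: cmeasurable_cst.
by apply: (mxmeasurable_meanmx (W := T)) => i _; exact: mxmeasurable_G.
Qed.

Lemma expectation_weight_degree_le S1 S2 : Q S1 != 0 -> Q S2 != 0 ->
  ('E_P[fun w => weight (g w) S1 S2 idx] <=
   ((2 * n%:R ^+ 2) ^+ m * c2 ^+ (2 * d))%R%:E)%E.
Proof.
move=> Q1 Q2; set b : R := 2 * n%:R ^+ 2.
have b1 : 1 <= b by rewrite mulr_ege1 ?exprn_ege1 ?ler1n.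
apply: le_trans (expectation_weight_le o GH_indep G_law c2_ge1 GG2_le S1 S2
  (index_enum_uniq _)) _.
rewrite lee_fin exprMn ler_pM ?exprn_ge0 ?(le_trans _ b1)//.
  by rewrite -[X in _ <= b ^+ X]size_idx ler_weXn2l ?count_size.
rewrite ler_weXn2l// mul2n -addnn.
have cardE (S : {set 'I_m}) : count (mem S) idx = #|S| by rewrite -sum1_count sum1_card.
apply: leq_trans (leq_add (card_coef_le Q_degree Q1) (card_coef_le Q_degree Q2)).
by rewrite -!cardE -count_predUI leq_addr.
Qed.

Lemma expectation_residual_le S1 S2 : Q S1 != 0 -> Q S2 != 0 ->
  ('E_P[fun w => sqfro (residual o (g w) (h w) S1 S2)] <=
   (residual_const m n * (c2 ^+ (2 * d) / p%:R))%R%:E)%E.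
Proof.
move=> Q1 Q2; pose kappa : R := 64 * n%:R ^+ 3 / p%:R.
pose K := kappa * ((2 * n%:R ^+ 2) ^+ m * c2 ^+ (2 * d)).
have entry_le x y :
    ('E_P[fun w => sqnormc (residual o (g w) (h w) S1 S2 x y)] <= (4 ^+ m * K)%:E)%E.
  have u : uniq (idx ++ [::]) by rewrite cats0 index_enum_uniq.
  have := hybrid_concentration n_gt0 k_gt0 GH_indep H_haar x y o0 u (K := K).
  rewrite size_idx => /(_ S1 S2) concentration.
  under eq_fun do rewrite mxE -[X in meanmx _ _ _ X]cats0.
  apply: concentration; rewrite cats0; apply: ge0_expectationZ_le.
  - by rewrite divr_ge0// mulr_ge0// exprn_ge0.
  - by apply: (nnmeasurable_weight (W := T)) => i _; exact: mxmeasurable_G.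
  - exact: expectation_weight_degree_le.
apply: le_trans (expectation_sqfro_le _ entry_le) _; first exact: mxmeasurable_residual.
rewrite lee_fin le_eqVlt; apply/orP; left; apply/eqP.
by rewrite /residual_const /K /kappa; ring.
Qed.

Lemma expectation_gram_error_le :
  ('E_P[fun w => sqfro (gram_error o Q (g w) (h w))] <=
   (error_const m n * (c2 ^+ (2 * d) / p%:R))%R%:E)%E.
Proof.
set N := #|{: {set 'I_m} * {set 'I_m}}|; set K := residual_const m n * (c2 ^+ (2 * d) / p%:R).
pose pairs (SS : {set 'I_m} * {set 'I_m}) := (Q SS.1 != 0) && (Q SS.2 != 0).
have K0 : 0 <= K.
  by rewrite /K /residual_const mulr_ge0 ?divr_ge0 ?exprn_ge0 ?(mulr_ge0, exprn_ge0).
have mres SS : nnmeasurable (fun w => sqfro (residual o (g w) (h w) SS.1 SS.2)).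
  by apply: nnmeasurable_sqfro; exact: mxmeasurable_residual.
have N0 : 0 <= N%:R * n%:R ^+ 2 :> R by rewrite mulr_ge0.
apply: (@le_trans _ _ ('E_P[(fun w => N%:R * n%:R ^+ 2 * \sum_SS
    (pairs SS)%:R * sqfro (residual o (g w) (h w) SS.1 SS.2))%R])%E).
  by apply: ge0_le_expectation => w; [exact: sqfro_ge0|exact: sqfro_gram_error_le].
apply: (@le_trans _ _ (N%:R * n%:R ^+ 2 * \sum_SS (pairs SS)%:R * K)%:E).
  apply: ge0_expectationZ_le => //.
    by apply: nnmeasurable_sum => SS; apply: nnmeasurableZ => //; exact: mres.
  apply: ge0_expectation_lincomb_le => // -[S1 S2] /=.
  rewrite ltr0n lt0b => /andP[Q1 Q2]; exact: (expectation_residual_le Q1 Q2).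
rewrite lee_fin -mulr_suml [leRHS](_ : _ = N%:R * n%:R ^+ 2 * (N%:R * K)); last first.
  by rewrite /error_const /K -/N; ring.
rewrite ler_wpM2l// ler_wpM2r// -natr_sum ler_nat /N -sum1_card.
by apply: leq_sum => SS _; case: (pairs SS).
Qed.

Lemma expectation_gram_main_dist_le :
  ('E_P[fun w => sqfro (gram_main o Q (g w) - \sum_S gram_coef Q S)] <=
   (c2 ^+ d * (max_influence Q * (d%:R * n%:R)))%R%:E)%E.
Proof.
have meanB w : gram_main o Q (g w) - \sum_S gram_coef Q S =
    \sum_S (mean S w - 1)%:C *: gram_coef Q S.
  rewrite -sumrB; apply: eq_bigr => S _.
  by rewrite rmorphB /= rmorph1 scalerBl scale1r.
under eq_fun do rewrite meanB.
apply: le_trans (expectation_sqfro_centered_le (y := mean)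
  (rho := fun S S' => c2 ^+ #|S :&: S'|) _ _ _ _) _ => //.
- by move=> S S'; rewrite frodot_gram sqfro_ge0.
- by move=> S; apply: (expectation_scalar_mean o GH_indep G_law GG_mean);
    exact: index_enum_uniq.
- move=> S S'; apply: le_trans (expectation_scalar_meanM_le o GH_indep G_law GG_mean
    GG2_le _ _ _ _ (index_enum_uniq _)) _.
  rewrite lee_fin -sum1_count sum1_card (_ : #|_| = #|S :&: S'|)//.
  by apply: eq_card => i; rewrite inE.
rewrite lee_fin; apply: le_trans (sum_gram_overlap_le Q_norm Q_degree c2_ge1).
by apply: ler_sum => S _; apply: ler_sum => S' _; rewrite frodot_gram.
Qed.

Let excess w : R := n%:R^-1 * retr (spectral_calc sqr_excess (absmx (iotaeval Q (g w) (h w)))).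

Let excess_ge0 w : 0 <= excess w.
Proof. by rewrite mulr_ge0 ?invr_ge0// retr_sqr_excess_ge0. Qed.

Let nnmeasurable_gram_error : nnmeasurable (fun w => sqfro (gram_error o Q (g w) (h w))).
Proof.
apply: nnmeasurable_sqfro; apply: mxmeasurable_sum => S; apply: mxmeasurable_sum => S'.
by apply: mxmeasurableM; [apply: mxmeasurableM|]; [exact: mxmeasurable_cst| |
  exact: mxmeasurable_cst].
Qed.

Let nnmeasurable_gram_main_dist :
  nnmeasurable (fun w => sqfro (gram_main o Q (g w) - \sum_S gram_coef Q S)).
Proof.
apply: nnmeasurable_sqfro; apply: mxmeasurableB; last exact: mxmeasurable_cst.
apply: mxmeasurable_sum => S; apply: mxmeasurableZ; last exact: mxmeasurable_cst.
exact/cmeasurable_real/(nnmeasurable_mean S).1.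
Qed.

Lemma expectation_excess_le_dist :
  ('E_P[excess] <=
   (n%:R^-1 * (2^-1 * (error_const m n * (c2 ^+ (2 * d) / p%:R)) +
               2^-1 * (c2 ^+ d * (max_influence Q * (d%:R * n%:R)))))%R%:E)%E.
Proof.
have nV0 : 0 <= n%:R^-1 :> R by rewrite invr_ge0.
have half0 : 0 <= 2^-1 :> R by rewrite invr_ge0.
apply: (@le_trans _ _ ('E_P[(fun w => n%:R^-1 *
    (2^-1 * sqfro (gram_error o Q (g w) (h w)) +
     2^-1 * sqfro (gram_main o Q (g w) - \sum_S gram_coef Q S)))%R])%E).
  apply: ge0_le_expectation => // w; rewrite ler_wpM2l//.
  exact: retr_sqr_excess_eval_le_dist.
apply: ge0_expectationZ_le => //; first by apply: nnmeasurableD; exact: nnmeasurableZ.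
apply: ge0_expectationD_le; try exact: nnmeasurableZ.
  by apply: ge0_expectationZ_le => //; exact: expectation_gram_error_le.
by apply: ge0_expectationZ_le => //; exact: expectation_gram_main_dist_le.
Qed.

Lemma expectation_excess_le_mxtrace s : 0 < s ->
  ('E_P[excess] <=
   (n%:R^-1 * (2^-1 * (n%:R * s + error_const m n * (c2 ^+ (2 * d) / p%:R) / s) + n%:R))%R%:E)%E.
Proof.
move=> s0; have nV0 : 0 <= n%:R^-1 :> R by rewrite invr_ge0.
have mmean : nnmeasurable (fun w => \sum_S sqfro (Q S) * mean S w).
  by apply: nnmeasurable_sum => S; apply: nnmeasurableZ => //; exact: sqfro_ge0.
have sV0 : 0 <= s^-1 by rewrite invr_ge0 ltW.
have ns0 : nnmeasurable ((fun=> n%:R * s) : T -> R).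
  by apply: nnmeasurable_cst; rewrite mulr_ge0// ltW.
have merr : nnmeasurable (fun w => sqfro (gram_error o Q (g w) (h w)) / s).
  by under eq_fun do rewrite mulrC; exact: nnmeasurableZ.
apply: (@le_trans _ _ ('E_P[(fun w => n%:R^-1 *
    (2^-1 * (n%:R * s + sqfro (gram_error o Q (g w) (h w)) / s) +
     \sum_S sqfro (Q S) * mean S w))%R])%E).
  apply: ge0_le_expectation => // w; rewrite ler_wpM2l//.
  exact: retr_sqr_excess_eval_le_mxtrace.
apply: ge0_expectationZ_le => //.
  by apply: nnmeasurableD => //; apply: nnmeasurableZ => //; exact: nnmeasurableD.
apply: ge0_expectationD_le => //; first by apply: nnmeasurableZ => //; exact: nnmeasurableD.
- apply: ge0_expectationZ_le => //; first exact: nnmeasurableD.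
  apply: ge0_expectationD_le => //; first by rewrite expectation_cst.
  under eq_fun do rewrite mulrC; rewrite [X in (_ <= X%:E)%E]mulrC.
  by apply: ge0_expectationZ_le => //; exact: expectation_gram_error_le.
- rewrite (ge0_expectation_lincomb (e := fun=> 1))// => [|S|S]; last 2 first.
  + exact: sqfro_ge0.
  + by apply: (expectation_scalar_mean o GH_indep G_law GG_mean); exact: index_enum_uniq.
  by rewrite lee_fin; under eq_bigr do rewrite mulr1; exact: sum_sqfro_coef_le.
Qed.

End random_evaluation.

(** * The inequality *)

(* Either the first term is absorbed by the last one, or K < z u and it is at most K z^2. *)
Lemma absorb_error_le (R : realFieldType) (K z u s : R) : 1 <= K -> 1 <= z -> 0 < u ->
  0 <= s -> s <= 1 -> K * z ^+ 2 * s <= z ^+ 9 * u + K ^+ 3 * ((u ^+ 2)^-1 * s).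
Proof.
move=> K1 z1 u0 s0 s1; have K0 : 0 < K by exact: lt_le_trans K1.
have z0 : 0 < z by exact: lt_le_trans z1.
have u20 : 0 < u ^+ 2 by exact: exprn_gt0.
have [Kzu|Kzu] := leP (K * z ^+ 2) (K ^+ 3 / u ^+ 2).
  rewrite [X in _ + X]mulrA (le_trans (ler_wpM2r s0 Kzu))// lerDr.
  by rewrite mulr_ge0 ?exprn_ge0 ?ltW.
have {}Kzu : K <= z * u.
  rewrite -(@ler_pXn2r _ 2) ?nnegrE ?mulr_ge0 ?(ltW z0) ?(ltW u0) ?(ltW K0)//.
  rewrite -(ler_pM2l K0) -exprS exprMn mulrA.
  by rewrite -ler_pdivrMr// ltW.
rewrite ler_wpDr//; first by rewrite !mulr_ge0 ?invr_ge0 ?exprn_ge0// ltW.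
apply: (@le_trans _ _ (z ^+ 3 * u)); last by rewrite ler_wpM2r ?ler_weXn2l// ltW.
rewrite (_ : z ^+ 3 * u = (z * u) * z ^+ 2 * 1); last by ring.
have z20 : 0 <= z ^+ 2 by exact: sqr_ge0.
by rewrite ler_pM ?ler_wpM2r// mulr_ge0// ltW.
Qed.

Section constants.
Context {R : realFieldType} (c2 c3 : R) (d : nat).
Hypotheses (c2_ge1 : 1 <= c2) (c3_ge1 : 1 <= c3) (d_gt0 : (0 < d)%N).
Local Notation B := ((8 * c2 * c3) ^+ (9 * d)).

Let exp8_le (x : R) : 1 <= x -> 8 ^+ (9 * d) * x ^+ (9 * d) <= (8 * x * c3) ^+ (9 * d).
Proof.
by move=> x1; rewrite !exprMn ler_peMr ?exprn_ege1// mulr_ge0 ?exprn_ge0// (le_trans _ x1).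
Qed.

Lemma exp9_le_constant : 8 * (c2 ^+ d) ^+ 9 <= B.
Proof.
have c20 : 0 <= c2 by exact: le_trans c2_ge1.
apply: le_trans (exp8_le c2_ge1); rewrite -exprM mulnC ler_wpM2r ?exprn_ge0//.
by rewrite -[leLHS]expr1 ler_weXn2l ?ler1n// muln_gt0.
Qed.

Lemma degree_exp_le_constant : d%:R * c2 ^+ d <= B.
Proof.
have c20 : 0 <= c2 by exact: le_trans c2_ge1.
apply: le_trans (exp8_le c2_ge1); apply: ler_pM; rewrite ?exprn_ge0//; last first.
  by rewrite ler_weXn2l// leq_pmull.
rewrite -natrX ler_nat (leq_trans (leq_pmull d (isT : 0 < 9)%N))// ltnW//.
exact: ltn_expl.
Qed.

End constants.

Section final_estimates.
Context {R : realType} (c2 c3 tau E : R) (d n p : nat).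
Hypotheses (c2_ge1 : 1 <= c2) (c3_ge1 : 1 <= c3) (tau_gt0 : 0 < tau) (E_ge0 : 0 <= E).
Hypotheses (d_gt0 : (0 < d)%N) (n_gt0 : (0 < n)%N) (p_gt0 : (0 < p)%N).
Local Notation B := ((8 * c2 * c3) ^+ (9 * d)).
Local Notation u := (tau `^ (1 / 6)).
Local Notation s := (p%:R `^ (- (1 / 2))).
Local Notation z := (c2 ^+ d).

Let u_gt0 : 0 < u.
Proof. exact: powR_gt0. Qed.

Let u6 : u ^+ 6 = tau.
Proof. by rewrite -powR_mulrn ?powR_ge0// -powRrM divfK// powRr1// ltW. Qed.

Let p_gt0R : 0 < p%:R :> R.
Proof. by rewrite ltr0n. Qed.

Let s_gt0 : 0 < s :> R.
Proof. exact: powR_gt0. Qed.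

Let s2 : s ^+ 2 = p%:R^-1 :> R.
Proof. by rewrite -powR_mulrn ?powR_ge0// -powRrM mulNr divfK// powRN powRr1. Qed.

Let s_le1 : s <= 1 :> R.
Proof.
by rewrite -(@ler_pXn2r _ 2) ?nnegrE ?(ltW s_gt0)// s2 expr1n invf_le1// ler1n.
Qed.

Let z_ge1 : 1 <= z.
Proof. exact: exprn_ege1. Qed.

Let z2E : c2 ^+ (2 * d) = z ^+ 2.
Proof. by rewrite -exprM mulnC. Qed.

Let half_nV_le1 : n%:R^-1 / 2 <= 1 :> R.
Proof. by rewrite mulr_ile1 ?invr_ge0 ?invf_le1 ?ler1n ?ltr0n. Qed.

Lemma dist_bound_le : tau <= 1 ->
  n%:R^-1 * (2^-1 * (E * (c2 ^+ (2 * d) / p%:R)) + 2^-1 * (z * (tau * (d%:R * n%:R)))) <=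
  2^-1 * (B * u) + (1 + E) * z ^+ 2 * s.
Proof.
move=> tau1; rewrite z2E mulrDr addrC; apply: lerD.
  have tau_le : tau <= u.
    have u1 : u <= 1 by rewrite -(@ler_pXn2r _ 6) ?nnegrE ?(ltW u_gt0)// u6 expr1n.
    by rewrite -[leLHS]u6 -[leRHS]expr1 ler_wiXn2l// ltW.
  have -> : n%:R^-1 * (2^-1 * (z * (tau * (d%:R * n%:R)))) = 2^-1 * (d%:R * z * tau).
    by field; rewrite gt_eqF ?ltr0n.
  rewrite ler_pM2l// ler_pM ?degree_exp_le_constant ?(ltW tau_gt0)// mulr_ge0//.
  by rewrite (le_trans _ z_ge1).
have -> : n%:R^-1 * (2^-1 * (E * (z ^+ 2 / p%:R))) = n%:R^-1 / 2 * E * z ^+ 2 * p%:R^-1 by ring.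
have z20 : 0 <= z ^+ 2 by exact: sqr_ge0.
have nE0 : 0 <= n%:R^-1 / 2 * E by rewrite mulr_ge0.
apply: ler_pM; rewrite ?(mulr_ge0 nE0) ?invr_ge0//; last first.
  by rewrite -s2 expr2 ler_piMr// ltW.
rewrite ler_wpM2r//; apply: (@le_trans _ _ E); last by rewrite lerDr.
by rewrite ler_piMl.
Qed.

Lemma mxtrace_bound_le : 1 <= tau ->
  n%:R^-1 * (2^-1 * (n%:R * s + E * (c2 ^+ (2 * d) / p%:R) / s) + n%:R) <=
  2^-1 * (B * u) + (1 + E) * z ^+ 2 * s.
Proof.
move=> tau1; rewrite z2E -s2.
have -> : n%:R^-1 * (2^-1 * (n%:R * s + E * (z ^+ 2 * s ^+ 2) / s) + n%:R) =
    1 + (2^-1 * s + n%:R^-1 / 2 * E * z ^+ 2 * s).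
  by field; rewrite !gt_eqF ?ltr0n.
apply: lerD.
  have u1 : 1 <= u.
    rewrite leNgt; apply/negP => u1; move: tau1; apply/negP; rewrite -ltNge -u6.
    by rewrite exprn_ilt1// ltW.
  have B2 : 2 <= B.
    apply: le_trans (exp9_le_constant c2_ge1 c3_ge1 d_gt0).
    by have := exprn_ege1 9 z_ge1; lra.
  by rewrite ler_pdivlMl// ler_pM.
rewrite 2!mulrDl; apply: lerD; rewrite ler_wpM2r ?(ltW s_gt0)//.
  by rewrite mul1r (le_trans _ (exprn_ege1 2 z_ge1))// invf_le1 ?ler1n.
by rewrite ler_wpM2r ?sqr_ge0// ler_piMl.
Qed.

Lemma absorbed_bound_le :
  2^-1 * (B * u) + (1 + E) * z ^+ 2 * s <=
  B * n%:R `^ (1 / 2) * u + (1 + E) ^+ 3 * (tau `^ (- (1 / 3)) * s).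
Proof.
have -> : tau `^ (- (1 / 3)) = (u ^+ 2)^-1.
  rewrite powRN; congr (_^-1); rewrite -powR_mulrn ?powR_ge0// -powRrM.
  by congr (_ `^ _); field.
have K1 : 1 <= 1 + E by rewrite lerDl.
have := absorb_error_le K1 z_ge1 u_gt0 (ltW s_gt0) s_le1.
have zB : 8 * (z ^+ 9 * u) <= B * u.
  by rewrite mulrA ler_wpM2r ?(ltW u_gt0)// exp9_le_constant.
have zu0 : 0 <= z ^+ 9 * u.
  by apply: mulr_ge0; [exact/exprn_ge0/(le_trans _ z_ge1)|exact: ltW].
have B0 : 0 <= B * u by apply: le_trans zB; rewrite mulr_ge0.
have rootn : 1 <= n%:R `^ (1 / 2) :> R.
  by rewrite -[leLHS](powRr0 n%:R) ler_powR ?ler1n// divr_ge0.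
have : B * u <= B * n%:R `^ (1 / 2) * u by rewrite [leRHS]mulrAC ler_peMr.
lra.
Qed.

End final_estimates.

Theorem theorem1p4 (R : realType) (m n : nat) (m_gt0 : (0 < m)%N)
    (n_gt0 : (0 < n)%N) :
  exists C : R, 0 < C /\
  forall (d k : nat) (d_gt0 : (0 < d)%N) (k_gt0 : (0 < k)%N)
    (Q : ncpoly R m n) (degQ : ncdegree Q = d)
    (normQ : forall sigma : 'I_m -> R[i],
       (forall i, sigma i = -1 \/ sigma i = 1) ->
       opnorm (nceval Q (fun i => (sigma i)%:M)) <= 1)
    (tau_gt0 : 0 < max_influence Q)
    (calG : probability (cmx R n) R)
    (G_int : mx_integrable calG (fun g : 'M[R[i]]_n => g))
    (G_mean : mx_expectation calG (fun g : 'M[R[i]]_n => g) = 0)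
    (GG_int : mx_integrable calG (fun g : 'M[R[i]]_n => g *m g ^t*))
    (GG_mean :
       mx_expectation calG (fun g : 'M[R[i]]_n => g *m g ^t*) = 1%:M)
    (c2 c3 : R) (c2_ge1 : 1 <= c2) (c3_ge1 : 1 <= c3)
    (GG2_int : mx_integrable calG (fun g : 'M[R[i]]_n => (g *m g ^t*) ^+ 2))
    (GG2_le : opnorm
       (mx_expectation calG (fun g : 'M[R[i]]_n => (g *m g ^t*) ^+ 2)) <= c2)
    (GG3_int : mx_integrable calG (fun g : 'M[R[i]]_n => (g *m g ^t*) ^+ 3))
    (GG3_le : opnorm
       (mx_expectation calG (fun g : 'M[R[i]]_n => (g *m g ^t*) ^+ 3)) <= c3)
    (disp : measure_display) (T : measurableType disp) (P : probability T R)
    (G : 'I_m -> {RV P >-> cmx R n})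
    (H : 'I_m -> {RV P >-> cmx R (n * k)%N})
    (G_law : forall (i : 'I_m) (A : set (cmx R n)), measurable A ->
       distribution P (G i) A = calG A)
    (H_law : forall i : 'I_m, haar_unitary (distribution P (H i)))
    (GH_indep : mutually_independent P
       (fun i : 'I_m + 'I_m =>
          match i with
          | inl a => rv_events (G a)
          | inr b => rv_events (H b)
          end)),
  ('E_P[(fun w : T => n%:R^-1 *
       retr (spectral_calc (fun t : R => Num.max 0 (t - 1) ^+ 2)
         (absmx (nceval (iotapoly (n * k) Q)
            (fun i : 'I_m => ampliation k (G i w) *m H i w)))))%R]
   <= ((8 * c2 * c3) ^+ (9 * d) * n%:R `^ (1 / 2)
         * max_influence Q `^ (1 / 6)
       + C * (max_influence Q `^ (- (1 / 3))
              * (n * k)%:R `^ (- (1 / 2))))%R%:E)%E.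
Proof.
exists ((1 + error_const m n) ^+ 3); split.
  by rewrite exprn_gt0// ltr_wpDr ?error_const_ge0.
move=> d k d_gt0 k_gt0 Q degQ normQ tau_gt0 calG _ _ GG_int GG_mean c2 c3 c2_ge1 c3_ge1.
move=> GG2_int GG2_le _ _ disp T P G H G_law H_law GH_indep.
have o0 : val (Ordinal n_gt0) = 0%N by [].
have p_gt0 : (0 < n * k)%N by rewrite muln_gt0 n_gt0.
have s_gt0 : 0 < (n * k)%:R `^ (- (1 / 2)) :> R by rewrite powR_gt0 ?ltr0n.
have degQ_le : (ncdegree Q <= d)%N by rewrite degQ.
have E0 := @error_const_ge0 R m n.
apply: le_trans (_ : _ <= _%:E)%E _; last first.
  by rewrite lee_fin; exact: absorbed_bound_le c2_ge1 c3_ge1 tau_gt0 E0 d_gt0 n_gt0 p_gt0.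
have [tau1|tau1] := leP (max_influence Q) 1.
- apply: le_trans (expectation_excess_le_dist o0 k_gt0 degQ_le normQ c2_ge1
    (conj GG_int GG_mean) (conj GG2_int GG2_le) G_law H_law GH_indep) _.
  by rewrite lee_fin dist_bound_le.
- apply: le_trans (expectation_excess_le_mxtrace o0 k_gt0 degQ_le normQ c2_ge1
    (conj GG_int GG_mean) (conj GG2_int GG2_le) G_law H_law GH_indep s_gt0) _.
  by rewrite lee_fin mxtrace_bound_le// ltW.
Qed.
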